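(* Let $\Gamma,\Gamma'$ be additive subgroups of $\mathbb{F}^4$ satisfying condition (A) of the context, and let $J=J_1\times J_2\times J_3\times J_4$, $J'=J'_1\times J'_2\times J'_3\times J'_4$ with each $J_p,J'_p\in\{\{0\},\mathbb{N}\}$. The Lie algebras $\mathcal{B}=\mathcal{B}(\Gamma,J)$ and $\mathcal{B}'=\mathcal{B}(\Gamma',J')$ of Xu type are isomorphic if and only if there exist $a_1,a_2,a_3,a_4\in\mathbb{F}$ with $a_2,a_4\neq0$, with $a_1=0$ if $J_1=\{0\}\neq J_2$, and with $a_3=0$ if $J_3=\{0\}\neq J_4$, such that either (i) $J=J'$ and the map $$\phi:\beta=(\beta_1,\beta_2,\beta_3,\beta_4)\mapsto(\beta_1+a_1\beta_2,\ a_2\beta_2,\ \beta_3+a_3\beta_4,\ a_4\beta_4)$$ is a group isomorphism $\Gamma\cong\Gamma'$; or else (ii) $(J_1,J_2,J_3,J_4)=(J'_3,J'_4,J'_1,J'_2)$ and the map $$\phi:\beta=(\beta_1,\beta_2,\beta_3,\beta_4)\mapsto(\beta_3+a_3\beta_4,\ a_4\beta_4,\ \beta_1+a_1\beta_2,\ a_2\beta_2)$$ is a group isomorphism $\Gamma\cong\Gamma'$.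
   Context: $\mathbb{F}$ is an algebraically closed field of characteristic $0$; all vector spaces are over $\mathbb{F}$; $\mathbb{N}=\{0,1,2,\dots\}$. For $a\in\mathbb{F}$ and $p\in\{1,2,3,4\}$, $a_{[p]}\in\mathbb{F}^4$ denotes the vector with $a$ in position $p$ and $0$ elsewhere. Elements of $\mathbb{F}^4$ are written $\alpha=(\alpha_1,\alpha_2,\alpha_3,\alpha_4)$. Condition (A) on an additive subgroup $\Gamma\subseteq\mathbb{F}^4$: $\sigma:=(1,0,1,0)\in\Gamma$; $\Gamma\cap\mathbb{F}1_{[p]}\neq\{0\}$ for $p=1,2,3,4$; and $\Gamma\cap(1_{[q]}+\mathbb{F}1_{[q+1]})\neq\emptyset$ for $q=1,3$. Construction of $\mathcal{B}(\Gamma,J)$. Elements of $J$ are written $\mathbf{i}=(i_1,i_2,i_3,i_4)$. $\mathcal{A}_4=\mathcal{A}_4(\Gamma,J)$ is the commutative associative semigroup algebra of $\Gamma\times J$ with basis $\{x^{\alpha,\mathbf{i}}\mid(\alpha,\mathbf{i})\in\Gamma\times J\}$ and product $x^{\alpha,\mathbf{i}}\cdot x^{\beta,\mathbf{j}}=x^{\alpha+\beta,\mathbf{i}+\mathbf{j}}$. Write $x^\alpha=x^{\alpha,0}$. Convention: any technically appearing but undefined expression (e.g. $x^{\alpha,\mathbf{i}}$ with some $i_p<0$, or $x^\alpha$ with $\alpha\notin\Gamma$) is treated as zero. For $p=1,\dots,4$ let $\partial_p$ be the derivation of $\mathcal{A}_4$ with $\partial_p(x^{\alpha,\mathbf{i}})=\alpha_px^{\alpha,\mathbf{i}}+i_px^{\alpha,\mathbf{i}-1_{[p]}}$.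 The Lie bracket on $\mathcal{A}_4$ is $$[u,v]=x^{\sigma}\big(\partial_1(u)\partial_2(v)-\partial_1(v)\partial_2(u)\big)+(u+\partial_3(u))\partial_4(v)-(v+\partial_3(v))\partial_4(u).$$ Put $\sigma_1=-1_{[3]}=(0,0,-1,0)$ and $\sigma_2=1_{[1]}-2_{[3]}=(1,0,-2,0)$, with $x^{\sigma_i}$ treated as $0$ if $\sigma_i\notin\Gamma$. The element $x^{\sigma_1}$ is central; let $\mathcal{B}_4=\mathcal{A}_4/\mathbb{F}x^{\sigma_1}$ with the induced bracket, and write $x^{\alpha,\mathbf{i}}$ also for its image (so $x^{\sigma_1}=0$). The Lie algebra of Xu type is $\mathcal{B}(\Gamma,J)=[\mathcal{B}_4,\mathcal{B}_4]$; it is simple, and equals $\mathcal{B}_4$ if $J\neq\{0\}$ or $\sigma_2\notin\Gamma$. With $\Gamma^\#=\Gamma$ if $J\neq\{0\}$ and $\Gamma^\#=\Gamma\setminus\{\sigma_1,\sigma_2\}$ if $J=\{0\}$, a basis of $\mathcal{B}(\Gamma,J)$ is $\{x^{\alpha,\mathbf{i}}\mid(\alpha,\mathbf{i})\in\Gamma^\#\times J,\ (\alpha,\mathbf{i})\neq(\sigma_1,0)\}$. *)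

(* Defs.v *)
From HB Require Import structures.
From mathcomp Require Import all_boot all_order all_algebra.
From mathcomp Require Import finmap ring.
From mathcomp Require Import boolp.
From mathcomp Require Import monalg.

Set Implicit Arguments.
Unset Strict Implicit.
Unset Printing Implicit Defensive.

Import GRing.Theory.
Local Open Scope ring_scope.

Reserved Notation "[ 'lie' u , v ]" (at level 0, u, v at level 99).

HB.mixin Record Lmodule_isLieAlgebra (R : comNzRingType) L
    of GRing.Lmodule R L := {
  lie : L -> L -> L;
  lie_linearl : forall w, linear (lie^~ w);
  lie_linearr : forall u, linear (lie u);
  lie_alt : forall u, lie u u = 0;
  lie_jacobi : forall u v w,
    lie u (lie v w) + lie v (lie w u) + lie w (lie u v) = 0
}.

#[short(type="lieAlgType")]
HB.structure Definition LieAlgebra (R : comNzRingType) :=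
  { L of GRing.Lmodule R L & Lmodule_isLieAlgebra R L }.

Notation "[ 'lie' u , v ]" := (lie u v) : ring_scope.

Definition lie_isomorphic (R : comNzRingType) (L L' : lieAlgType R) : Prop :=
  exists f : {linear L -> L'},
    bijective f /\ {morph f : u v / [lie u, v] >-> [lie u, v]}.

Section LieTheory.
Context (R : comNzRingType) (L : lieAlgType R).
Implicit Types (u v w : L) (a : R).

HB.instance Definition _ u :=
  GRing.isLinear.Build R L L *:%R (lie u) (lie_linearr u).

Lemma lieDl u v w : [lie u + v, w] = [lie u, w] + [lie v, w].
Proof. by have := lie_linearl w 1 u v; rewrite !scale1r. Qed.

Lemma lieDr u v w : [lie w, u + v] = [lie w, u] + [lie w, v].
Proof. exact: raddfD. Qed.

Lemma lieZr a u v : [lie u, a *: v] = a *: [lie u, v].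
Proof. exact: linearZ. Qed.

Lemma lieC u v : [lie u, v] = - [lie v, u].
Proof.
apply/eqP; rewrite -addr_eq0; apply/eqP.
have := lie_alt (u + v).
by rewrite lieDl !lieDr !lie_alt add0r addr0.
Qed.

Lemma lieZl a u v : [lie a *: u, v] = a *: [lie u, v].
Proof. by rewrite lieC lieZr -scalerN -lieC. Qed.

Lemma lieBl u v w : [lie u - v, w] = [lie u, w] - [lie v, w].
Proof. by rewrite lieDl -scaleN1r lieZl scaleN1r. Qed.

Lemma lieBr u v w : [lie w, u - v] = [lie w, u] - [lie w, v].
Proof. exact: raddfB. Qed.
End LieTheory.

Record lieIdeal (R : comNzRingType) (L : lieAlgType R) := LieIdeal {
  lie_ideal_pred :> {pred L};
  lie_ideal_submod_closed : submod_closed lie_ideal_pred;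
  lie_ideal : forall u v, v \in lie_ideal_pred -> [lie u, v] \in lie_ideal_pred
}.

HB.instance Definition _ (R : comNzRingType) (L : lieAlgType R)
    (I : lieIdeal L) :=
  GRing.isSubmodClosed.Build R L (lie_ideal_pred I) (lie_ideal_submod_closed I).

Local Open Scope quotient_scope.

Section LieQuotient.
Context (R : comNzRingType) (L : lieAlgType R) (I : lieIdeal L).

Definition lie_quot : Type := Quotient.quot I.

HB.instance Definition _ := GRing.Zmodule.on lie_quot.

Definition lie_pi : L -> lie_quot := \pi_(Quotient.quot I).
Definition lie_repr : lie_quot -> L := @repr _ (Quotient.quot I).

Lemma lie_reprK : cancel lie_repr lie_pi.
Proof. exact: reprK. Qed.

Lemma lie_pi_eq u v : (lie_pi u == lie_pi v) = (u - v \in I).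
Proof. by rewrite Quotient.idealrBE. Qed.

Lemma lie_piP u v : lie_pi u = lie_pi v <-> u - v \in I.
Proof. by rewrite -lie_pi_eq; split=> [->|/eqP]. Qed.

Lemma lie_pi_repr u : lie_repr (lie_pi u) - u \in I.
Proof. by apply/lie_piP; rewrite lie_reprK. Qed.

Lemma lie_piB : {morph lie_pi : u v / u - v}.
Proof. by move=> u v; rewrite /lie_pi !piE. Qed.

Lemma lie_piD : {morph lie_pi : u v / u + v}.
Proof. by move=> u v; rewrite /lie_pi !piE. Qed.

Definition quot_scale (a : R) (x : lie_quot) := lie_pi (a *: lie_repr x).
Definition quot_lie (x y : lie_quot) := lie_pi [lie lie_repr x, lie_repr y].

Lemma lie_piZ a u : lie_pi (a *: u) = quot_scale a (lie_pi u).
Proof. by apply/lie_piP; rewrite -scalerBr rpredZ // -opprB rpredN lie_pi_repr. Qed.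

Lemma lie_pi_lie u v : lie_pi [lie u, v] = quot_lie (lie_pi u) (lie_pi v).
Proof.
apply/lie_piP; set u' := lie_repr _; set v' := lie_repr _.
have -> : [lie u, v] - [lie u', v'] = [lie v', u' - u] - [lie u, v' - v].
  by rewrite !lieBr (lieC v' u') (lieC v' u) opprK opprB [RHS]addrC [RHS]addrACA addNr addr0.
by rewrite rpredB // lie_ideal // lie_pi_repr.
Qed.

Fact quot_scaleA a b x : quot_scale a (quot_scale b x) = quot_scale (a * b) x.
Proof. by rewrite -[x]lie_reprK -!lie_piZ scalerA. Qed.

Fact quot_scale1 : left_id 1 quot_scale.
Proof. by move=> x; rewrite -[x]lie_reprK -lie_piZ scale1r. Qed.

Fact quot_scaleDr : right_distributive quot_scale +%R.
Proof.
move=> a x y; rewrite -[x]lie_reprK -[y]lie_reprK.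
by rewrite -lie_piD -!lie_piZ -lie_piD scalerDr.
Qed.

Fact quot_scaleDl x : {morph quot_scale^~ x : a b / a + b}.
Proof.
by move=> a b; rewrite -[x]lie_reprK -!lie_piZ -lie_piD scalerDl.
Qed.

HB.instance Definition _ := GRing.Zmodule_isLmodule.Build R lie_quot
  quot_scaleA quot_scale1 quot_scaleDr quot_scaleDl.

Lemma lie_pi_is_linear : linear lie_pi.
Proof. by move=> a u v; rewrite lie_piD lie_piZ. Qed.

HB.instance Definition _ :=
  GRing.isLinear.Build R L lie_quot *:%R lie_pi lie_pi_is_linear.

Fact quot_lie_linearl z : linear (quot_lie^~ z).
Proof.
move=> a x y; rewrite -[x]lie_reprK -[y]lie_reprK -[z]lie_reprK.
by rewrite -linearP -!lie_pi_lie -linearP lieDl lieZl.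
Qed.

Fact quot_lie_linearr x : linear (quot_lie x).
Proof.
move=> a y z; rewrite -[x]lie_reprK -[y]lie_reprK -[z]lie_reprK.
by rewrite -linearP -!lie_pi_lie -linearP lieDr lieZr.
Qed.

Fact quot_lie_alt x : quot_lie x x = 0.
Proof. by rewrite -[x]lie_reprK -lie_pi_lie lie_alt linear0. Qed.

Fact quot_lie_jacobi x y z :
  quot_lie x (quot_lie y z) + quot_lie y (quot_lie z x)
    + quot_lie z (quot_lie x y) = 0.
Proof.
rewrite -[x]lie_reprK -[y]lie_reprK -[z]lie_reprK.
by rewrite -!lie_pi_lie -!lie_piD lie_jacobi linear0.
Qed.

HB.instance Definition _ := Lmodule_isLieAlgebra.Build R lie_quot
  quot_lie_linearl quot_lie_linearr quot_lie_alt quot_lie_jacobi.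
End LieQuotient.

(* The linear span of all brackets: scalars can be absorbed into the first
   argument of each bracket. *)

Section Derived.
Context (R : comNzRingType) (L : lieAlgType R).

Definition derived_pred : {pred L} := fun u =>
  `[< exists s : seq (L * L), u = \sum_(p <- s) [lie p.1, p.2] >].

Lemma derived_predP u :
  reflect (exists s : seq (L * L), u = \sum_(p <- s) [lie p.1, p.2])
          (u \in derived_pred).
Proof. exact: asboolP. Qed.

Lemma lie_derived u v : [lie u, v] \in derived_pred.
Proof. by apply/derived_predP; exists [:: (u, v)]; rewrite big_seq1. Qed.

Fact derived_submod_closed : submod_closed derived_pred.
Proof.
split=> [|a u v]; first by apply/derived_predP; exists [::]; rewrite big_nil.
move=> /derived_predP[s ->] /derived_predP[t ->]; apply/derived_predP.
exists ([seq (a *: p.1, p.2) | p <- s] ++ t); rewrite big_cat big_map /=.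
by congr (_ + _); rewrite scaler_sumr; apply: eq_bigr => p _; rewrite lieZl.
Qed.

HB.instance Definition _ :=
  GRing.isSubmodClosed.Build R L derived_pred derived_submod_closed.

Record derived : predArgType :=
  Derived { derived_val : L; _ : derived_val \in derived_pred }.

HB.instance Definition _ := [isSub for derived_val].
HB.instance Definition _ := [Choice of derived by <:].
HB.instance Definition _ := [SubChoice_isSubLmodule of derived by <:].

Definition derived_lie (x y : derived) : derived :=
  Derived (lie_derived (val x) (val y)).

Let derived_val_inj : injective derived_val. Proof. exact: val_inj. Qed.

Fact derived_lie_linearl z : linear (derived_lie^~ z).
Proof.
move=> a x y; apply: derived_val_inj.
by rewrite /= lieDl lieZl.
Qed.

Fact derived_lie_linearr x : linear (derived_lie x).
Proof.
move=> a y z; apply: derived_val_inj.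
by rewrite /= lieDr lieZr.
Qed.

Fact derived_lie_alt x : derived_lie x x = 0.
Proof.
by apply: derived_val_inj; rewrite /= lie_alt.
Qed.

Fact derived_lie_jacobi x y z :
  derived_lie x (derived_lie y z) + derived_lie y (derived_lie z x)
    + derived_lie z (derived_lie x y) = 0.
Proof.
apply: derived_val_inj.
by rewrite /= lie_jacobi.
Qed.

HB.instance Definition _ := Lmodule_isLieAlgebra.Build R derived
  derived_lie_linearl derived_lie_linearr derived_lie_alt derived_lie_jacobi.
End Derived.


HB.lock Definition malg_ext (K : choiceType) (R : nzRingType) (V : lmodType R)
    (f : K -> V) (g : {malg R[K]}) : V :=
  \sum_(k <- msupp g) g@_k *: f k.

Section LinearExtension.
Context (K : choiceType) (R : nzRingType) (V : lmodType R) (f : K -> V).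

Local Notation malg_ext := (malg_ext f).

Lemma malg_extEw (g : {malg R[K]}) (D : {fset K}) : (msupp g `<=` D)%fset ->
  malg_ext g = \sum_(k <- D) g@_k *: f k.
Proof.
move=> sD; rewrite malg_ext.unlock (big_fset_incl _ sD) //.
by move=> k _ /mcoeff_outdom->; rewrite scale0r.
Qed.

Fact malg_ext_is_linear : linear malg_ext.
Proof.
move=> a g h; pose D := (msupp g `|` msupp h `|` msupp (a *: g + h))%fset.
rewrite !(@malg_extEw _ D) /D.
- rewrite scaler_sumr -big_split /=; apply: eq_bigr => k _.
  by rewrite mcoeffD mcoeffZ scalerDl scalerA.
- by apply/fsubsetP=> k kh; rewrite !inE kh orbT.
- by apply/fsubsetP=> k kh; rewrite !inE kh.
- by apply/fsubsetP=> k kh; rewrite !inE kh orbT.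
Qed.

HB.instance Definition _ :=
  GRing.isLinear.Build R {malg R[K]} V *:%R malg_ext malg_ext_is_linear.

Lemma malg_extU k : malg_ext << k >> = f k.
Proof.
rewrite (@malg_extEw _ [fset k]%fset) ?msuppU_le //.
by rewrite big_seq_fset1 mcoeffUU scale1r.
Qed.
End LinearExtension.


Lemma malg_ind (K : choiceType) (R : nzRingType) (P : {malg R[K]} -> Prop) :
    P 0 -> (forall a u v, P u -> P v -> P (a *: u + v)) ->
    (forall k, P << k >>) ->
  forall u, P u.
Proof.
move=> P0 PD PU u; rewrite [u]monalgE.
elim/big_ind: _ => // [v w Pv Pw|k _].
  by rewrite -[v]scale1r; apply: PD.
have -> : << u@_k *g k >> = u@_k *: << k >> + 0.
  by apply/malgP=> l; rewrite addr0 mcoeffZ !mcoeffU mulr_natr.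
exact: PD.
Qed.

(* The semigroup algebra of a commutative monoid K, written additively.
   monalg provides the product on {malg R[K]} only for monoids K without
   nontrivial units, so only the free module {malg R[K]} is taken from there.
   The operations are locked so that failing conversion tests on elements of
   the algebra do not unfold finitely supported functions. *)
HB.lock Definition sgzero (R : comNzRingType) (K : choiceType) : {malg R[K]} := 0.
HB.lock Definition sgopp (R : comNzRingType) (K : choiceType)
  (u : {malg R[K]}) : {malg R[K]} := - u.
HB.lock Definition sgadd (R : comNzRingType) (K : choiceType)
  (u v : {malg R[K]}) : {malg R[K]} := u + v.
HB.lock Definition sgscale (R : comNzRingType) (K : choiceType) (a : R)
  (u : {malg R[K]}) : {malg R[K]} := a *: u.

Definition sgalg (R : comNzRingType) (K : choiceType) : Type := {malg R[K]}.

Section SgalgModule.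
Context (R : comNzRingType) (K : choiceType).

HB.instance Definition _ := Choice.on (sgalg R K).

Fact sgaddA : associative (@sgadd R K).
Proof. by rewrite sgadd.unlock; apply: addrA. Qed.

Fact sgaddC : commutative (@sgadd R K).
Proof. by rewrite sgadd.unlock; apply: addrC. Qed.

Fact sgadd0 : left_id (sgzero R K) (@sgadd R K).
Proof. by rewrite sgadd.unlock sgzero.unlock; apply: add0r. Qed.

Fact sgaddN : left_inverse (sgzero R K) (@sgopp R K) (@sgadd R K).
Proof. by rewrite sgadd.unlock sgzero.unlock sgopp.unlock; apply: addNr. Qed.

HB.instance Definition _ :=
  GRing.isZmodule.Build (sgalg R K) sgaddA sgaddC sgadd0 sgaddN.

Fact sgscaleA (a b : R) (u : sgalg R K) :
  sgscale a (sgscale b u) = sgscale (a * b) u.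
Proof. by rewrite sgscale.unlock; apply: scalerA. Qed.

Fact sgscale1 : left_id 1 (@sgscale R K).
Proof. by rewrite sgscale.unlock; apply: scale1r. Qed.

Fact sgscaleDr : right_distributive (@sgscale R K) (@sgadd R K).
Proof. by rewrite sgscale.unlock sgadd.unlock; apply: scalerDr. Qed.

Fact sgscaleDl (u : sgalg R K) :
  {morph (@sgscale R K)^~ u : a b / a + b >-> sgadd a b}.
Proof. by rewrite sgscale.unlock sgadd.unlock; apply: scalerDl. Qed.

HB.instance Definition _ := GRing.Zmodule_isLmodule.Build R (sgalg R K)
  sgscaleA sgscale1 sgscaleDr sgscaleDl.

Definition sgbase (k : K) : sgalg R K := << k >>.

Definition sgcoeff (k : K) (u : sgalg R K) : R := mcoeff k u.

Fact sgcoeff_is_linear k : linear_for *%R (sgcoeff k).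
Proof.
move=> a u v; rewrite /sgcoeff {1}/GRing.add {1}/GRing.scale /=.
by rewrite sgadd.unlock sgscale.unlock mcoeffD mcoeffZ.
Qed.

HB.instance Definition _ k := GRing.isLinear.Build R (sgalg R K) R *%R
  (sgcoeff k) (sgcoeff_is_linear k).

Lemma sgcoeffU k l : sgcoeff k (sgbase l) = (l == k)%:R.
Proof. by rewrite /sgcoeff /sgbase mcoeffU. Qed.

Lemma sgalgP (u v : sgalg R K) : (forall k, sgcoeff k u = sgcoeff k v) <-> u = v.
Proof. exact: malgP. Qed.

Definition sgext (V : lmodType R) (f : K -> V) (u : sgalg R K) : V :=
  malg_ext f u.

Fact sgext_is_linear (V : lmodType R) (f : K -> V) : linear (sgext f).
Proof.
move=> a u v; rewrite /sgext {1}/GRing.add {1}/GRing.scale /=.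
by rewrite sgadd.unlock sgscale.unlock linearP.
Qed.

HB.instance Definition _ (V : lmodType R) (f : K -> V) :=
  GRing.isLinear.Build R (sgalg R K) V *:%R (sgext f) (sgext_is_linear f).

Lemma sgextU (V : lmodType R) (f : K -> V) k : sgext f (sgbase k) = f k.
Proof. exact: malg_extU. Qed.

Lemma sgalg_ind (P : sgalg R K -> Prop) :
    P 0 -> (forall a u v, P u -> P v -> P (a *: u + v)) ->
    (forall k, P (sgbase k)) ->
  forall u, P u.
Proof.
move=> P0 PD PU; apply: malg_ind => [|a u v Pu Pv|k]; last exact: PU.
  by move: P0; rewrite {1}/GRing.zero /= sgzero.unlock.
move: (PD a u v Pu Pv); rewrite {1}/GRing.add {1}/GRing.scale /=.
by rewrite sgadd.unlock sgscale.unlock.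
Qed.
End SgalgModule.

HB.lock Definition sgmul (R : comNzRingType) (K : nmodType) (u v : sgalg R K) :
  sgalg R K := sgext (fun k => sgext (fun l => sgbase R (k + l)) v) u.

Section SemigroupAlgebra.
Context (R : comNzRingType) (K : nmodType).

Local Notation sgalg := (sgalg R K).
Local Notation sgbase := (sgbase R).
Implicit Types u v w : sgalg.

Fact sgmulU (k l : K) : sgmul (sgbase k) (sgbase l) = sgbase (k + l).
Proof. by rewrite sgmul.unlock !sgextU. Qed.

Fact sgmul_linearl w : linear (@sgmul R K ^~ w).
Proof. by move=> a u v; rewrite sgmul.unlock linearP. Qed.

Fact sgmul_linearr u : linear (sgmul u).
Proof.
move=> a v w; rewrite sgmul.unlock.
elim/sgalg_ind: u => [|b u u' IHu IHu'|k]; last by rewrite !sgextU linearP.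
  by rewrite !linear0 ?scaler0 addr0.
rewrite !(sgext_is_linear _ b) IHu IHu' !scalerDr !scalerA (mulrC b).
by rewrite addrACA.
Qed.

Fact sgmul0l w : sgmul 0 w = 0.
Proof. by rewrite sgmul.unlock linear0. Qed.

Fact sgmul0r w : sgmul w 0 = 0.
Proof.
have := sgmul_linearr w (-1) 0 0.
by rewrite scaler0 addr0 scaleN1r addNr.
Qed.

Fact sgmulC : commutative (@sgmul R K).
Proof.
elim/sgalg_ind => [v|a u v IHu IHv w|k]; first by rewrite sgmul0l sgmul0r.
  by rewrite sgmul_linearl sgmul_linearr IHu IHv.
elim/sgalg_ind => [|a u v IHu IHv|l]; first by rewrite sgmul0l sgmul0r.
  by rewrite sgmul_linearl sgmul_linearr IHu IHv.
by rewrite !sgmulU addrC.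
Qed.

Fact sgmulA : associative (@sgmul R K).
Proof.
elim/sgalg_ind => [v w|a u u' IHu IHu' v w|k]; first by rewrite !sgmul0l.
  by rewrite !sgmul_linearl IHu IHu'.
elim/sgalg_ind => [w|a u u' IHu IHu' w|l].
- by rewrite sgmul0l sgmul0r sgmul0l.
- by rewrite sgmul_linearl !sgmul_linearr sgmul_linearl IHu IHu'.
elim/sgalg_ind => [|a u u' IHu IHu'|m].
- by rewrite !sgmul0r.
- by rewrite !sgmul_linearr IHu IHu'.
by rewrite !sgmulU addrA.
Qed.

Fact sgmul1l : left_id (sgbase (0 : K)) (@sgmul R K).
Proof.
elim/sgalg_ind => [|a u u' IHu IHu'|m]; first by rewrite sgmul0r.
  by rewrite sgmul_linearr IHu IHu'.
by rewrite sgmulU add0r.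
Qed.

Fact sgmulDl : left_distributive (@sgmul R K) +%R.
Proof. by move=> u v w; rewrite sgmul.unlock linearD. Qed.

Fact sgone_neq0 : sgbase (0 : K) != 0.
Proof.
apply/eqP=> /(congr1 (sgcoeff (0 : K))); rewrite sgcoeffU eqxx linear0.
exact/eqP/oner_neq0.
Qed.

HB.instance Definition _ := GRing.Zmodule_isComNzRing.Build sgalg
  sgmulA sgmulC sgmul1l sgmulDl sgone_neq0.

Fact sgscaleAl (a : R) u v : a *: (u * v) = (a *: u) * v.
Proof. by rewrite /GRing.mul /= sgmul.unlock linearZ. Qed.

HB.instance Definition _ := GRing.Lmodule_isLalgebra.Build R sgalg sgscaleAl.
HB.instance Definition _ := GRing.Lalgebra_isComAlgebra.Build R sgalg.

Lemma sgbaseM (k l : K) : sgbase k * sgbase l = sgbase (k + l).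
Proof. exact: sgmulU. Qed.
End SemigroupAlgebra.

Lemma xu_jacobi (A : comNzRingType) (s : A) (d1 d2 d3 d4 : {additive A -> A}) :
  let br u v := s * (d1 u * d2 v - d1 v * d2 u)
                + (u + d3 u) * d4 v - (v + d3 v) * d4 u in
    (forall u v, d1 (u * v) = d1 u * v + u * d1 v) ->
    (forall u v, d2 (u * v) = d2 u * v + u * d2 v) ->
    (forall u v, d3 (u * v) = d3 u * v + u * d3 v) ->
    (forall u v, d4 (u * v) = d4 u * v + u * d4 v) ->
    (forall u, d2 (d1 u) = d1 (d2 u)) -> (forall u, d3 (d1 u) = d1 (d3 u)) ->
    (forall u, d4 (d1 u) = d1 (d4 u)) -> (forall u, d3 (d2 u) = d2 (d3 u)) ->
    (forall u, d4 (d2 u) = d2 (d4 u)) -> (forall u, d4 (d3 u) = d3 (d4 u)) ->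
    d1 s = s -> d2 s = 0 -> d3 s = s -> d4 s = 0 ->
  forall u v w, br u (br v w) + br v (br w u) + br w (br u v) = 0.
Proof.
move=> br M1 M2 M3 M4 C21 C31 C41 C32 C42 C43 S1 S2 S3 S4 u v w.
rewrite /br !(raddfB, raddfD, M1, M2, M3, M4) /=.
rewrite !(C21, C31, C41, C32, C42, C43) S1 S2 S3 S4.
ring.
Qed.

Definition p1 : 'I_4 := @Ordinal 4 0 isT.
Definition p2 : 'I_4 := @Ordinal 4 1 isT.
Definition p3 : 'I_4 := @Ordinal 4 2 isT.
Definition p4 : 'I_4 := @Ordinal 4 3 isT.

Definition vec4 (T : Type) (a b c d : T) : 'rV[T]_4 :=
  \row_q nth a [:: a; b; c; d] q.

(* a_[p] *)
Definition single (V : nmodType) (a : V) (p : 'I_4) : 'rV[V]_4 :=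
  \row_q (if q == p then a else 0).

Definition sigma (F : fieldType) : 'rV[F]_4 := vec4 1 0 1 0.
Definition sigma1 (F : fieldType) : 'rV[F]_4 := - single 1 p3.

(* Gamma is a boolean predicate. This is no restriction: by boolp, any subset
   of 'rV[F]_4 given by a Prop-valued predicate is also given by a boolean one.
   As 0 always belongs to Gamma, Gamma meets F 1_[p] in more than {0} iff it
   contains a_[p] for some a != 0. *)
Definition conditionA (F : fieldType) (Gamma : zmodClosed 'rV[F]_4) : Prop :=
  [/\ sigma F \in Gamma,
      forall p, exists2 a : F, a != 0 & single a p \in Gamma,
      exists a : F, single 1 p1 + single a p2 \in Gamma
    & exists a : F, single 1 p3 + single a p4 \in Gamma].

(* A product J = J_1 x J_2 x J_3 x J_4 with each J_p equal to {0} or to nat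
   is encoded by the four booleans telling whether J_p is nat. *)
Definition jtype := {ffun 'I_4 -> bool}.

Definition jfactor (b : bool) : {pred nat} := if b then predT else pred1 0%N.

Definition jset (J : jtype) : {pred 'rV[nat]_4} :=
  fun i => [forall p, i 0 p \in jfactor (J p)].

Lemma jsetP (J : jtype) (i : 'rV[nat]_4) :
  reflect (forall p, i 0 p \in jfactor (J p)) (i \in jset J).
Proof. exact: forallP. Qed.

Fact jset_addr_closed (J : jtype) : addr_closed (jset J).
Proof.
split=> [|i j /jsetP iJ /jsetP jJ]; apply/jsetP=> p.
  by rewrite mxE /jfactor; case: (J p).
by move: (iJ p) (jJ p); rewrite mxE /jfactor; case: (J p) => // /eqP-> /eqP->.
Qed.

HB.instance Definition _ (J : jtype) :=
  GRing.isAddClosed.Build 'rV[nat]_4 (jset J) (jset_addr_closed J).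

Section IndexTypes.
Context (F : fieldType) (Gamma : zmodClosed 'rV[F]_4) (J : jtype).

Record gidx : predArgType :=
  GIdx { gidx_val : 'rV[F]_4; _ : gidx_val \in Gamma }.
HB.instance Definition _ := [isSub for gidx_val].
HB.instance Definition _ := [Choice of gidx by <:].
HB.instance Definition _ := [SubChoice_isSubZmodule of gidx by <:].

Record jidx : predArgType :=
  JIdx { jidx_val : 'rV[nat]_4; _ : jidx_val \in jset J }.
HB.instance Definition _ := [isSub for jidx_val].
HB.instance Definition _ := [Choice of jidx by <:].
HB.instance Definition _ :=
  GRing.SubChoice_isSubNmodule.Build _ _ jidx (jset_addr_closed J).

End IndexTypes.

Definition xu_A4 (F : fieldType) (Gamma : zmodClosed 'rV[F]_4) (J : jtype) :
  Type := sgalg F (gidx Gamma * jidx J)%type.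

HB.instance Definition _ (F : fieldType) (Gamma : zmodClosed 'rV[F]_4)
    (J : jtype) := GRing.ComAlgebra.on (xu_A4 Gamma J).

(* x^{alpha, i}, which is 0 if (alpha, i) is not in Gamma x J *)
HB.lock Definition xmon (F : fieldType) (Gamma : zmodClosed 'rV[F]_4)
    (J : jtype) (alpha : 'rV[F]_4) (i : 'rV[nat]_4) : xu_A4 Gamma J :=
  if insub alpha is Some g then
    if insub i is Some j then sgbase F (g, j) else 0
  else 0.

(* i - 1_[p]. The subtraction is truncated, which is harmless since
   x^{alpha, i - 1_[p]} only occurs below with the coefficient i_p. *)
Definition jdec (i : 'rV[nat]_4) (p : 'I_4) : 'rV[nat]_4 :=
  \row_q (i ord0 q - single 1%N p ord0 q)%N.

Definition xu_d_mon (F : fieldType) (Gamma : zmodClosed 'rV[F]_4) (J : jtype)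
    (p : 'I_4) (k : gidx Gamma * jidx J) : xu_A4 Gamma J :=
  let alpha := gidx_val k.1 in let i := jidx_val k.2 in
  alpha 0 p *: xmon Gamma J alpha i
    + (i 0 p)%:R *: xmon Gamma J alpha (jdec i p).

HB.lock Definition xu_d (F : fieldType) (Gamma : zmodClosed 'rV[F]_4)
    (J : jtype) (p : 'I_4) : xu_A4 Gamma J -> xu_A4 Gamma J :=
  sgext (xu_d_mon p).

Section XuType.
Context (F : fieldType) (Gamma : zmodClosed 'rV[F]_4) (J : jtype).

Local Notation gidx := (gidx Gamma).
Local Notation jidx := (jidx J).
Local Notation xu_A4 := (xu_A4 Gamma J).
Local Notation xmon := (xmon Gamma J).
Local Notation xu_d := (@xu_d F Gamma J).

Lemma xu_d_is_linear p : linear (xu_d p).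
Proof. by rewrite xu_d.unlock; apply: sgext_is_linear. Qed.

HB.instance Definition _ p :=
  GRing.isLinear.Build F xu_A4 xu_A4 *:%R (xu_d p) (xu_d_is_linear p).

Lemma xu_d_linear p a u v : xu_d p (a *: u + v) = a *: xu_d p u + xu_d p v.
Proof. exact: linearP. Qed.

Lemma xu_d0 p : xu_d p 0 = 0.
Proof. exact: linear0. Qed.

Lemma xu_dZ p a u : xu_d p (a *: u) = a *: xu_d p u.
Proof. exact: linearZ. Qed.

Lemma xu_dD p u v : xu_d p (u + v) = xu_d p u + xu_d p v.
Proof. exact: linearD. Qed.

Definition xu_bracket (u v : xu_A4) : xu_A4 :=
  xmon (sigma F) 0 * (xu_d p1 u * xu_d p2 v - xu_d p1 v * xu_d p2 u)
  + (u + xu_d p3 u) * xu_d p4 v - (v + xu_d p3 v) * xu_d p4 u.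

Lemma xu_ind (P : xu_A4 -> Prop) :
    P 0 -> (forall a u v, P u -> P v -> P (a *: u + v)) ->
    (forall alpha i, alpha \in Gamma -> i \in jset J -> P (xmon alpha i)) ->
  forall u, P u.
Proof.
move=> P0 PD PU; apply: sgalg_ind => // -[[al al_G] [i iJ]].
have := PU al i al_G iJ; rewrite xmon.unlock.
by rewrite (insubT (mem Gamma) al_G) (insubT (mem (jset J)) iJ).
Qed.

Lemma xmonE alpha i (aG : alpha \in Gamma) (iJ : i \in jset J) :
  xmon alpha i = sgbase F (GIdx aG, JIdx iJ).
Proof.
by rewrite xmon.unlock (insubT (mem Gamma) aG) (insubT (mem (jset J)) iJ).
Qed.

Lemma xmon_outl alpha i : alpha \notin Gamma -> xmon alpha i = 0.
Proof. by move=> aG; rewrite xmon.unlock insubN. Qed.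

Lemma xmonM alpha beta i j : alpha \in Gamma -> beta \in Gamma ->
    i \in jset J -> j \in jset J ->
  xmon alpha i * xmon beta j = xmon (alpha + beta) (i + j).
Proof.
move=> aG bG iJ jJ; rewrite !xmonE ?rpredD // => abG ijJ.
by rewrite sgbaseM; congr sgbase; congr pair; apply: val_inj.
Qed.

Lemma jdec_jset i p : i \in jset J -> jdec i p \in jset J.
Proof.
move=> /jsetP iJ; apply/jsetP=> q; move: (iJ q); rewrite !mxE /jfactor.
by case: (J q) => // /eqP->.
Qed.

Lemma xu_dE p alpha i : i \in jset J ->
  xu_d p (xmon alpha i)
    = alpha 0 p *: xmon alpha i + (i 0 p)%:R *: xmon alpha (jdec i p).
Proof.
move=> iJ; have [aG|aG] := boolP (alpha \in Gamma); last first.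
  by rewrite !xmon_outl // xu_d0 !scaler0 addr0.
by rewrite {1}(xmonE aG iJ) xu_d.unlock sgextU.
Qed.

Fact jset0 : 0 \in jset J. Proof. exact: rpred0. Qed.

Lemma xu_dE0 p alpha : xu_d p (xmon alpha 0) = alpha 0 p *: xmon alpha 0.
Proof. by rewrite xu_dE ?jset0 // mxE scale0r addr0. Qed.

Lemma xu_dC p q u : xu_d p (xu_d q u) = xu_d q (xu_d p u).
Proof.
elim/xu_ind: u => [|a u v IHu IHv|al i aG iJ]; first by rewrite !xu_d0.
  by rewrite !xu_d_linear IHu IHv.
rewrite (xu_dE _ _ iJ) (xu_dE _ _ iJ) !xu_dD !xu_dZ !(xu_dE _ _ iJ).
rewrite !(xu_dE _ _ (jdec_jset _ iJ)).
rewrite !scalerDr !scalerA -!natrM.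
have -> : jdec (jdec i q) p = jdec (jdec i p) q.
  by apply/rowP=> r; rewrite !mxE subnAC.
have -> : (i ord0 q * jdec i q ord0 p = i ord0 p * jdec i p ord0 q)%N.
  rewrite !mxE (eq_sym q); case: eqVneq => [->//|_].
  by rewrite !subn0 mulnC.
rewrite (mulrC (al 0 q)) !(mulrC _%:R) -!addrA; congr (_ + _).
by rewrite addrCA.
Qed.

Lemma xu_dM p u v : xu_d p (u * v) = xu_d p u * v + u * xu_d p v.
Proof.
elim/xu_ind: u v => [v|a u v IHu IHv w|al i aG iJ].
- by rewrite !(mul0r, xu_d0) addr0.
- rewrite mulrDl -scalerAl !xu_d_linear IHu IHv mulrDl -!scalerAl.
  by rewrite mulrDl -scalerAl scalerDr addrACA.
elim/xu_ind => [|a u v IHu IHv|be j bG jJ].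
- by rewrite !(mulr0, xu_d0) addr0.
- rewrite mulrDr -scalerAr !xu_d_linear IHu IHv !mulrDr -!scalerAr.
  by rewrite scalerDr addrACA.
have ijJ : i + j \in jset J by rewrite rpredD.
rewrite (xmonM aG bG iJ jJ) (xu_dE _ _ ijJ) (xu_dE _ _ iJ) (xu_dE _ _ jJ).
rewrite mulrDl mulrDr -!scalerAl -!scalerAr (xmonM aG bG iJ jJ).
rewrite (xmonM aG bG (jdec_jset _ iJ) jJ) (xmonM aG bG iJ (jdec_jset _ jJ)).
rewrite [X in X *: _]mxE [X in X%:R]mxE natrD !scalerDl -!addrA; congr (_ + _).
rewrite [RHS]addrCA; congr (_ + _).
have dec_add (k l : 'rV[nat]_4) : k 0 p != 0%N ->
    jdec (k + l) p = jdec k p + l.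
  move=> k0; apply/rowP=> r; rewrite !mxE.
  case: eqVneq => [->|_]; last by rewrite !subn0.
  by apply/esym/addnBAC; rewrite lt0n.
congr (_ + _).
  case: (eqVneq (i 0 p) 0%N) => [->|i0]; first by rewrite !scale0r.
  by rewrite dec_add.
case: (eqVneq (j 0 p) 0%N) => [->|j0]; first by rewrite !scale0r.
by rewrite (addrC i j) dec_add // (addrC i).
Qed.

Fact xu_linearr u : linear (xu_bracket u).
Proof.
move=> a v w; have [a1 E] : exists a1 : xu_A4, forall x : xu_A4, a *: x = a1 * x.
  by exists a%:A => x; rewrite mulr_algl.
by rewrite /xu_bracket !xu_d_linear !E; ring.
Qed.

Fact xu_alt u : xu_bracket u u = 0.
Proof. by rewrite /xu_bracket subrr mulr0 add0r subrr. Qed.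

Fact xu_linearl w : linear (xu_bracket^~ w).
Proof.
have C u v : xu_bracket u v = - xu_bracket v u by rewrite /xu_bracket; ring.
by move=> a u v; rewrite !(C _ w) xu_linearr opprD scalerN.
Qed.

Fact xu_bracket_jacobi u v w :
  xu_bracket u (xu_bracket v w) + xu_bracket v (xu_bracket w u)
    + xu_bracket w (xu_bracket u v) = 0.
Proof.
have M p : forall x y, xu_d p (x * y) = xu_d p x * y + x * xu_d p y.
  by move=> x y; apply: xu_dM.
have C p q : forall x, xu_d p (xu_d q x) = xu_d q (xu_d p x).
  by move=> x; apply: xu_dC.
have S p : xu_d p (xmon (sigma F) 0) = sigma F 0 p *: xmon (sigma F) 0.
  exact: xu_dE0.
apply: (xu_jacobi (M p1) (M p2) (M p3) (M p4) (C p2 p1) (C p3 p1) (C p4 p1)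
          (C p3 p2) (C p4 p2) (C p4 p3)).
- by rewrite /= S mxE /= scale1r.
- by rewrite /= S mxE /= scale0r.
- by rewrite /= S mxE /= scale1r.
- by rewrite /= S mxE /= scale0r.
Qed.

HB.instance Definition _ := Lmodule_isLieAlgebra.Build F xu_A4
  xu_linearl xu_linearr xu_alt xu_bracket_jacobi.

Lemma xmon_sigma1_central u : [lie u, xmon (sigma1 F) 0] = 0.
Proof.
rewrite /lie /= /xu_bracket !xu_dE0 !mxE /=.
rewrite oppr0 !scale0r !mulr0 mul0r subrr mulr0 !add0r scaleN1r subrr.
by rewrite mul0r oppr0.
Qed.

(* F x^{sigma_1}, which is {0} if sigma_1 is not in Gamma *)
Definition sigma1_line : {pred xu_A4} :=
  fun u => `[< exists c : F, u = c *: xmon (sigma1 F) 0 >].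

Fact sigma1_line_submod_closed : submod_closed sigma1_line.
Proof.
split=> [|a _ _ /asboolP[c ->] /asboolP[d ->]]; apply/asboolP.
  by exists 0; rewrite scale0r.
by exists (a * c + d); rewrite scalerDl scalerA.
Qed.

Fact sigma1_line_ideal u v : v \in sigma1_line -> [lie u, v] \in sigma1_line.
Proof.
move=> /asboolP[c ->]; apply/asboolP; exists 0.
by rewrite lieZr xmon_sigma1_central scaler0 scale0r.
Qed.

Definition sigma1_ideal : lieIdeal xu_A4 :=
  LieIdeal sigma1_line_submod_closed sigma1_line_ideal.

Definition xu_B4 : lieAlgType F := lie_quot sigma1_ideal.

Definition xu_B : lieAlgType F := derived xu_B4.
End XuType.

Definition is_group_iso (V V' : zmodType) (Gamma : zmodClosed V)
    (Gamma' : zmodClosed V') (phi : V -> V') : Prop :=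
  [/\ forall x, x \in Gamma -> phi x \in Gamma',
      {in Gamma &, {morph phi : x y / x + y}},
      {in Gamma &, injective phi}
    & forall y, y \in Gamma' -> exists2 x, x \in Gamma & phi x = y].

(* Main.v *)
From HB Require Import structures.
Require Import Defs.
From mathcomp Require Import all_boot all_order all_algebra finmap monalg.
From mathcomp Require Import boolp classical_sets.
From mathcomp Require Import ring zify.

Set Implicit Arguments.
Unset Strict Implicit.
Unset Printing Implicit Defensive.

Import GRing.Theory.
Local Open Scope ring_scope.

(** Write [z] for x^sigma_1, [X] for x^(-sigma) and [1] for x^0. In A_4 one has
    [[X, u] = - d_2 u] and [[1, u] = d_4 u], so [X] and [1] span a torus whose
    weight spaces are the joint eigenspaces of [d_2] and [d_4]. Elements of
    weight 0 act on each weight space by a multiplication of A_4.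

    Sufficiency. The substitution of variables dual to the triangular map of
    exponents is a morphism of algebras. Multiplied by a_4^(-1) and twisted by a
    character of the additive group F that sends 1 to a_2 / a_4, it preserves
    the bracket; the character exists since the multiplicative group of F is
    divisible. This is case (i). Multiplication by [X] after the substitution
    of exponents alpha |-> - (alpha_3, alpha_4, alpha_1, alpha_2) is an
    isomorphism that exchanges [X] and [1], hence the two pairs of coordinates;
    case (ii) is case (i) followed by this one.

    Necessity. An isomorphism of the derived algebras is read as a relation
    [R] between representatives in A_4, defined up to [z] (record [xu_corr]).

    - The elements whose adjoint action is locally finite on weight vectors are
      the combinations of [X], [1] and [z] ([lfin_span]). Order the weights
      totally: if such an element has a nonzero weight, its extreme component
      is locally nilpotent, which weight vectors of nonzero weight never are.
      Hence [R] matches the two tori.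
    - A vector [u] of nonzero weight generates its weight space under the
      multiplications by brackets of opposite weights iff [u] is a scalar
      multiple of a monomial x^alpha ([cyclic_mon], [mon_cyclic]): what [u]
      generates consists of multiples of [u], and the units of the domain A_4
      are the multiples of the monomials x^alpha. Hence [R] matches monomials
      ([corr_mon]).
    - The torus contains two distinguished lines, F X and F 1: they are detected
      by weight 0 elements that send monomials to monomials and have the same
      kernel on them as [X] or [1]. So [R] preserves or exchanges the lines
      ([corr_lines]), and the exchange reduces to the other case by the
      isomorphism above.
    - When the lines are preserved, a bracket with a weight 0 monomial shifts the
      first exponent. Comparing the bracket of two monomials with its shift
      forces the first two coordinates of alpha |-> alpha' to be the expected
      triangular map ([corr_coord1]). The coefficients of the images of x^N t_1
      and x^N t_2 give J_1, J_2 and the vanishing of a_1 ([corr_first]). The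
      coordinates 3 and 4 follow by conjugation with the exchange
      ([corr_coords]). *)

(** * Orders and characters *)

(** A strict cone that is maximal among those avoiding [0] is the positive
    cone of a total order. *)
Lemma total_cone_exists (V : zmodType) :
    (forall (x : V) n, x *+ n.+1 = 0 -> x = 0) ->
  exists C : V -> Prop,
    [/\ forall x y, C x -> C y -> C (x + y), ~ C 0
      & forall x, x <> 0 -> C x \/ C (- x)].
Proof.
move=> tf.
pose P (C : set V) := (forall x y, C x -> C y -> C (x + y)) /\ ~ C 0.
have [|C [[CD C0] Cmax]] := @Zorn_bigcup _ P.
  move=> S SP Stot; split=> [x y [X SX Xx] [Y SY Yy]|[X /SP[_ X0] /X0//]].
  have [XY|YX] := Stot X Y SX SY.
    by exists Y => //; apply: (SP _ SY).1 => //; apply: XY.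
  by exists X => //; apply: (SP _ SX).1 => //; apply: YX.
exists C; split=> // x x0.
have CM y n : C y -> C (y *+ n.+1).
  by move=> Cy; elim: n => [//|n IH]; rewrite mulrS; apply: CD.
(* A maximal cone missing [y] contains a negative multiple of [y]. *)
have key (y : V) : y <> 0 -> ~ C y -> exists n, C (- (y *+ n.+1)).
  move=> y0 nCy; apply: contrapT => no.
  pose C' : set V := fun v => C v \/ exists n c, (c = 0 \/ C c) /\ v = c + y *+ n.+1.
  apply: (Cmax C'); last first.
    split; last first.
      move=> [//|[n [c [[->|Cc] /esym E]]]].
        by rewrite add0r in E; apply: y0; apply: tf E.
      by apply: no; exists n; have /eqP := E; rewrite addrC addr_eq0 => /eqP->; rewrite opprK.
    move=> u v [Cu|[n [c [cC ->]]]] [Cv|[m [d [dC ->]]]].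
    - by left; apply: CD.
    - right; exists m, (u + d); rewrite addrA; split=> //; right.
      by case: dC => [->|Cd]; [rewrite addr0|apply: CD].
    - right; exists n, (c + v); rewrite addrAC; split=> //; right.
      by case: cC => [->|Cc]; [rewrite add0r|apply: CD].
    - right; exists (n + m).+1, (c + d); rewrite addrACA -mulrnDr addSn addnS; split=> //.
      case: cC dC => [->|Cc] [->|Cd]; rewrite ?add0r ?addr0; try by [left|right].
      by right; apply: CD.
  split; last by move=> /(_ y) H; apply/nCy/H; right; exists 0%N, 0; rewrite add0r mulr1n; split=> //; left.
  by move=> v Cv; left.
have [Cx|nCx] := pselect (C x); first by left.
have [Cy|nCy] := pselect (C (- x)); first by right.
have [n Cn] := key _ x0 nCx.
have [|m] := key (- x) _ nCy; first by move/eqP; rewrite oppr_eq0 => /eqP.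
rewrite mulNrn opprK => Cm; exfalso; apply: C0.
have := CD _ _ (CM _ m Cn) (CM _ n Cm).
by rewrite -mulNrn -!mulrnA mulnC mulNrn addNr.
Qed.

Lemma intr_eq0_char0 (F : fieldType) (char0 : [pchar F] =i pred0) (m : int) :
  (m%:~R == 0 :> F) = (m == 0).
Proof.
case: m => n; first by rewrite -pmulrn ((pcharf0P F).1 char0).
by rewrite NegzE mulrNz oppr_eq0 -pmulrn ((pcharf0P F).1 char0).
Qed.

(** The integers map to the multiplicative group of [F] by powers of [c]; a
    maximal extension of this map is total because that group is divisible. *)
Lemma character_exists (F : closedFieldType) (char0 : [pchar F] =i pred0) (c : F) :
    c != 0 ->
  exists chi : F -> F,
    [/\ forall x y, chi (x + y) = chi x * chi y, chi 0 = 1 & chi 1 = c].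
Proof.
move=> c0.
(* Graphs of homomorphisms from a subgroup of [F] to its multiplicative
   group. *)
pose hom (G : set (F * F)) :=
  [/\ forall x u y v, G (x, u) -> G (y, v) -> G (x + y, u * v),
      forall x u, G (x, u) -> G (- x, u^-1),
      forall x u, G (x, u) -> u != 0 & forall u, G (0, u) -> u = 1].
(* The empty graph is admitted, as the union of the empty chain. *)
pose P (G : set (F * F)) := (forall p, ~ G p) \/ hom G /\ G (1, c).
have baseP : P (fun p => exists m : int, p = (m%:~R, c ^ m)).
  right; split; last by exists 1; rewrite expr1z.
  split=> [x u y v [m [-> ->]] [k [-> ->]]|x u [m [-> ->]]|x u [m [_ ->]]|u [m []]].
  - by exists (m + k); rewrite intrD expfzDr.
  - by exists (- m); rewrite mulrNz -invr_expz.
  - by rewrite expfz_neq0.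
  - by move/esym/eqP; rewrite intr_eq0_char0 // => /eqP->; rewrite expr0z => ->.
have [S SP Stot|G [PG Gmax]] := @Zorn_bigcup _ P.
  have [[X0 SX0 X0n0]|no] := pselect (exists2 X, S X & exists p, X p); last first.
    by left=> p [X SX Xp]; apply: no; exists X => //; exists p.
  right; have homX X : S X -> (exists p, X p) -> hom X /\ X (1, c).
    by move=> /SP[nX [p Xp]|//]; case: (nX p).
  split; last by exists X0 => //; exact: (homX X0 SX0 X0n0).2.
  split=> [x u y v [X SX Xx] [Y SY Yy]|x u [X SX Xx]|x u [X SX Xx]|u [X SX Xu]].
  - have [XY|YX] := Stot X Y SX SY.
      have [[YD _ _ _] _] := homX Y SY (ex_intro _ _ Yy).
      by exists Y => //; apply: YD => //; apply: XY.
    have [[XD _ _ _] _] := homX X SX (ex_intro _ _ Xx).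
    by exists X => //; apply: XD => //; apply: YX.
  - have [[_ XN _ _] _] := homX X SX (ex_intro _ _ Xx).
    by exists X => //; apply: XN.
  - by have [[_ _ Xn0 _] _] := homX X SX (ex_intro _ _ Xx); apply: Xn0 Xx.
  - by have [[_ _ _ X1] _] := homX X SX (ex_intro _ _ Xu); apply: X1.
have [[GD GN Gn0 G1] Gc] : hom G /\ G (1, c).
  case: PG => // nG; exfalso; apply: (Gmax _ _ baseP); split=> [p /nG//|].
  by move=> /(_ (1, c))H; apply: (nG (1, c)); apply: H; exists 1; rewrite expr1z.
have G0 : G (0, 1).
  by have := GD _ _ _ _ Gc (GN _ _ Gc); rewrite subrr divff // (Gn0 _ _ Gc).
have GM x u : G (x, u) -> forall m : int, G (x *~ m, u ^ m).
  move=> Gx; elim=> [|n IH|n IH]; first by rewrite mulr0z expr0z.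
    by rewrite intS mulrzDr expfzDr ?(Gn0 _ _ Gx) // mulr1z expr1z; apply: GD.
  rewrite intS opprD mulrzDr expfzDr ?(Gn0 _ _ Gx) // addrC [_ * u ^ _]mulrC.
  by apply: GD => //; rewrite mulrNz mulr1z; apply: GN.
have Gfun x u v : G (x, u) -> G (x, v) -> u = v.
  move=> Gu Gv; have := GD _ _ _ _ Gu (GN _ _ Gv); rewrite subrr => /G1 E.
  by rewrite -[u](divfK (Gn0 _ _ Gv)) E mul1r.
have Gtot x : exists u, G (x, u).
  apply: contrapT => nx.
  (* The least positive multiple of [x] in the domain decides which root to
     take. *)
  have [y y0 yP] : exists2 y, y != 0 & forall (m : int) v, G (x *~ m, v) -> v = y ^ m.
    pose Q n := `[< exists v, G (x *+ n.+1, v) >].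
    have [exQ|no] := pselect (exists n, Q n); last first.
      exists 1; first exact: oner_neq0.
      move=> m v Gv; rewrite exp1rz; case: m => [[|n]|n] in Gv *.
      - by apply: G1; rewrite mulr0z in Gv.
      - by case: no; exists n; apply/asboolP; exists v.
      - case: no; exists n; apply/asboolP; exists v^-1.
        by have := GN _ _ Gv; rewrite NegzE mulrNz opprK.
    case: (ex_minnP exQ) => n /asboolP[w Gw] nmin.
    have [y yw] : exists y, y ^+ n.+1 = w.
      have [y] := solve_monicpoly (fun i => if i is 0%N then w else 0) (ltn0Sn n).
      rewrite big_ord_recl big1 => [|i _]; last by rewrite mul0r.
      by rewrite addr0 expr0 mulr1 => <-; exists y.
    have y0 : y != 0.
      by apply: contraTneq (Gn0 _ _ Gw) => y0; rewrite -yw y0 expr0n eqxx.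
    exists y => // m v Gv.
    have Gq : G (x *~ (m %/ n.+1)%Z *+ n.+1, y ^ (n.+1%:Z * (m %/ n.+1)%Z)).
      have := GM _ _ Gw (m %/ n.+1)%Z.
      by rewrite -yw exprnP exprz_exp !pmulrn -!mulrzA [_ * n.+1%:Z]mulrC.
    have Gr : G (x *~ (m %% n.+1)%Z, v * (y ^ (n.+1%:Z * (m %/ n.+1)%Z))^-1).
      suff -> : x *~ (m %% n.+1)%Z = x *~ m - x *~ (m %/ n.+1)%Z *+ n.+1.
        by apply: GD => //; apply: GN.
      apply/eqP; rewrite eq_sym subr_eq addrC pmulrn -mulrzA -mulrzDr.
        by rewrite -(divz_eq m n.+1).
    have := @ltz_pmod m n.+1 isT; have := @modz_ge0 m n.+1 isT.
    case: (m %% n.+1)%Z Gr (divz_eq m n.+1) => // -[|r] Gr mE _ rn.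
      rewrite mulr0z in Gr; move/G1: Gr => Gr.
      rewrite mE addr0 mulrC.
      apply: (mulIf (invr_neq0 (expfz_neq0 (n.+1%:Z * (m %/ n.+1)%Z) y0))).
      by rewrite Gr divff // expfz_neq0.
    have : (n <= r)%N by apply: nmin; apply/asboolP; eexists; exact: Gr.
    by rewrite leqNgt => /negP[].
  pose G' : set (F * F) := fun p =>
    exists h u (m : int), G (h, u) /\ p = (h + x *~ m, u * y ^ m).
  apply: (Gmax G').
    split=> [[h u] Gh|/(_ (x, y)) H]; first by exists h, u, 0; rewrite mulr0z addr0 mulr1.
    by apply: nx; exists y; apply: H; exists 0, 1, 1; rewrite add0r mul1r.
  right; split; last by exists 1, c, 0; rewrite mulr0z addr0 mulr1.
  split=> [_ _ _ _ [h [u [m [Gu [-> ->]]]]] [k [v [l [Gv [-> ->]]]]]| | |].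
  - exists (h + k), (u * v), (m + l); rewrite mulrzDr addrACA expfzDr // mulrACA.
    by split=> //; apply: GD.
  - move=> _ _ [h [u [m [Gu [-> ->]]]]]; exists (- h), u^-1, (- m).
    by rewrite opprD mulrNz invfM -invr_expz; split=> //; apply: GN.
  - by move=> _ _ [h [u [m [Gu [_ ->]]]]]; rewrite mulf_neq0 ?expfz_neq0 // (Gn0 _ _ Gu).
  - move=> _ [h [u [m [Gu [/esym E ->]]]]].
    have := GN _ _ Gu; have -> : - h = x *~ m by apply/eqP; rewrite eq_sym -addr_eq0 addrC E.
    by move/yP=> <-; rewrite divff // (Gn0 _ _ Gu).
have [chi chiP] := choice Gtot.
exists chi; split=> [x y||].
- by apply: (@Gfun (x + y)) => //; apply: GD.
- by apply: (@Gfun 0).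
- by apply: (@Gfun 1).
Qed.

(** * Semigroup algebras over ordered groups *)

Section Supports.
Context (F : fieldType) (K : nmodType).
Local Notation A := (sgalg F K).
Implicit Types (u v w : A) (Q : K -> Prop).

Definition supp_in Q u := forall k, sgcoeff k u != 0 -> Q k.

Lemma supp_inS Q Q' u : (forall k, Q k -> Q' k) -> supp_in Q u -> supp_in Q' u.
Proof. by move=> QQ' Qu k /Qu/QQ'. Qed.

Lemma supp_in0 Q : supp_in Q 0.
Proof. by move=> k; rewrite linear0 eqxx. Qed.

Lemma supp_inP Q a u v : supp_in Q u -> supp_in Q v -> supp_in Q (a *: u + v).
Proof.
move=> Qu Qv k; case: (eqVneq (sgcoeff k u) 0) => [E|/Qu//].
by rewrite linearP /= E mulr0 add0r => /Qv.
Qed.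

Lemma supp_inZ Q a u : supp_in Q u -> supp_in Q (a *: u).
Proof. by move=> Qu; rewrite -[_ *: u]addr0; apply: supp_inP => //; apply: supp_in0. Qed.

Lemma supp_inD Q u v : supp_in Q u -> supp_in Q v -> supp_in Q (u + v).
Proof. by move=> Qu; rewrite -[u]scale1r; apply: supp_inP. Qed.

Lemma supp_inN Q u : supp_in Q u -> supp_in Q (- u).
Proof. by move=> Qu; rewrite -scaleN1r; apply: supp_inZ. Qed.

Lemma supp_inU Q k : Q k -> supp_in Q (sgbase F k).
Proof. by move=> Qk l; rewrite sgcoeffU; case: (eqVneq k l) => [<-//|_]; rewrite eqxx. Qed.

Lemma sgalg_sum u : u = \sum_(k <- msupp u) sgcoeff k u *: sgbase F k.
Proof.
apply/sgalgP=> l; rewrite linear_sum /=.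
have [lu|lu] := boolP (l \in msupp u); last first.
  rewrite big_seq big1 => [|k ku]; first by rewrite /sgcoeff mcoeff_outdom.
  rewrite linearZ /= sgcoeffU; case: eqVneq => [kl|]; last by rewrite mulr0.
  by rewrite -kl ku in lu.
rewrite (big_rem l) //= linearZ /= sgcoeffU eqxx mulr1 big_seq big1 ?addr0 // => k.
rewrite mem_rem_uniq ?fset_uniq // !inE => /andP[/negPf kl _].
by rewrite linearZ /= sgcoeffU kl mulr0.
Qed.

Lemma supp_in_ind Q (P : A -> Prop) u :
    P 0 -> (forall a v w, P v -> P w -> P (a *: v + w)) ->
    (forall k, Q k -> P (sgbase F k)) ->
  supp_in Q u -> P u.
Proof.
move=> P0 PD PU Qu; rewrite [u]sgalg_sum big_seq.
apply: (big_rec P) => // k w ku Pw; apply: PD => //; apply: PU; apply: Qu.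
by rewrite /sgcoeff mcoeff_neq0.
Qed.

Lemma supp_inM Q Q' Q'' u v : (forall k l, Q k -> Q' l -> Q'' (k + l)) ->
  supp_in Q u -> supp_in Q' v -> supp_in Q'' (u * v).
Proof.
move=> QM Qu Qv.
apply: (supp_in_ind (P := fun u => supp_in Q'' (u * v)) _ _ _ Qu).
- by rewrite mul0r; apply: supp_in0.
- by move=> a w1 w2 IH1 IH2; rewrite mulrDl -scalerAl; apply: supp_inP.
move=> k Qk; apply: (supp_in_ind (P := fun v => supp_in Q'' (sgbase F k * v)) _ _ _ Qv).
- by rewrite mulr0; apply: supp_in0.
- by move=> a w1 w2 IH1 IH2; rewrite mulrDr -scalerAr; apply: supp_inP.
by move=> l Ql; rewrite sgbaseM; apply: supp_inU; apply: QM.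
Qed.

Definition sgpart (Q : pred K) u : A :=
  sgext (fun k => if Q k then sgbase F k else 0) u.

Lemma sgpartE (Q : pred K) u k : sgcoeff k (sgpart Q u) = if Q k then sgcoeff k u else 0.
Proof.
rewrite /sgpart; elim/sgalg_ind: u => [|a u v IHu IHv|l].
- by rewrite !linear0 if_same.
- by rewrite (sgext_is_linear _ a) !(sgcoeff_is_linear _ a) IHu IHv; case: ifP => // _; rewrite mulr0 addr0.
rewrite sgextU sgcoeffU (fun_if (sgcoeff k)) sgcoeffU linear0.
by case: eqVneq => [->|]; rewrite ?if_same.
Qed.

Section Lead.
Context (V : zmodType) (C : V -> Prop) (wt : K -> V).
Hypothesis CD : forall x y, C x -> C y -> C (x + y).
Hypothesis C0 : ~ C 0.
Hypothesis Ctot : forall x, x <> 0 -> C x \/ C (- x).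
Hypothesis wtD : forall k l, wt (k + l) = wt k + wt l.

Lemma seq_top (s : seq K) : s != [::] ->
  exists2 k, k \in s & forall l, l \in s -> wt l = wt k \/ C (wt k - wt l).
Proof.
elim: s => // k [|k' s] IH _.
  by exists k; [rewrite inE|move=> l; rewrite inE => /eqP->; left].
have [//|m ms mP] := IH.
have [E|/eqP E] := eqVneq (wt k) (wt m).
  by exists m; [rewrite inE ms orbT|move=> l; rewrite inE => /orP[/eqP->|/mP]; [left|]].
have [|km|mk] := @Ctot (wt m - wt k).
- by move/eqP; rewrite subr_eq0 => /eqP mk; apply: E.
- by exists m; [rewrite inE ms orbT|move=> l; rewrite inE => /orP[/eqP->|/mP]; [right|]].
exists k; first exact: mem_head.
rewrite opprB in mk; move=> l; rewrite inE => /orP[/eqP->|/mP[->|ml]]; [by left|by right|right].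
by rewrite -(subrKA (wt m)); apply: CD.
Qed.

(** Among the finitely many weights of [u] one is the largest for the order
    with positive cone [C]; [u1] collects the monomials of this weight. *)
Lemma top_part u : u != 0 ->
  exists k u1 u2, [/\ u = u1 + u2, sgcoeff k u1 != 0,
    supp_in (fun l => wt l = wt k) u1, supp_in (fun l => C (wt k - wt l)) u2
    & forall l, sgcoeff l u1 != 0 -> sgcoeff l u != 0].
Proof.
move=> u0.
have [|k ku kP] := @seq_top (msupp u).
  by apply: contra u0 => /eqP E; rewrite [u]sgalg_sum E big_nil.
exists k, (sgpart (fun l => wt l == wt k) u), (u - sgpart (fun l => wt l == wt k) u).
split; first by rewrite addrC subrK.
- by rewrite sgpartE eqxx /sgcoeff mcoeff_neq0.
- by move=> l; rewrite sgpartE; case: ifP => [/eqP //|_]; rewrite eqxx.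
- move=> l; rewrite linearB /= sgpartE; case: (eqVneq (wt l) (wt k)) => [_|lk].
    by rewrite subrr eqxx.
  rewrite subr0 => lu; have [|E|//] := kP l.
    by rewrite -mcoeff_neq0.
  by rewrite E eqxx in lk.
by move=> l; rewrite sgpartE; case: ifP => // _; rewrite eqxx.
Qed.

Hypothesis wt_inj : injective wt.

Lemma lead_coeff u : u != 0 ->
  exists k, sgcoeff k u != 0 /\ exists2 u', u = sgcoeff k u *: sgbase F k + u' & 
    supp_in (fun l => C (wt k - wt l)) u'.
Proof.
move=> /top_part[k [u1 [u2 [uE uk u1k u2k u1u]]]].
exists k; split; first exact: u1u.
exists u2 => //; rewrite {1}uE; congr (_ + _).
have u2k0 : sgcoeff k u2 = 0 by apply/eqP/negP => /negP/u2k; rewrite subrr.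
rewrite uE linearD /= u2k0 addr0; apply/sgalgP=> l; rewrite linearZ /= sgcoeffU.
case: eqVneq => [<-|kl]; first by rewrite mulr1.
rewrite mulr0; apply/eqP/negP => /negP/u1k/wt_inj lk.
by rewrite lk eqxx in kl.
Qed.

(** A product of two monomials of [u] and [v] has the largest weight only if
    both factors do, so the leading monomials multiply without cancellation. *)
Lemma lead_mul u v : u != 0 -> v != 0 ->
  exists k l, [/\ sgcoeff k u != 0, sgcoeff l v != 0, sgcoeff (k + l) (u * v) != 0,
    supp_in (fun m => m = k \/ C (wt k - wt m)) u /\
    supp_in (fun m => m = l \/ C (wt l - wt m)) v
    & forall m, sgcoeff m (u * v) != 0 -> m = k + l \/ C (wt (k + l) - wt m)].
Proof.
move=> /lead_coeff[k [uk [u' uE u'k]]] /lead_coeff[l [vl [v' vE v'l]]].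
move: uk vl uE vE; set a := sgcoeff k u; set b := sgcoeff l v => uk vl uE vE.
pose r := (a *: sgbase F k) * v' + u' * (b *: sgbase F l + v').
have rP : supp_in (fun m => C (wt (k + l) - wt m)) r.
  apply: supp_inD.
    apply: (@supp_inM (fun m => m = k) (fun m => C (wt l - wt m))) => //.
    - by move=> m n -> ln; rewrite !wtD opprD addrACA subrr add0r.
    - by apply: supp_inZ; apply: supp_inU.
  apply: (@supp_inM (fun m => C (wt k - wt m)) (fun m => m = l \/ C (wt l - wt m))) => //.
    move=> m n km [->|ln]; rewrite !wtD opprD addrACA; last exact: CD.
    by rewrite subrr addr0.
  apply: supp_inD; first by apply: supp_inZ; apply: supp_inU; left.
  by apply: supp_inS v'l => m; right.
have uvE : u * v = (a * b) *: sgbase F (k + l) + r.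
  rewrite /r -sgbaseM -scalerA [b *: _]scalerAr [a *: _]scalerAl addrA -mulrDr -vE.
  by rewrite -mulrDl -uE.
exists k, l; split=> //.
- rewrite uvE linearD linearZ /= sgcoeffU eqxx mulr1.
  have -> : sgcoeff (k + l) r = 0 by apply/eqP/negP => /negP/rP; rewrite subrr.
  by rewrite addr0 mulf_neq0.
- by split; [rewrite uE|rewrite vE]; apply: supp_inD; (try by apply: supp_inZ; apply: supp_inU; left);
    [apply: supp_inS u'k => m; right|apply: supp_inS v'l => m; right].
move=> m; rewrite uvE linearD linearZ /= sgcoeffU.
by case: (eqVneq (k + l) m) => [->|_]; [left|rewrite mulr0 add0r => /rP; right].
Qed.
End Lead.
End Supports.

Section Domain.
Context (F : fieldType) (K : nmodType) (V : zmodType) (wt : K -> V).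
Hypothesis V_tf : forall (x : V) n, x *+ n.+1 = 0 -> x = 0.
Hypothesis wtD : forall k l, wt (k + l) = wt k + wt l.
Hypothesis wt_inj : injective wt.
Implicit Types u v : sgalg F K.

Lemma sgalg_mul_eq0 u v : u * v = 0 -> u = 0 \/ v = 0.
Proof.
move=> uv0; have [->|u0] := eqVneq u 0; first by left.
have [->|v0] := eqVneq v 0; first by right.
have [C [CD C0 Ctot]] := total_cone_exists V_tf.
have [k [l [_ _ /negP[]]]] := lead_mul CD C0 Ctot wtD wt_inj u0 v0.
by rewrite uv0 linear0.
Qed.

(** The product of the leading monomials of [u] and [v] is [1], and so is the
    product of their trailing monomials, which lead for the opposite order.
    Hence the leading and the trailing monomial of [u] agree. *)
Lemma sgalg_unit u v : u * v = 1 ->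
  exists k l c, [/\ k + l = 0, c != 0 & u = c *: sgbase F k].
Proof.
move=> uv1.
have one0 : (1 : sgalg F K) != 0 by exact: oner_neq0.
have u0 : u != 0 by apply: contraNneq one0 => u0; rewrite -uv1 u0 mul0r.
have v0 : v != 0 by apply: contraNneq one0 => v0; rewrite -uv1 v0 mulr0.
have coeff1 (m : K) : sgcoeff m (1 : sgalg F K) != 0 -> m = 0.
  by rewrite (sgcoeffU F m 0); case: (eqVneq 0 m) => [->|_ /eqP].
have [C [CD C0 Ctot]] := total_cone_exists V_tf.
have [k [l [uk vl kl [uS vS] _]]] := lead_mul CD C0 Ctot wtD wt_inj u0 v0.
pose C' x := C (- x).
have [| | |k' [l' [uk' vl' kl' [uS' _] _]]] := @lead_mul _ _ _ C' wt _ _ _ wtD wt_inj u v u0 v0.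
- by move=> x y; rewrite /C' opprD; apply: CD.
- by rewrite /C' oppr0.
- by move=> x /Ctot; rewrite /C' opprK or_comm.
rewrite uv1 in kl kl'; move/coeff1: kl => kl; move/coeff1: kl' => kl'.
have E : wt k - wt k' = - (wt l - wt l').
  by apply/eqP; rewrite -addr_eq0 addrACA -opprD -!wtD kl kl' subrr.
have kk' : k = k'.
  have [->//|Ck] := uS _ uk'; have [ll'|Cl] := vS _ vl'; exfalso; apply: C0.
    by rewrite E ll' subrr oppr0 in Ck.
  by have := CD _ _ Ck Cl; rewrite E addNr.
exists k, l, (sgcoeff k u); split=> //; apply/sgalgP=> m; rewrite linearZ /= sgcoeffU.
case: eqVneq => [<-|km]; first by rewrite mulr1.
rewrite mulr0; apply/eqP/negP=> /negP um.
have [mk|Cm] := uS _ um; first by rewrite mk eqxx in km.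
have [mk|Cm'] := uS' _ um; first by rewrite mk kk' eqxx in km.
by apply: C0; have := CD _ _ Cm Cm'; rewrite kk' addrN.
Qed.
End Domain.

(** * Coefficients in the algebra and its units *)

Section Coefficients.
Context (F : fieldType) (Gamma : zmodClosed 'rV[F]_4) (J : jtype).
Local Notation A := (xu_A4 Gamma J).
Local Notation xmon := (xmon Gamma J).
Local Notation xg alpha := (xmon alpha 0).
Local Notation d := (@xu_d F Gamma J).
Implicit Types (u v w : A) (alpha beta : 'rV[F]_4) (i j : 'rV[nat]_4) (p q : 'I_4).

(** The coefficient at [xmon alpha i], extended by [0] to exponents that do
    not occur, in line with the convention for [xmon]. *)
Definition xcoeff alpha i u : F :=
  if insub alpha is Some g then
    if insub i is Some j then sgcoeff (g, j) u else 0
  else 0.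

Fact xcoeff_is_linear alpha i : linear_for *%R (xcoeff alpha i).
Proof.
move=> a u v; rewrite /xcoeff; case: insub => [g|]; last by rewrite mulr0 addr0.
by case: insub => [h|]; [apply: sgcoeff_is_linear|rewrite mulr0 addr0].
Qed.

HB.instance Definition _ alpha i := GRing.isLinear.Build F A F *%R
  (xcoeff alpha i) (xcoeff_is_linear alpha i).

Lemma xcoeffE alpha i (aG : alpha \in Gamma) (iJ : i \in jset J) u :
  xcoeff alpha i u = sgcoeff (GIdx aG, JIdx iJ) u.
Proof. by rewrite /xcoeff (insubT (mem Gamma) aG) (insubT (mem (jset J)) iJ). Qed.

Lemma xcoeff_outl alpha i u : alpha \notin Gamma -> xcoeff alpha i u = 0.
Proof. by move=> aG; rewrite /xcoeff insubN. Qed.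

Lemma xcoeff_outr alpha i u : i \notin jset J -> xcoeff alpha i u = 0.
Proof. by move=> iJ; rewrite /xcoeff; case: insub => // g; rewrite insubN. Qed.

Lemma xcoeffP u v : (forall alpha i, alpha \in Gamma -> i \in jset J ->
  xcoeff alpha i u = xcoeff alpha i v) -> u = v.
Proof.
by move=> E; apply/sgalgP=> -[[al aG] [i iJ]]; have := E al i aG iJ; rewrite !xcoeffE.
Qed.

Lemma xcoeff_mon alpha i beta j : beta \in Gamma -> j \in jset J ->
  xcoeff alpha i (xmon beta j) = ((alpha == beta) && (i == j))%:R.
Proof.
move=> bG jJ; case: (boolP (alpha \in Gamma)) => aG; last first.
  rewrite xcoeff_outl //; case: eqVneq => // E; by rewrite E bG in aG.
case: (boolP (i \in jset J)) => iJ; last first.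
  rewrite xcoeff_outr //; case: (eqVneq i j) => [E|]; last by rewrite andbF.
  by rewrite E jJ in iJ.
rewrite xcoeffE xmonE sgcoeffU; congr (nat_of_bool _)%:R.
by rewrite (eq_sym alpha) (eq_sym i); apply/eqP/andP => [[-> ->]|[/eqP E1 /eqP E2]];
  [|congr pair; apply: val_inj].
Qed.

Lemma jincE i p q : (i + single 1%N p) 0 q = (i 0%R q + (q == p))%N.
Proof. by rewrite !mxE; case: eqP. Qed.

Lemma jdecE i p q : jdec i p 0 q = (i 0%R q - (q == p))%N.
Proof. by rewrite !mxE; case: eqP. Qed.

Lemma jsetD1 i p : (i + single 1%N p \in jset J) = (i \in jset J) && J p.
Proof.
apply/jsetP/andP=> [iJ|[/jsetP iJ Jp] q]; last first.
  have := iJ q; rewrite jincE; case: eqP => [->|_]; last by rewrite addn0.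
  by rewrite Jp.
split; last by have := iJ p; rewrite jincE eqxx /jfactor addn1; case: (J p).
apply/jsetP=> q; have := iJ q; rewrite jincE /jfactor; case: (J q) => //.
by rewrite !inE addn_eq0 => /andP[].
Qed.

Lemma xcoeff_d p alpha i u : i \in jset J ->
  xcoeff alpha i (d p u)
    = alpha 0 p * xcoeff alpha i u + (i 0 p).+1%:R * xcoeff alpha (i + single 1%N p) u.
Proof.
move=> iJ; elim/xu_ind: u => [|a u v IHu IHv|be j bG jJ].
- by rewrite xu_d0 !linear0 !mulr0 addr0.
- by rewrite xu_d_linear !linearP /= IHu IHv; ring.
rewrite xu_dE // linearD !linearZ /= !xcoeff_mon ?jdec_jset //.
congr (_ + _); first by case: (eqVneq alpha be) => [->//|_]; rewrite !mulr0.
case: (eqVneq alpha be) => [_|_] /=; last by rewrite !mulr0.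
case: (eqVneq (j 0 p) 0%N) => [j0|j0].
  rewrite j0 mul0r; case: eqP => [E|_]; last by rewrite mulr0.
  by move/rowP/(_ p): E; rewrite jincE eqxx j0 addn1.
have -> : (i == jdec j p) = (i + single 1%N p == j).
  apply/eqP/eqP => [->|<-]; apply/rowP=> q.
    by rewrite jincE jdecE; case: (eqVneq q p) => [->|_]; rewrite ?subn0 ?addn0 // subnK // lt0n.
  by rewrite jdecE jincE addnK.
case: eqP => [<-|_]; last by rewrite !mulr0.
by rewrite jincE eqxx addn1.
Qed.

Lemma xcoeff_shift beta alpha i u : beta \in Gamma ->
  xcoeff (alpha + beta) i (u * xg beta) = xcoeff alpha i u.
Proof.
move=> bG; elim/xu_ind: u => [|a u v IHu IHv|ga j gG jJ].
- by rewrite mul0r !linear0.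
- by rewrite mulrDl -scalerAl !linearP /= IHu IHv.
rewrite xmonM ?jset0 // addr0 !xcoeff_mon ?rpredD //; congr (nat_of_bool (_ && _))%:R.
exact: (inj_eq (addIr beta)).
Qed.

Lemma xg0 : xg 0 = 1.
Proof.
rewrite (xmonE (rpred0 Gamma) (rpred0 (jset J))).
by congr sgbase; congr pair; apply: val_inj.
Qed.

Lemma xmon_neq0 alpha i : alpha \in Gamma -> i \in jset J -> xmon alpha i != 0.
Proof.
move=> aG iJ; apply/eqP => /(congr1 (xcoeff alpha i)).
by rewrite xcoeff_mon // !eqxx linear0 => /eqP; rewrite oner_eq0.
Qed.

Lemma xg_neq0 alpha : alpha \in Gamma -> xg alpha != 0.
Proof. by move=> aG; apply: xmon_neq0 => //; apply: jset0. Qed.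

Lemma xgM alpha beta : alpha \in Gamma -> beta \in Gamma ->
  xg alpha * xg beta = xg (alpha + beta).
Proof. by move=> aG bG; rewrite xmonM ?jset0 // addr0. Qed.

Lemma xgV alpha : alpha \in Gamma -> xg alpha * xg (- alpha) = 1.
Proof. by move=> aG; rewrite xgM ?rpredN // addrN xg0. Qed.

Lemma bracketE u v : [lie u, v] = 
  xg (sigma F) * (d p1 u * d p2 v - d p1 v * d p2 u)
  + (u + d p3 u) * d p4 v - (v + d p3 v) * d p4 u.
Proof. by []. Qed.

Lemma xcoeff_neq0 u : u != 0 -> exists alpha i,
  [/\ alpha \in Gamma, i \in jset J & xcoeff alpha i u != 0].
Proof.
move=> u0; apply: contrapT => no; move/eqP: u0; apply; apply: xcoeffP => al i aG iJ.
rewrite linear0; apply/eqP/negP => /negP un0; apply: no.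
by exists al, i; split.
Qed.

Lemma xu_const : exists c : F -> A,
  [/\ forall a u, a *: u = c a * u, forall a b, c (a + b) = c a + c b,
      forall a b, c (a * b) = c a * c b, forall a, c (- a) = - c a & c 1 = 1 /\ c 0 = 0].
Proof.
exists (fun a => a%:A); split=> [a u|a b|a b|a|]; first by rewrite mulr_algl.
- by rewrite scalerDl.
- by rewrite -scalerAl mul1r scalerA.
- by rewrite scaleNr.
- by rewrite scale1r scale0r.
Qed.
End Coefficients.

(** [ring] has no notion of scaling: scalars are first turned into elements of
    the ring by an abstract ring morphism [c]. *)
Ltac xu_ring Gamma J :=
  let c := fresh "c" in let cE := fresh "cE" in let cD := fresh "cD" in
  let cM := fresh "cM" in let cN := fresh "cN" in let c1 := fresh "c1" in
  let c0 := fresh "c0" in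
  have [c [cE cD cM cN [c1 c0]]] := xu_const Gamma J;
  rewrite ?cE ?(cD, cM, cN, c1, c0); ring.

Section DomainA.
Context (F : fieldType) (char0 : [pchar F] =i pred0).
Context (Gamma : zmodClosed 'rV[F]_4) (J : jtype).
Local Notation A := (xu_A4 Gamma J).
Local Notation xmon := (xmon Gamma J).
Local Notation xg alpha := (xmon alpha 0).
Implicit Types (u v w : A).

Lemma natf_eq0_char0 n : (n%:R == 0 :> F) = (n == 0%N).
Proof. exact: ((pcharf0P F).1 char0). Qed.

Lemma rV_torsion_free m (x : 'rV[F]_m) n : x *+ n.+1 = 0 -> x = 0.
Proof.
move=> E; apply/rowP=> q; move/rowP/(_ q): E; rewrite mulmxnE !mxE => /eqP.
by rewrite -mulr_natr mulf_eq0 natf_eq0_char0 orbF => /eqP.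
Qed.

(* The exponents in [nat] are sent to [F], so that the index monoid embeds into
   a torsion-free group. *)
Let wt (k : (gidx Gamma * jidx J)%type) : ('rV[F]_4 * 'rV[F]_4)%type :=
  (gidx_val k.1, map_mx (fun n => n%:R) (jidx_val k.2)).

Let wt_tf (x : ('rV[F]_4 * 'rV[F]_4)%type) n : x *+ n.+1 = 0 -> x = 0.
Proof.
have E m : x *+ m = (x.1 *+ m, x.2 *+ m).
  by elim: m => [|m IH]; rewrite ?mulr0n // !mulrS IH.
by rewrite E => -[/rV_torsion_free E1 /rV_torsion_free E2]; case: x E1 E2 {E} => a b /= -> ->.
Qed.

Let wtD k l : wt (k + l) = wt k + wt l.
Proof. by congr pair; apply/rowP=> q; rewrite !mxE natrD. Qed.

Let wt_inj : injective wt.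
Proof.
move=> [g i] [h j] [/= E1 E2]; congr pair; apply: val_inj => //=.
apply/rowP=> q; move/rowP/(_ q): E2; rewrite !mxE => /eqP.
case: (leqP (jidx_val i 0 q) (jidx_val j 0 q)) => le.
  rewrite eq_sym -subr_eq0 -natrB // natf_eq0_char0 subn_eq0 => ?; lia.
by rewrite -subr_eq0 -natrB 1?ltnW // natf_eq0_char0 subn_eq0 => ?; lia.
Qed.

Lemma xu_mul_eq0 u v : u * v = 0 -> u = 0 \/ v = 0.
Proof. exact: (sgalg_mul_eq0 wt_tf wtD wt_inj). Qed.

Lemma xu_mulI u v w : u != 0 -> u * v = u * w -> v = w.
Proof.
move=> u0 /eqP; rewrite -subr_eq0 -mulrBr => /eqP/xu_mul_eq0[/eqP|/eqP].
  by rewrite (negPf u0).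
by rewrite subr_eq0 => /eqP.
Qed.

Lemma xu_mul_neq0 u v : u != 0 -> v != 0 -> u * v != 0.
Proof. by move=> /eqP u0 /eqP v0; apply/eqP=> /xu_mul_eq0[]. Qed.

Lemma xu_expr_neq0 u n : u != 0 -> u ^+ n != 0.
Proof.
move=> u0; elim: n => [|n IH]; first by rewrite expr0 oner_neq0.
by rewrite exprS xu_mul_neq0.
Qed.

Lemma xu_unit u v : u * v = 1 -> exists alpha c, [/\ alpha \in Gamma, c != 0 & u = c *: xg alpha].
Proof.
move=> /(sgalg_unit wt_tf wtD wt_inj)[[[al aG] [i iJ]] [[be j] [c [kl c0 uE]]]].
exists al, c; split=> //; rewrite uE; congr (_ *: _); rewrite -xmonE; congr xmon.
have /(congr1 (fun k => jidx_val k.2)) /= E := kl.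
by apply/rowP=> q; move/rowP/(_ q): E; rewrite !mxE => /eqP; rewrite addn_eq0 => /andP[/eqP].
Qed.
End DomainA.

(** * The torus and its weight spaces *)

Section LieBasics.
Context (F : fieldType) (Gamma : zmodClosed 'rV[F]_4) (J : jtype).
Local Notation A := (xu_A4 Gamma J).
Local Notation xmon := (xmon Gamma J).
Local Notation xg alpha := (xmon alpha 0).
Local Notation d := (@xu_d F Gamma J).
Local Notation sig := (sigma F).
Local Notation sig1 := (sigma1 F).
Local Notation inD u := (lie_pi (sigma1_ideal Gamma J) u \in @derived_pred F (xu_B4 Gamma J)).
Implicit Types (u v w : A) (alpha beta : 'rV[F]_4) (i j : 'rV[nat]_4) (p q : 'I_4).

Lemma xu_dN p u : d p (- u) = - d p u.
Proof. exact: linearN. Qed.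

Definition inZ u := exists c : F, u = c *: xg sig1.

Lemma sigmaE : (sig 0 p1 = 1) * (sig 0 p2 = 0) * (sig 0 p3 = 1) * (sig 0 p4 = 0).
Proof. by rewrite !mxE. Qed.

Lemma sigma1E : (sig1 0 p1 = 0) * (sig1 0 p2 = 0) * (sig1 0 p3 = - 1) * (sig1 0 p4 = 0).
Proof. by rewrite !mxE /= oppr0. Qed.

Lemma rV4P alpha beta : alpha 0 p1 = beta 0 p1 -> alpha 0 p2 = beta 0 p2 ->
  alpha 0 p3 = beta 0 p3 -> alpha 0 p4 = beta 0 p4 -> alpha = beta.
Proof.
move=> E1 E2 E3 E4; apply/rowP=> -[[|[|[|[|//]]]] lt4].
- by move: E1; congr (alpha 0 _ = beta 0 _); apply: val_inj.
- by move: E2; congr (alpha 0 _ = beta 0 _); apply: val_inj.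
- by move: E3; congr (alpha 0 _ = beta 0 _); apply: val_inj.
- by move: E4; congr (alpha 0 _ = beta 0 _); apply: val_inj.
Qed.

Lemma rvD alpha beta p : (alpha + beta) 0 p = alpha 0 p + beta 0 p.
Proof. exact: mxE. Qed.

Lemma rvN alpha p : (- alpha) 0 p = - alpha 0 p.
Proof. exact: mxE. Qed.

Lemma rv0 p : (0 : 'rV[F]_4) 0 p = 0.
Proof. exact: mxE. Qed.

Lemma rvMn alpha n p : (alpha *+ n) 0 p = alpha 0 p *+ n.
Proof. exact: mulmxnE. Qed.

Lemma singleE (a : F) p q : single a p 0 q = if q == p then a else 0.
Proof. exact: mxE. Qed.

Definition coordE := (sigmaE, sigma1E, singleE, rvD, rvN, rvMn).

Lemma inZ0 : inZ 0. Proof. by exists 0; rewrite scale0r. Qed.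

Lemma inZP a u v : inZ u -> inZ v -> inZ (a *: u + v).
Proof. by move=> [b ->] [c ->]; exists (a * b + c); rewrite scalerDl scalerA. Qed.

Lemma inZD u v : inZ u -> inZ v -> inZ (u + v).
Proof. by move=> uZ; rewrite -[u]scale1r; apply: inZP. Qed.

Lemma inZZ a u : inZ u -> inZ (a *: u).
Proof. by move=> uZ; rewrite -[_ *: u]addr0; apply: inZP => //; apply: inZ0. Qed.

Lemma inZN u : inZ u -> inZ (- u).
Proof. by rewrite -scaleN1r; apply: inZZ. Qed.

Lemma inZB u v : inZ u -> inZ v -> inZ (u - v).
Proof. by move=> uZ /inZN; apply: inZD. Qed.

Lemma inZ_pi u v :
  lie_pi (sigma1_ideal Gamma J) u = lie_pi (sigma1_ideal Gamma J) v <-> inZ (u - v).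
Proof. by rewrite lie_piP; split=> /asboolP. Qed.

Lemma lie_Zr u v : inZ v -> [lie u, v] = 0.
Proof. by move=> [c ->]; rewrite lieZr xmon_sigma1_central scaler0. Qed.

Lemma lie_Zl u v : inZ v -> [lie v, u] = 0.
Proof. by move=> vZ; rewrite lieC lie_Zr ?oppr0. Qed.

Lemma inD_lie u v : inD [lie u, v].
Proof. by rewrite lie_pi_lie; apply: lie_derived. Qed.

Lemma inDP a u v : inD u -> inD v -> inD (a *: u + v).
Proof. by move=> uD vD; rewrite linearP rpredD ?rpredZ. Qed.

Lemma inDZ a u : inD u -> inD (a *: u).
Proof. by move=> uD; rewrite linearZ rpredZ. Qed.

Lemma inDZr a u : a != 0 -> inD (a *: u) -> inD u.
Proof. by move=> a0 /(inDZ a^-1); rewrite scalerA mulVf // scale1r. Qed.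

Lemma d_Z p u : p = p2 \/ p = p4 -> inZ u -> d p u = 0.
Proof.
by move=> pE [c ->]; rewrite xu_dZ xu_dE0; case: pE => ->; rewrite sigma1E scale0r scaler0.
Qed.

Lemma dZ2 u : inZ u -> d p2 u = 0. Proof. by apply: d_Z; left. Qed.
Lemma dZ4 u : inZ u -> d p4 u = 0. Proof. by apply: d_Z; right. Qed.

Lemma d1 p : d p 1 = 0.
Proof. by rewrite -xg0 xu_dE0 mxE scale0r. Qed.

Lemma lie_1 u : [lie (1 : A), u] = d p4 u.
Proof. by rewrite bracketE !d1; ring. Qed.

Section SigmaIn.
Hypothesis sigG : sig \in Gamma.

Lemma lie_X u : [lie xg (- sig), u] = - d p2 u.
Proof.
rewrite bracketE !xu_dE0 ![(- sig) 0 _]mxE !sigmaE oppr0 !scale0r scaleN1r subrr.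
transitivity (- (xg sig * xg (- sig)) * d p2 u); first ring.
by rewrite xgV // mulN1r.
Qed.

Lemma d_lie p u v : p = p2 \/ p = p4 ->
  d p [lie u, v] = [lie d p u, v] + [lie u, d p v].
Proof.
move=> [->|->]; rewrite !bracketE !(xu_dN, xu_dD, xu_dM) xu_dE0 sigmaE scale0r.
  by rewrite (xu_dC p2 p1) (xu_dC p2 p3) (xu_dC p2 p4) (xu_dC p2 p1) (xu_dC p2 p3) (xu_dC p2 p4); ring.
by rewrite (xu_dC p4 p1) (xu_dC p4 p3) (xu_dC p4 p2) (xu_dC p4 p1) (xu_dC p4 p3) (xu_dC p4 p2); ring.
Qed.

(** The joint eigenspaces of the derivations [d p2] and [d p4], which are the
    inner derivations given by [xg (- sig)], up to sign, and [1]. *)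
Definition wspace (l m : F) u := d p2 u = l *: u /\ d p4 u = m *: u.

Lemma wspaceP l m a u v : wspace l m u -> wspace l m v -> wspace l m (a *: u + v).
Proof.
move=> [u2 u4] [v2 v4]; split; rewrite xu_d_linear ?u2 ?v2 ?u4 ?v4.
  by rewrite scalerDr !scalerA mulrC.
by rewrite scalerDr !scalerA mulrC.
Qed.

Lemma wspace0 l m : wspace l m 0.
Proof. by split; rewrite xu_d0 scaler0. Qed.

Lemma wspaceZ l m a u : wspace l m u -> wspace l m (a *: u).
Proof. by move=> uW; rewrite -[_ *: u]addr0; apply: wspaceP => //; apply: wspace0. Qed.

Lemma wspaceD l m u v : wspace l m u -> wspace l m v -> wspace l m (u + v).
Proof. by move=> uW; rewrite -[u]scale1r; apply: wspaceP. Qed.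

Lemma wspaceM l m l' m' u v : wspace l m u -> wspace l' m' v ->
  wspace (l + l') (m + m') (u * v).
Proof.
by move=> [u2 u4] [v2 v4]; split; rewrite xu_dM ?u2 ?v2 ?u4 ?v4 -scalerAl -scalerAr scalerDl.
Qed.

Lemma wspace_d p l m u : wspace l m u -> wspace l m (d p u).
Proof. by move=> [u2 u4]; split; rewrite xu_dC ?u2 ?u4 xu_dZ. Qed.

Lemma wspace_lie l m l' m' u v : wspace l m u -> wspace l' m' v ->
  wspace (l + l') (m + m') [lie u, v].
Proof.
move=> [u2 u4] [v2 v4]; split; rewrite d_lie; try by [left|right].
  by rewrite u2 v2 lieZl lieZr scalerDl.
by rewrite u4 v4 lieZl lieZr scalerDl.
Qed.

Lemma wspace_xg alpha : wspace (alpha 0 p2) (alpha 0 p4) (xg alpha).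
Proof. by split; rewrite xu_dE0. Qed.

Lemma wspaceZ0 l m u : (l, m) <> (0, 0) -> wspace l m u -> inZ u -> u = 0.
Proof.
move=> lm0 [u2 u4] uZ; rewrite dZ2 // in u2; rewrite dZ4 // in u4.
have [l0|l0] := eqVneq l 0; last first.
  by have /eqP := esym u2; rewrite scaler_eq0 (negPf l0) => /eqP.
have [m0|m0] := eqVneq m 0; first by rewrite l0 m0 in lm0.
by have /eqP := esym u4; rewrite scaler_eq0 (negPf m0) => /eqP.
Qed.

(** A vector of nonzero weight is a multiple of its bracket with an element
    of the torus. *)
Lemma wspace_inD l m u : (l, m) <> (0, 0) -> wspace l m u -> inD u.
Proof.
move=> lm0 [u2 u4].
have [l0|l0] := eqVneq l 0; last first.
  apply: (inDZr (a := - l)); rewrite ?oppr_eq0 //.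
  by rewrite scaleNr -u2 -lie_X; apply: inD_lie.
have [m0|m0] := eqVneq m 0; first by rewrite l0 m0 in lm0.
by apply: (inDZr m0); rewrite -u4 -lie_1; apply: inD_lie.
Qed.

Lemma lie_xg alpha beta : alpha \in Gamma -> beta \in Gamma ->
  [lie xg alpha, xg beta] =
    (alpha 0 p1 * beta 0 p2 - beta 0 p1 * alpha 0 p2) *: xg (alpha + beta + sig)
    + ((alpha 0 p3 + 1) * beta 0 p4 - (beta 0 p3 + 1) * alpha 0 p4) *: xg (alpha + beta).
Proof.
move=> aG bG; rewrite bracketE !xu_dE0 -!xgM ?rpredD //.
xu_ring Gamma J.
Qed.

(** Only the derivatives of [u] along the torus enter besides those of [f],
    and they are multiples of [u]. *)
Lemma lie_wspace0 l m f u : wspace 0 0 f -> wspace l m u ->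
  [lie f, u] = (l *: (xg sig * d p1 f) + m *: (f + d p3 f)) * u.
Proof.
move=> [f2 f4] [u2 u4]; rewrite bracketE f2 f4 u2 u4 !scale0r; xu_ring Gamma J.
Qed.

End SigmaIn.
End LieBasics.

(** * The adjoint action and the nilpotent parts of the torus *)

Lemma last_iter (T : Type) (P : T -> Prop) (f : T -> T) (x : T) n :
  ~ P x -> P (iter n f x) -> exists m, ~ P (iter m f x) /\ P (iter m.+1 f x).
Proof.
elim: n => [//|n IH] nPx Pn; have [Pm|nPm] := pselect (P (iter n f x)); first exact: IH.
by exists n.
Qed.

Section Leibniz.
Context (R : comNzRingType) (L : lieAlgType R).

Lemma lie0l (v : L) : [lie (0 : L), v] = 0.
Proof. by rewrite lieC linear0 oppr0. Qed.

Lemma iter0 (f : L -> L) n : f 0 = 0 -> iter n f 0 = 0.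
Proof. by move=> f0; elim: n => //= n ->. Qed.

Lemma iter_additive (f : L -> L) n : {morph f : u v / u + v} -> {morph iter n f : u v / u + v}.
Proof. by move=> fD u v; elim: n => //= n ->; rewrite fD. Qed.

(** In the iterated Leibniz formula for a bracket of two vectors on which the
    operator is nilpotent, only one term of the top order survives. Three
    operators occur because they are shifted by different eigenvalues in the
    applications; [u] is treated modulo elements that bracket trivially. *)
Lemma leibniz_top (NL NR NB : L -> L) :
    {morph NB : u v / u + v} ->
    (forall u v, NB [lie u, v] = [lie NL u, v] + [lie u, NR v]) ->
  forall n m u v, (forall w, [lie iter n.+1 NL u, w] = 0) -> iter m.+1 NR v = 0 ->
  iter (n + m) NB [lie u, v] = 'C(n + m, n)%:R *: [lie iter n NL u, iter m NR v]
  /\ iter (n + m).+1 NB [lie u, v] = 0.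
Proof.
move=> NBD NBlie.
have NB0 : NB 0 = 0 by apply: (addrI (NB 0)); rewrite -NBD !addr0.
have step s u v : iter s.+1 NB [lie u, v] = iter s NB [lie NL u, v] + iter s NB [lie u, NR v].
  by rewrite iterSr NBlie iter_additive.
move=> n m; move: {2}(n + m)%N (erefl (n + m)%N) => s; elim: s n m => [|t IH] n m nm u v uc v0.
  case: n m nm uc v0 => [|//] [|//] _ /= uc v0.
  by rewrite bin0 scale1r NBlie uc v0 linear0 addr0.
have I1 : iter t NB [lie NL u, v] = 'C(t, n.-1)%:R *: (if n is n'.+1 then [lie iter n NL u, iter m NR v] else 0)
    /\ iter t.+1 NB [lie NL u, v] = 0.
  case: n nm uc => [|n] nm uc; first by rewrite (uc v) scaler0 !iter0.
  have ns : (n + m)%N = t by move: nm; rewrite addSn => -[].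
  by have := IH n m ns (NL u) v; rewrite -!iterSr ns; apply.
have I2 : iter t NB [lie u, NR v] = 'C(t, n)%:R *: (if m is m'.+1 then [lie iter n NL u, iter m NR v] else 0)
    /\ iter t.+1 NB [lie u, NR v] = 0.
  case: m nm v0 I1 => [|m] nm v0 _; first by rewrite /= in v0; rewrite v0 linear0 scaler0 !iter0.
  have ns : (n + m)%N = t by move: nm; rewrite addnS => -[].
  by have := IH n m ns u (NR v); rewrite -!iterSr ns; apply.
rewrite nm; split; rewrite step; last by rewrite I1.2 I2.2 addr0.
rewrite I1.1 I2.1.
case: n nm {uc I1 I2} => [|n] nm.
  by rewrite scaler0 add0r !bin0; case: m nm v0.
case: m nm v0 => [|m] nm v0.
  by have -> : t = n by [lia]; rewrite scaler0 addr0 !binn.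
by rewrite binS natrD scalerDl addrC.
Qed.

End Leibniz.

Section AdPoly.
Context (F : closedFieldType) (char0 : [pchar F] =i pred0).
Context (Gamma : zmodClosed 'rV[F]_4) (J : jtype).
Local Notation A := (xu_A4 Gamma J).
Local Notation xmon := (xmon Gamma J).
Local Notation d := (@xu_d F Gamma J).
Local Notation sig := (sigma F).
Local Notation sig1 := (sigma1 F).
Local Notation inZ := (@inZ F Gamma J).
Implicit Types (u v w : A) (alpha beta : 'rV[F]_4) (i j : 'rV[nat]_4) (p q : 'I_4) (P : {poly F}).
Hypothesis sigG : sig \in Gamma.

Let nat0 n : (n%:R == 0 :> F) = (n == 0%N) := natf_eq0_char0 char0 n.

(** ** Finite supports *)

Lemma deg_bound u : exists M, forall alpha i p, xcoeff alpha i u != 0 -> (i 0%R p <= M)%N.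
Proof.
elim/xu_ind: u => [|a u v [M HM] [N HN]|be j bG jJ].
- by exists 0%N => al i p; rewrite linear0 eqxx.
- exists (M + N)%N => al i p; case: (eqVneq (xcoeff al i u) 0) => [E|/(HM _ _ p) le _].
    by rewrite linearP /= E mulr0 add0r => /(HN _ _ p)/leq_trans; apply; rewrite leq_addl.
  by rewrite (leq_trans le) // leq_addr.
exists (\max_q j 0%R q) => al i p; rewrite xcoeff_mon //.
case: (eqVneq i j) => [->|]; last by rewrite andbF eqxx.
by move=> _; rewrite leq_bigmax.
Qed.

(** For fixed [alpha] the eigenvalue equation ties the coefficient at [i +
    1_p] to [(l - alpha_p)] times the one at [i]: if [alpha_p] differs from
    [l], the powers of the variable are unbounded. *)
Lemma eig_supp p l u alpha i : d p u = l *: u -> xcoeff alpha i u != 0 ->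
  alpha 0 p = l /\ i 0 p = 0%N.
Proof.
move=> du ai0.
have iJ : i \in jset J by apply: contraNT ai0 => iJ; rewrite xcoeff_outr.
have step j : j \in jset J ->
    (l - alpha 0 p) * xcoeff alpha j u = (j 0 p).+1%:R * xcoeff alpha (j + single 1%N p) u.
  move=> jJ; have := congr1 (xcoeff alpha j) du; rewrite xcoeff_d // linearZ /=.
  by move=> E; rewrite mulrBl -E addrAC subrr add0r.
have al : alpha 0 p = l.
  apply/eqP; rewrite eq_sym -subr_eq0; apply/negP => /negP l0.
  have [M HM] := deg_bound u.
  have grow m : exists2 j, xcoeff alpha j u != 0 & (m <= j 0%R p)%N.
    elim: m => [|m [j j0 mj]]; first by exists i.
    have jJ : j \in jset J by apply: contraNT j0 => jJ; rewrite xcoeff_outr.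
    exists (j + single 1%N p); last by rewrite jincE eqxx addn1.
    by apply: contraNneq (mulf_neq0 l0 j0) => E; rewrite step // E mulr0.
  by have [j /(HM _ _ p) H1 /leq_trans/(_ H1)] := grow M.+1; rewrite ltnn.
split=> //; apply/eqP/negP => /negP ip.
have iE : i = jdec i p + single 1%N p.
  by apply/rowP=> q; rewrite jincE jdecE; case: (eqVneq q p) => [->|_]; rewrite ?subn0 ?addn0 // subnK // lt0n.
have := step _ (jdec_jset p iJ); rewrite -iE al subrr mul0r => /esym/eqP.
by rewrite mulf_eq0 (negPf ai0) nat0.
Qed.

(** By [eig_supp] the four equations leave [sigma1] as the only possible
    exponent. *)
Lemma ker_inZ u : d p1 u = 0 -> d p2 u = 0 -> u + d p3 u = 0 -> d p4 u = 0 -> inZ u.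
Proof.
move=> u1 u2 u3 u4; exists (xcoeff sig1 0 u); apply: xcoeffP => al i aG iJ.
have e1 : d p1 u = 0 *: u by rewrite scale0r.
have e2 : d p2 u = 0 *: u by rewrite scale0r.
have e4 : d p4 u = 0 *: u by rewrite scale0r.
have e3 : d p3 u = (- 1) *: u by rewrite scaleN1r; apply/eqP; rewrite -addr_eq0 addrC u3.
rewrite linearZ /=.
have supp alpha j : xcoeff alpha j u != 0 -> alpha = sig1 /\ j = 0.
  move=> c0; have [a1 j1] := eig_supp e1 c0; have [a2 j2] := eig_supp e2 c0.
  have [a3 j3] := eig_supp e3 c0; have [a4 j4] := eig_supp e4 c0.
  split; first by apply: rV4P; rewrite sigma1E.
  apply/rowP=> -[[|[|[|[|//]]]] lt4]; rewrite [RHS]mxE.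
  - by move: j1; congr (j _ _ = _); apply: val_inj.
  - by move: j2; congr (j _ _ = _); apply: val_inj.
  - by move: j3; congr (j _ _ = _); apply: val_inj.
  - by move: j4; congr (j _ _ = _); apply: val_inj.
case: (eqVneq (xcoeff al i u) 0) => [E|/[dup] ne0 /supp[-> ->]].
  case: (eqVneq al sig1) => [Ea|na]; last first.
    case: (eqVneq (xcoeff sig1 0 u) 0) => [->|/supp _]; first by rewrite E mul0r.
    have [sG|sG] := boolP (sig1 \in Gamma); last by rewrite xmon_outl // linear0 mulr0.
    by rewrite xcoeff_mon ?jset0 // (negPf na) mulr0.
  case: (eqVneq i 0) => [Ei|ni]; first by rewrite Ea Ei in E *; rewrite E mul0r.
  by rewrite -Ea E xcoeff_mon ?jset0 // (negPf ni) andbF mulr0.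
have [sG|sG] := boolP (sig1 \in Gamma); last by rewrite xcoeff_outl ?mul0r.
by rewrite xcoeff_mon ?jset0 // !eqxx mulr1.
Qed.

(** ** Weights *)
Definition wt2 (k : (gidx Gamma * jidx J)%type) : (F * F)%type :=
  (gidx_val k.1 0 p2, gidx_val k.1 0 p4).

Lemma wt2D k l : wt2 (k + l) = wt2 k + wt2 l.
Proof. by rewrite /wt2 !mxE. Qed.

Definition wsupp (Q : F * F -> Prop) u := @supp_in F _ (fun k => Q (wt2 k)) u.

Lemma wsupp_mon Q alpha i : Q (alpha 0 p2, alpha 0 p4) -> wsupp Q (xmon alpha i).
Proof.
move=> Qa; have [aG|aG] := boolP (alpha \in Gamma); last first.
  by rewrite xmon_outl //; apply: supp_in0.
have [iJ|iJ] := boolP (i \in jset J); last first.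
  have -> : xmon alpha i = 0.
    by rewrite xmon.unlock (insubT (mem Gamma) aG) insubN.
  exact: supp_in0.
by rewrite xmonE; apply: supp_inU.
Qed.

Lemma wsupp_ind Q (P : A -> Prop) u :
    P 0 -> (forall a v w, P v -> P w -> P (a *: v + w)) ->
    (forall alpha i, alpha \in Gamma -> i \in jset J -> Q (alpha 0 p2, alpha 0 p4) -> P (xmon alpha i)) ->
  wsupp Q u -> P u.
Proof.
move=> P0 PD PU; apply: (supp_in_ind (P := P)) => // -[[al aG] [i iJ]] Qk.
by have := PU al i aG iJ Qk; rewrite xmonE.
Qed.

Lemma wsupp_d Q p u : wsupp Q u -> wsupp Q (d p u).
Proof.
apply: (wsupp_ind (P := fun u => wsupp Q (d p u))) => [|a v w IHv IHw|al i aG iJ Qa]; first by rewrite xu_d0; apply: supp_in0.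
  by rewrite xu_d_linear; apply: supp_inP.
by rewrite xu_dE //; apply: supp_inP; [|apply: supp_inZ]; apply: wsupp_mon.
Qed.

Lemma wsupp_lie Q Q' Q'' u v : (forall x y, Q x -> Q' y -> Q'' (x + y)) ->
  wsupp Q u -> wsupp Q' v -> wsupp Q'' [lie u, v].
Proof.
move=> QQ Qu Qv.
have M u' v' : wsupp Q u' -> wsupp Q' v' -> wsupp Q'' (u' * v').
  by apply: supp_inM => k l Qk Ql; rewrite wt2D; apply: QQ.
have M' u' v' : wsupp Q u' -> wsupp Q' v' -> wsupp Q'' (v' * u').
  by move=> *; rewrite mulrC; apply: M.
rewrite bracketE; apply: supp_inD; [apply: supp_inD|apply: supp_inN]; last first.
- by apply: M'; [|apply: supp_inD => //]; apply: wsupp_d.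
- by apply: M; [apply: supp_inD => //|]; apply: wsupp_d.
apply: (@supp_inM _ _ (fun k => wt2 k = 0) (fun k => Q'' (wt2 k))).
- by move=> k l k0; rewrite wt2D k0 add0r.
- by apply: (@wsupp_mon (fun x => x = 0)); rewrite !sigmaE.
by apply: supp_inD; [|apply: supp_inN]; [apply: M|apply: M']; apply: wsupp_d.
Qed.

(** ** Nilpotent parts of the derivations *)
(** This operator is nilpotent on the monomials whose exponent has [p]-th
    coordinate [l]. *)
Definition shifted_d p l u := d p u - l *: u.

Lemma shifted_dP p l a u v : shifted_d p l (a *: u + v) = a *: shifted_d p l u + shifted_d p l v.
Proof. by rewrite /shifted_d xu_d_linear; xu_ring Gamma J. Qed.

Lemma shifted_dD p l : {morph shifted_d p l : u v / u + v}.
Proof. by move=> u v; rewrite -[u]scale1r shifted_dP !scale1r. Qed.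

Lemma shifted_d0 p l : shifted_d p l 0 = 0.
Proof. by rewrite /shifted_d xu_d0 scaler0 subrr. Qed.

Lemma shifted_dZ p l a : {morph shifted_d p l : u / a *: u}.
Proof. by move=> u; have := shifted_dP p l a u 0; rewrite shifted_d0 !addr0. Qed.

Lemma iter_shifted_dP p l n a u v : iter n (shifted_d p l) (a *: u + v) = a *: iter n (shifted_d p l) u + iter n (shifted_d p l) v.
Proof. by elim: n => //= n ->; rewrite shifted_dP. Qed.

Lemma iter_shifted_d0 p l n : iter n (shifted_d p l) 0 = 0.
Proof. by elim: n => //= n ->; rewrite shifted_d0. Qed.

Lemma shifted_d_lie p l l' u v : p = p2 \/ p = p4 ->
  shifted_d p (l + l') [lie u, v] = [lie shifted_d p l u, v] + [lie u, shifted_d p l' v].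
Proof.
move=> pE; rewrite /shifted_d (d_lie _ _ pE) scalerDl lieBl lieBr lieZl lieZr.
by rewrite opprD addrACA.
Qed.

Lemma shifted_d_comm p l q m u : shifted_d p l (shifted_d q m u) = shifted_d q m (shifted_d p l u).
Proof.
by rewrite /shifted_d !(xu_dD, xu_dN, xu_dZ) (xu_dC p q); xu_ring Gamma J.
Qed.

Lemma iter_shifted_d_comm p l q m n k u :
  iter n (shifted_d p l) (iter k (shifted_d q m) u) = iter k (shifted_d q m) (iter n (shifted_d p l) u).
Proof.
elim: n => //= n ->; elim: k => //= k IH; by rewrite shifted_d_comm IH.
Qed.

Lemma shifted_d_mon_nil p alpha i : alpha \in Gamma -> i \in jset J ->
  iter (i 0%R p).+1 (shifted_d p (alpha 0 p)) (xmon alpha i) = 0.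
Proof.
move=> aG; move: {2}(i 0%R p) (erefl (i 0%R p)) => n; elim: n i => [|n IH] i ip iJ.
  by rewrite ip /= /shifted_d xu_dE // ip scale0r addr0 subrr.
rewrite ip iterSr /shifted_d -/(shifted_d p (alpha 0 p)) xu_dE // addrAC subrr add0r.
rewrite -[_ *: _]addr0 iter_shifted_dP iter_shifted_d0 addr0.
have E : jdec i p 0%R p = n by rewrite jdecE eqxx ip subn1.
by have := IH (jdec i p) E (jdec_jset p iJ); rewrite E => ->; rewrite scaler0.
Qed.

Lemma shifted_d_nil p u (x : F * F) : p = p2 \/ p = p4 -> wsupp (fun y => y = x) u ->
  exists n, iter n (shifted_d p (if p == p2 then x.1 else x.2)) u = 0.
Proof.
move=> pE; apply: (wsupp_ind (P := fun u => exists n, iter n (shifted_d p (if p == p2 then x.1 else x.2)) u = 0)).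
- by exists 0%N.
- move=> a v w [n vn] [m wm]; exists (n + m)%N; rewrite iter_shifted_dP.
  by rewrite [X in _ + X]iterD wm iter_shifted_d0 addr0 addnC iterD vn iter_shifted_d0 scaler0.
move=> al i aG iJ <-; exists (i 0%R p).+1.
have -> : (if p == p2 then (al 0 p2, al 0 p4).1 else (al 0 p2, al 0 p4).2) = al 0 p.
  by case: pE => ->.
exact: shifted_d_mon_nil.
Qed.

(** [leibniz_top] iterated along [k] brackets: the top power of the shifted
    derivation moves the full [n] derivatives to each factor [u]. *)
Lemma iter_lie_shifted_d_top p l n u v m k : p = p2 \/ p = p4 ->
    (forall w, [lie iter n.+1 (shifted_d p l) u, w] = 0) -> shifted_d p m v = 0 ->
  (exists2 c : F, c != 0 &
    iter (k * n) (shifted_d p (l *+ k + m)) (iter k (lie u) v) = c *: iter k (lie (iter n (shifted_d p l) u)) v)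
  /\ iter (k * n).+1 (shifted_d p (l *+ k + m)) (iter k (lie u) v) = 0.
Proof.
move=> pE uc v0; elim: k => [|k [[c c0 IH1] IH2]].
  by rewrite mulr0n add0r mul0n /= v0; split=> //; exists 1; rewrite ?oner_neq0 // scale1r.
have [E1 E2] := @leibniz_top F A (shifted_d p l) (shifted_d p (l *+ k + m)) (shifted_d p (l *+ k.+1 + m))
  (@shifted_dD p _) (fun u v => etrans (congr1 (fun x => shifted_d p x _) (etrans (congr1 (fun x => x + m) (mulrS l k)) (esym (addrA _ _ _)))) (shifted_d_lie _ _ _ _ pE)) n (k * n)%N u (iter k (lie u) v) uc IH2.
rewrite mulSn iterS E1 E2 IH1 lieZr scalerA; split=> //.
exists ('C(n + k * n, n)%:R * c); last by [].
by rewrite mulf_neq0 // nat0 -lt0n bin_gt0 leq_addr.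
Qed.

(** ** Polynomials in [ad u] *)
(** The value at [v] of the polynomial [P] in the adjoint action of [u]. *)
Definition ad_poly P u v := \sum_(i < size P) P`_i *: iter i (lie u) v.

Definition lfin u v := exists P, P != 0 /\ ad_poly P u v = 0.

Definition ad_nilp u v := exists k, iter k (lie u) v = 0.

Lemma ad_nilp_lfin u v : ad_nilp u v -> lfin u v.
Proof.
move=> [k uv]; exists 'X^k; split; first by rewrite -size_poly_eq0 size_polyXn.
rewrite /ad_poly size_polyXn big_ord_recr /= coefXn eqxx scale1r uv addr0.
by rewrite big1 // => i _; rewrite coefXn ltn_eqF // scale0r.
Qed.

(** If [T] kills all but the last iterate that occur in the relation, it
    kills the last one too, whose coefficient is the nonzero leading
    coefficient of [P]. *)
Lemma ad_poly_top P u v (T : A -> A) : (forall a v w, T (a *: v + w) = a *: T v + T w) ->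
  P != 0 -> ad_poly P u v = 0 ->
  (forall k, (k < (size P).-1)%N -> T (iter k (lie u) v) = 0) -> T (iter (size P).-1 (lie u) v) = 0.
Proof.
move=> TP P0; have sP : size P = (size P).-1.+1 by rewrite prednK // lt0n size_poly_eq0.
have T0 : T 0 = 0 by have := TP (- 1) 0 0; rewrite scaler0 addr0 scaleN1r addNr.
rewrite /ad_poly sP big_ord_recr /= -lead_coefE => E Tk.
have := congr1 T E; rewrite T0 addrC TP.
have -> : T (\sum_(i < (size P).-1) P`_i *: iter i (lie u) v) = 0.
  by apply: (big_ind (fun x => T x = 0)) => // [x y Tx Ty|i _];
    [rewrite -[x]scale1r TP Tx Ty scaler0 addr0|rewrite -[_ *: _]addr0 TP T0 Tk // scaler0 addr0].
by rewrite addr0 => /eqP; rewrite scaler_eq0 lead_coef_eq0 (negPf P0) => /eqP.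
Qed.

Lemma leibniz_nil p l n u v m : p = p2 \/ p = p4 ->
    (forall w, [lie iter n.+1 (shifted_d p l) u, w] = 0) -> shifted_d p m v = 0 ->
  ad_nilp u v -> ad_nilp (iter n (shifted_d p l) u) v.
Proof.
move=> pE uc v0 [k uv]; exists k.
have [[c c0 + _]] := iter_lie_shifted_d_top k pE uc v0.
by rewrite uv iter_shifted_d0 => /esym/eqP; rewrite scaler_eq0 (negPf c0) => /eqP.
Qed.

(** The power [k * n] of the derivation grows with the number [k] of
    brackets, so a high enough power isolates the leading term of an
    annihilating polynomial. *)
Lemma leibniz_lfin p n u v m : p = p2 \/ p = p4 -> (0 < n)%N ->
    (forall w, [lie iter n.+1 (shifted_d p 0) u, w] = 0) -> shifted_d p m v = 0 ->
  lfin u v -> ad_nilp (iter n (shifted_d p 0) u) v.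
Proof.
move=> pE n0 uc v0 [P [P0 uv]]; set K := (size P).-1; exists K.
have [[c c0 E] _] := iter_lie_shifted_d_top K pE uc v0.
suff H : iter (K * n) (shifted_d p (0 *+ K + m)) (iter K (lie u) v) = 0.
  by move: E; rewrite H => /esym/eqP; rewrite scaler_eq0 (negPf c0) => /eqP.
apply: ad_poly_top P0 uv _ => [a v' w'|k kK]; first exact: iter_shifted_dP.
have [_ Ek] := iter_lie_shifted_d_top k pE uc v0.
have le : ((k * n).+1 <= K * n)%N by rewrite (leq_trans _ (leq_mul kK (leqnn n))) // mulSn -[X in (X < _)%N]add0n ltn_add2r.
by rewrite -(subnK le) iterD !mul0rn in Ek *; rewrite Ek iter_shifted_d0.
Qed.

End AdPoly.

(** * Locally finite elements *)

Section LocallyFinite.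
Context (F : closedFieldType) (char0 : [pchar F] =i pred0).
Context (Gamma : zmodClosed 'rV[F]_4) (J : jtype).
Local Notation A := (xu_A4 Gamma J).
Local Notation xmon := (xmon Gamma J).
Local Notation xg alpha := (xmon alpha 0).
Local Notation d := (@xu_d F Gamma J).
Local Notation sig := (sigma F).
Local Notation sig1 := (sigma1 F).
Local Notation inD u := (lie_pi (sigma1_ideal Gamma J) u \in @derived_pred F (xu_B4 Gamma J)).
Local Notation inZ := (@inZ F Gamma J).
Local Notation wspace := (@wspace F Gamma J).
Implicit Types (u v w : A) (alpha beta : 'rV[F]_4) (i j : 'rV[nat]_4) (p q : 'I_4) (P : {poly F}).
Hypothesis GammaA : conditionA Gamma.

Let sigG : sig \in Gamma. Proof. by case: GammaA. Qed.
Let nat0 n : (n%:R == 0 :> F) = (n == 0%N) := natf_eq0_char0 char0 n.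

Lemma axis_exists p : exists2 a : F, a != 0 & single a p \in Gamma.
Proof. by case: GammaA. Qed.

(** The exponent splits as [n_[2]] plus the rest, or as [n_[4]] plus the
    rest, and one of the two brackets has a nonzero coefficient unless
    [gamma] is [sigma_2], the exponent excluded by the hypothesis. *)
Lemma inD_xg gamma : gamma \in Gamma -> gamma 0 p2 = 0 -> gamma 0 p4 = 0 ->
  gamma 0 p1 != 1 \/ gamma 0 p3 != - 2%:R -> inD (xg gamma).
Proof.
move=> gG g2 g4 [g1|g3].
  have [n n0 nG] := axis_exists p2.
  apply: (inDZr (a := (1 - gamma 0 p1) * n)); first by rewrite mulf_neq0 // subr_eq0 eq_sym.
  have := inD_lie (xg (single n p2)) (xg (gamma - sig - single n p2)).
  rewrite lie_xg ?rpredB // !coordE /= !(sub0r, oppr0, addr0, subr0, mul0r, mulr0, mulr1, g2, g4).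
  rewrite scale0r addr0; congr (inD (_ *: xg _)); first ring.
  by rewrite [X in X + _]addrC !subrK.
have [n n0 nG] := axis_exists p4.
apply: (inDZr (a := - (gamma 0 p3 + 2%:R) * n)).
  by rewrite mulf_neq0 // oppr_eq0 addr_eq0.
have := inD_lie (xg (single n p4)) (xg (gamma - single n p4)).
rewrite lie_xg ?rpredB // !coordE /= !(sub0r, oppr0, addr0, subr0, mul0r, mulr0, add0r, mulr1, mul1r, g2, g4).
rewrite scale0r add0r; congr (inD (_ *: xg _)); first ring.
by rewrite addrC subrK.
Qed.

(** Only weight vectors of the derived algebra serve as test elements, since
    these have counterparts under a correspondence. *)
Definition lfinw u := forall l m v, inD v -> wspace l m v -> lfin u v.

(** The iterates of [lie u] at [v] run through distinct monomials, hence are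
    linearly independent. *)
Lemma chain_not_lfin u v (beta : nat -> 'rV[F]_4) (c : nat -> F) :
  (forall k, beta k \in Gamma) -> injective beta -> (forall k, c k != 0) ->
  (forall k, iter k (lie u) v = c k *: xg (beta k)) -> lfin u v -> False.
Proof.
move=> bG binj c0 E [P [P0 uv]].
have T a v' w' : xcoeff (beta (size P).-1) 0 (a *: v' + w') *: (1 : A) =
    a *: (xcoeff (beta (size P).-1) 0 v' *: 1) + xcoeff (beta (size P).-1) 0 w' *: 1.
  by rewrite linearP scalerDl scalerA.
have := ad_poly_top T P0 uv; rewrite /= => H.
have {H} := H _; rewrite E linearZ /= xcoeff_mon ?jset0 // !eqxx mulr1.
move=> /(_ _)/eqP; rewrite scaler_eq0 (negPf (c0 _)) oner_eq0 => H.
apply: notF; apply: H => k kK; rewrite E linearZ /= xcoeff_mon ?jset0 //.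
by rewrite (inj_eq binj) gtn_eqF // mulr0 scale0r.
Qed.

Lemma wspace00_xg alpha : alpha 0 p2 = 0 -> alpha 0 p4 = 0 -> wspace 0 0 (xg alpha).
Proof. by move=> a2 a4; have := @wspace_xg F Gamma J alpha; rewrite a2 a4. Qed.

Lemma iter_chain u (beta : nat -> 'rV[F]_4) (e : nat -> F) :
  (forall k, [lie u, xg (beta k)] = e k *: xg (beta k.+1)) -> 
  forall k, iter k (lie u) (xg (beta 0%N)) = (\prod_(j < k) e j) *: xg (beta k).
Proof.
move=> E; elim=> [|k IH]; first by rewrite big_ord0 scale1r.
by rewrite iterS IH lieZr E scalerA big_ord_recr.
Qed.

(** An annihilating polynomial splits into linear factors over [F], and in a
    domain one of the factors [f - r] vanishes. *)
Lemma lfin_constant u (f : A) alpha : alpha \in Gamma ->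
  (forall k, iter k (lie u) (xg alpha) = f ^+ k * xg alpha) -> lfin u (xg alpha) ->
  exists r : F, f = r%:A.
Proof.
move=> aG E [P [P0 uv]].
have [rs PE] := closed_field_poly_normal P.
have fP : (map_poly (in_alg A) P).[f] = 0.
  rewrite horner_coef size_map_inj_poly; last 2 first.
  - exact: fmorph_inj.
  - by rewrite rmorph0.
  have : (\sum_(i < size P) (map_poly (in_alg A) P)`_i * f ^+ i) * xg alpha = 0.
    rewrite -[RHS]uv /ad_poly mulr_suml; apply: eq_bigr => i _.
    by rewrite E coef_map /= mulr_algl scalerAl.
  by move=> /(xu_mul_eq0 char0)[//|/eqP]; rewrite (negPf (xg_neq0 J aG)).
move: fP; rewrite PE map_polyZ rmorph_prod hornerZ /= => /(xu_mul_eq0 char0)[/eqP|].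
  by rewrite scaler_eq0 lead_coef_eq0 (negPf P0) oner_eq0.
elim: rs {PE} => [|r rs IH].
  by rewrite big_nil hornerC => /eqP; rewrite oner_eq0.
rewrite big_cons hornerM => /(xu_mul_eq0 char0)[|//].
rewrite rmorphB /= map_polyX map_polyC /= hornerD hornerN hornerX hornerC.
by move/eqP; rewrite subr_eq0 => /eqP->; exists r.
Qed.

(** The difference satisfies the equations of [ker_inZ]. *)
Lemma span_of_gradient u s t : wspace 0 0 u -> d p1 u = s *: xg (- sig) -> u + d p3 u = t%:A ->
  inZ (u + s *: xg (- sig) - t%:A).
Proof.
move=> [u2 u4] u1 u3.
have X p : d p (xg (- sig)) = - (sig 0 p) *: xg (- sig) by rewrite xu_dE0 mxE.
apply: (ker_inZ char0); rewrite !(xu_dD, xu_dN, xu_dZ, X, d1) scaler0 subr0.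
- by rewrite u1 sigmaE scaleN1r scalerN subrr.
- by rewrite u2 sigmaE scale0r oppr0 scale0r scaler0 addr0.
- rewrite sigmaE scaleN1r scalerN.
  transitivity (u + d p3 u - t%:A); first by xu_ring Gamma J.
  by rewrite u3 subrr.
- by rewrite u4 sigmaE scale0r oppr0 scale0r scaler0 addr0.
Qed.

Lemma iter_lie_wspace l m f v : wspace 0 0 f -> wspace l m v ->
  forall k, iter k (lie f) v = (l *: (xg sig * d p1 f) + m *: (f + d p3 f)) ^+ k * v.
Proof.
move=> f0 vW; set g := (_ + _).
have g0 : wspace 0 0 g.
  have f0' p : wspace 0 0 (d p f) by apply: wspace_d.
  apply: wspaceP; last by apply: wspaceZ; apply: wspaceD.
  by have := wspaceM (@wspace00_xg sig _ _) (f0' p1); rewrite !addr0 !sigmaE; apply.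
have W k : wspace l m (g ^+ k * v).
  elim: k => [|k IH]; first by rewrite expr0 mul1r.
  by rewrite exprS -mulrA; have := wspaceM g0 IH; rewrite !add0r.
elim=> [|k IH]; first by rewrite expr0 mul1r.
by rewrite iterS IH (lie_wspace0 f0 (W k)) exprS mulrA.
Qed.

Lemma wspace_single n p : wspace (if p == p2 then n else 0) (if p == p4 then n else 0) (xg (single n p)).
Proof. by have := @wspace_xg F Gamma J (single n p); rewrite !singleE ![_ == p]eq_sym. Qed.

Lemma inD_single2 n : n != 0 -> inD (xg (single n p2)).
Proof.
by move=> n0; apply: (wspace_inD sigG _ (wspace_single n p2)) => -[] /eqP; rewrite (negPf n0).
Qed.

Lemma inD_single4 n : n != 0 -> inD (xg (single n p4)).
Proof.
by move=> n0; apply: (wspace_inD sigG _ (wspace_single n p4)) => -[] /eqP; rewrite (negPf n0).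
Qed.

Lemma mulrn_inj_rV (gamma : 'rV[F]_4) : gamma != 0 -> injective (fun k => gamma *+ k).
Proof.
move=> g0 k l /eqP; rewrite -subr_eq0.
wlog lk : k l / (l <= k)%N => [H E|].
  case: (leqP l k) => [/H|/ltnW/H]; first exact.
  by rewrite -oppr_eq0 opprB => /(_ E)->.
rewrite -mulrnBr // => E; case kl: (k - l)%N E => [|e]; first by lia.
by move/eqP/(rV_torsion_free char0)/eqP; rewrite (negPf g0).
Qed.

Lemma sigma1_neq0 : sig1 != 0.
Proof. by apply/eqP=> /rowP/(_ p3); rewrite sigma1E mxE => /eqP; rewrite oppr_eq0 oner_eq0. Qed.

(** If [d p2 u] or [d p4 u] were a nonzero multiple of the central monomial,
    [lie u] would push a suitable monomial along an infinite chain. So [u]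
    has weight [0] and multiplies the monomials [n_[2]] and [m_[4]]; by
    [lfin_constant] the multipliers are constants, which determines the
    gradient of [u]. *)
Lemma lfin_central_ends u : inZ (d p2 u) -> inZ (d p4 u) -> lfinw u ->
  exists s t : F, inZ (u - s *: xg (- sig) - t%:A).
Proof.
move=> [c2 u2] [c4 u4] lf.
have {u2} u2 : d p2 u = 0.
  apply/eqP; rewrite u2; apply/negP => /negP; rewrite scaler_eq0 negb_or => /andP[c20 z0].
  have sG : sig1 \in Gamma by apply: contraNT z0 => sG; rewrite xmon_outl.
  pose beta k := sig + sig1 *+ 2 + (sig + sig1) *+ k.
  have bG k : beta k \in Gamma by rewrite !(rpredD, rpredMn).
  have bE k : (beta k 0 p1 = k.+1%:R) * (beta k 0 p2 = 0) * (beta k 0 p3 = - 1) * (beta k 0 p4 = 0).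
    rewrite /beta !coordE !(addr0, mul0rn) subrr mul0rn addr0 -mulrS.
    by have -> : 1 + (- 1) *+ 2 = - 1 :> F by rewrite mulr2n; ring.
  have chain k : [lie u, xg (beta k)] = (- c2 * k.+1%:R) *: xg (beta k.+1).
    rewrite bracketE u2 u4 !xu_dE0 !bE !scale0r scaleN1r subrr.
    have -> : beta k.+1 = sig + sig1 + beta k by rewrite /beta [_ *+ k.+1]mulrS addrCA.
    rewrite -(xgM J (rpredD sigG sG) (bG k)) -(xgM J sigG sG); xu_ring Gamma J.
  apply: (chain_not_lfin (beta := beta) (c := fun k => \prod_(j < k) (- c2 * j.+1%:R)) bG _ _ (iter_chain chain)).
  - move=> k l /addrI; apply: mulrn_inj_rV.
    by apply/eqP=> /rowP/(_ p1); rewrite !coordE rv0 addr0 => /eqP; rewrite oner_eq0.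
  - by move=> k; apply/prodf_neq0 => i _; rewrite mulf_neq0 ?oppr_eq0 ?nat0.
  - apply: (lf 0 0); last by apply: wspace00_xg; rewrite !bE.
    apply: inD_xg; rewrite ?bE //; right; rewrite eqr_opp eq_sym -subr_eq0 -[X in _ - X]/1%:R.
    by rewrite -natrB // nat0.
have {u4} u4 : d p4 u = 0.
  apply/eqP; rewrite u4; apply/negP => /negP; rewrite scaler_eq0 negb_or => /andP[c40 z0].
  have sG : sig1 \in Gamma by apply: contraNT z0 => sG; rewrite xmon_outl.
  pose beta k := sig1 *+ k.+2.
  have bG k : beta k \in Gamma by rewrite rpredMn.
  have bE k : (beta k 0 p1 = 0) * (beta k 0 p2 = 0) * (beta k 0 p3 = - k.+2%:R) * (beta k 0 p4 = 0).
    by rewrite /beta !coordE !mul0rn mulNrn.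
  have chain k : [lie u, xg (beta k)] = (c4 * k.+1%:R) *: xg (beta k.+1).
    rewrite bracketE u2 u4 !xu_dE0 !bE !scale0r.
    have -> : beta k.+1 = sig1 + beta k by rewrite /beta -mulrS.
    have -> : k.+2%:R = k.+1%:R + 1 :> F by rewrite -natr1.
    rewrite -(xgM J sG (bG k)); xu_ring Gamma J.
  apply: (chain_not_lfin (beta := beta) (c := fun k => \prod_(j < k) (c4 * j.+1%:R)) bG _ _ (iter_chain chain)).
  - by move=> k l /(mulrn_inj_rV sigma1_neq0)[].
  - by move=> k; apply/prodf_neq0 => i _; rewrite mulf_neq0 ?nat0.
  - apply: (lf 0 0); last by apply: wspace00_xg; rewrite !bE.
    by apply: inD_xg; rewrite ?bE //; left; rewrite eq_sym oner_eq0.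
have u0 : wspace 0 0 u by split; rewrite scale0r.
have [n n0 nG] := axis_exists p2; have [m m0 mG] := axis_exists p4.
have := wspace_single n p2; rewrite eqxx [p2 == p4]/= => nW.
have := wspace_single m p4; rewrite eqxx [p4 == p2]/= => mW.
have [s sE] := lfin_constant nG (iter_lie_wspace u0 nW) (lf _ _ _ (inD_single2 n0) nW).
have [t tE] := lfin_constant mG (iter_lie_wspace u0 mW) (lf _ _ _ (inD_single4 m0) mW).
rewrite scale0r addr0 in sE; rewrite scale0r add0r in tE.
have u1 : d p1 u = (n^-1 * s) *: xg (- sig).
  apply: (xu_mulI char0 (xg_neq0 J sigG)); apply: (scalerI n0); rewrite sE -scalerAr xgV //.
  by rewrite scalerA mulrA divff // mul1r.
have u3 : u + d p3 u = (m^-1 * t)%:A.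
  by apply: (scalerI m0); rewrite tE scalerA mulrA divff // mul1r.
exists (- (n^-1 * s)), (m^-1 * t); rewrite scaleNr opprK; exact: span_of_gradient.
Qed.

(** The combination of [X] and [1] given by [lfin_central_ends] acts on the
    monomials [n_[2]] and [m_[4]] by scalars, which are nilpotent only if
    they vanish. *)
Lemma nilp_central_ends u : inZ (d p2 u) -> inZ (d p4 u) ->
  (forall l m v, inD v -> wspace l m v -> ad_nilp u v) -> inZ u.
Proof.
move=> u2 u4 hnil.
have [|s [t [c E]]] := lfin_central_ends u2 u4; first by move=> l m v vD vW; apply/ad_nilp_lfin; apply: hnil vW.
have lu v : [lie u, v] = - s *: d p2 v + t *: d p4 v.
  have -> : u = s *: xg (- sig) + t *: 1 + c *: xg sig1.
    by rewrite -E; xu_ring Gamma J.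
  rewrite !lieDl !lieZl lie_X // lie_1 lie_Zl; last by exists 1; rewrite scale1r.
  by rewrite scaler0 addr0 scalerN scaleNr.
have eig x v : [lie u, v] = x *: v -> ad_nilp u v -> v != 0 -> x = 0.
  move=> xv [k uv] v0; have E' : iter k (lie u) v = x ^+ k *: v.
    by elim: k {uv} => [|k IH]; rewrite ?scale1r // iterS IH lieZr xv scalerA exprSr.
  apply/eqP; move/eqP: uv; rewrite E' scaler_eq0 (negPf v0) orbF expf_eq0.
  by case/andP.
have [n n0 nG] := axis_exists p2; have [m m0 mG] := axis_exists p4.
have := wspace_single n p2; rewrite eqxx [p2 == p4]/= => -[n2 n4].
have := wspace_single m p4; rewrite eqxx [p4 == p2]/= => -[m2 m4].
have s0 : s = 0.
  have := eig (- s * n) (xg (single n p2)) _ (hnil _ _ _ (inD_single2 n0) (conj n2 n4)) (xg_neq0 J nG).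
  rewrite lu n2 n4 scale0r scaler0 addr0 scalerA => /(_ erefl)/eqP.
  by rewrite mulf_eq0 (negPf n0) orbF oppr_eq0 => /eqP.
have t0 : t = 0.
  have := eig (t * m) (xg (single m p4)) _ (hnil _ _ _ (inD_single4 m0) (conj m2 m4)) (xg_neq0 J mG).
  rewrite lu m2 m4 scale0r scaler0 add0r scalerA => /(_ erefl)/eqP.
  by rewrite mulf_eq0 (negPf m0) orbF => /eqP.
by exists c; rewrite -E s0 t0 !scale0r !subr0.
Qed.

End LocallyFinite.

Section LocallyFinite2.
Context (F : closedFieldType) (char0 : [pchar F] =i pred0).
Context (Gamma : zmodClosed 'rV[F]_4) (J : jtype).
Local Notation A := (xu_A4 Gamma J).
Local Notation xmon := (xmon Gamma J).
Local Notation xg alpha := (xmon alpha 0).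
Local Notation d := (@xu_d F Gamma J).
Local Notation sig := (sigma F).
Local Notation inD u := (lie_pi (sigma1_ideal Gamma J) u \in @derived_pred F (xu_B4 Gamma J)).
Local Notation inZ := (@inZ F Gamma J).
Local Notation wspace := (@wspace F Gamma J).
Local Notation wsupp := (@wsupp F Gamma J).
Implicit Types (u v w : A) (alpha beta : 'rV[F]_4) (i j : 'rV[nat]_4) (p q : 'I_4) (P : {poly F}).
Hypothesis GammaA : conditionA Gamma.

Let sigG : sig \in Gamma. Proof. by case: GammaA. Qed.
Let nat0 n : (n%:R == 0 :> F) = (n == 0%N) := natf_eq0_char0 char0 n.

Lemma iter_shifted_d_dZ p n u : p = p2 \/ p = p4 -> inZ u -> inZ (iter n (shifted_d p 0) u).
Proof.
move=> pE uZ; elim: n => //= n IH; rewrite /shifted_d d_Z // scale0r subr0.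
exact: inZ0.
Qed.

Lemma iter_inZ_comm p q n u : p = p2 \/ p = p4 -> inZ (d q u) -> inZ (d q (iter n (shifted_d p 0) u)).
Proof.
move=> pE uZ; suff -> : d q (iter n (shifted_d p 0) u) = iter n (shifted_d p 0) (d q u) by apply: iter_shifted_d_dZ.
by elim: n => //= n IH; rewrite -IH /shifted_d !scale0r !subr0 xu_dC.
Qed.

Lemma shifted_d00 p u : shifted_d p 0 u = d p u.
Proof. by rewrite /shifted_d scale0r subr0. Qed.

(** Differentiating in the directions [p] and [q] as often as possible without
    reaching the centre turns a locally finite element of weight [0] into a
    locally nilpotent one, which is impossible. *)
Lemma lfin_d_central p q u : (p = p2 /\ q = p4) \/ (p = p4 /\ q = p2) ->
  wsupp (fun x => x = 0) u -> lfinw u -> inZ (d p u).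
Proof.
move=> pq uS lf.
have pE : p = p2 \/ p = p4 by case: pq => -[-> _]; [left|right].
have qE : q = p2 \/ q = p4 by case: pq => -[_ ->]; [right|left].
have wtE r : (if r == p2 then (0 : (F * F)%type).1 else (0 : (F * F)%type).2) = 0 by case: ifP.
apply: contrapT => nZ.
have [n0 un0] : exists n, inZ (iter n (shifted_d p 0) (d p u)).
  have [n] := shifted_d_nil pE (wsupp_d (p := p) uS); rewrite wtE => E.
  by exists n; rewrite E; apply: inZ0.
have [n [nZn Zn]] := last_iter nZ un0.
set w := iter n (shifted_d p 0) (d p u) in nZn.
have wE : w = iter n.+1 (shifted_d p 0) u by rewrite iterSr shifted_d00.
have wS : wsupp (fun x => x = 0) w.
  rewrite wE; elim: (n.+1) => //= k IH; rewrite shifted_d00; exact: wsupp_d.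
have wnil l m v : inD v -> wspace l m v -> ad_nilp w v.
  move=> vD vW; rewrite wE; have [v2 v4] := vW.
  apply: (leibniz_lfin char0 (m := if p == p2 then l else m) pE (ltn0Sn n)).
  - by move=> x; apply: lie_Zl; rewrite iterSr shifted_d00.
  - by rewrite /shifted_d; case: pE => ->; rewrite ?v2 ?v4 subrr.
  - exact: lf vW.
have [m0 wm0] : exists n, inZ (iter n (shifted_d q 0) w).
  have [m] := shifted_d_nil qE wS; rewrite wtE => E.
  by exists m; rewrite E; apply: inZ0.
have [m [nZm Zm]] := last_iter nZn wm0.
apply: nZm; have dp : inZ (d p (iter m (shifted_d q 0) w)).
  by apply: iter_inZ_comm => //; move: Zn; rewrite /= shifted_d00.
have dq : inZ (d q (iter m (shifted_d q 0) w)) by move: Zm; rewrite /= shifted_d00.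
have wnil' l k v : inD v -> wspace l k v -> ad_nilp (iter m (shifted_d q 0) w) v.
  move=> vD vW; have [v2 v4] := vW.
  apply: (leibniz_nil char0 (m := if q == p2 then l else k) qE _ _ (wnil _ _ _ vD vW)).
  - by move=> x; apply: lie_Zl.
  - by rewrite /shifted_d; case: qE => ->; rewrite ?v2 ?v4 subrr.
by case: pq => -[pp qq]; subst p q; apply: (nilp_central_ends char0 GammaA).
Qed.

(** For [w] of weight [(l, m)] the multiples of powers of [w] by weight [0]
    factors are stable under [lie w], with an explicit recursion on the
    factor. *)
Lemma lie_expr l m w g k : wspace l m w -> wspace 0 0 g ->
  [lie w, w ^+ k * g] = w ^+ k.+1 *
    - (l *: (xg sig * d p1 g) + m *: ((1 - k%:R) *: g + d p3 g)).
Proof.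
move=> [w2 w4] [g2 g4].
have dX p : w * d p (w ^+ k) = k%:R *: (w ^+ k * d p w).
  elim: k => [|k IH]; first by rewrite expr0 d1 mulr0 scale0r.
  rewrite exprS xu_dM mulrDr [w * (w * _)]mulrCA IH -addn1 natrD.
  xu_ring Gamma J.
have dXe p l' : d p w = l' *: w -> d p (w ^+ k) = (k%:R * l') *: w ^+ k.
  move=> wl; elim: k {dX} => [|k IH]; first by rewrite expr0 d1 mul0r scale0r.
  rewrite exprS xu_dM IH wl -addn1 natrD; xu_ring Gamma J.
rewrite bracketE !xu_dM (dXe p2 l) // (dXe p4 m) // w2 w4 g2 g4 !scale0r !mulr0 !addr0.
transitivity (xg sig * (k%:R *: (w ^+ k * d p1 w) * (l *: g) - (w * d p1 (w ^+ k)) * (l *: g) - l *: (w * w ^+ k * d p1 g))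
  + k%:R *: (w ^+ k * w) * (m *: g) + k%:R *: (w ^+ k * d p3 w) * (m *: g)
  - (w * d p3 (w ^+ k)) * (m *: g) - m *: (w * w ^+ k * (g + d p3 g))).
  xu_ring Gamma J.
rewrite !dX exprS; xu_ring Gamma J.
Qed.

(** Take [v] of the form [sigma] if [m] vanishes and [b_[3]] otherwise: the
    recursion of [lie_expr] then multiplies a monomial by a nonzero scalar at
    each step. *)
Lemma not_nilp_weight l m w : (l, m) <> (0, 0) -> wspace l m w -> w != 0 ->
  exists2 v, inD v /\ wspace 0 0 v & ~ ad_nilp w v.
Proof.
move=> lm0 wW w0.
have main (beta : nat -> 'rV[F]_4) (e : nat -> F) :
    (forall k, beta k \in Gamma) -> (forall k, beta k 0 p2 = 0 /\ beta k 0 p4 = 0) ->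
    (forall k, e k != 0) ->
    (forall k, - (l *: (xg sig * d p1 (xg (beta k))) + m *: ((1 - k%:R) *: xg (beta k) + d p3 (xg (beta k))))
      = e k *: xg (beta k.+1)) -> ~ ad_nilp w (xg (beta 0%N)).
  move=> bG b24 e0 E [k]; have -> : iter k (lie w) (xg (beta 0%N)) = (\prod_(j < k) e j) *: (w ^+ k * xg (beta k)).
    elim: k => [|k IH]; first by rewrite big_ord0 scale1r expr0 mul1r.
    rewrite iterS IH lieZr (lie_expr _ wW) ?E; last by apply: wspace00_xg; case: (b24 k).
    by rewrite -scalerAr scalerA big_ord_recr.
  move/eqP; rewrite scaler_eq0 => /orP[|]; first by apply/negP/prodf_neq0 => i _; apply: e0.
  by apply/negP; apply: xu_mul_neq0 => //; [apply: xu_expr_neq0|apply: xg_neq0].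
have [m0|m0] := eqVneq m 0.
  have l0 : l != 0 by apply/eqP => l0; rewrite l0 m0 in lm0.
  pose beta k := sig *+ k.+1.
  have bG k : beta k \in Gamma by rewrite rpredMn.
  have bE k : (beta k 0 p1 = k.+1%:R) * (beta k 0 p2 = 0) * (beta k 0 p3 = k.+1%:R) * (beta k 0 p4 = 0).
    by rewrite /beta !coordE !mul0rn.
  exists (xg (beta 0%N)).
    split; last by apply: wspace00_xg; rewrite !bE.
    apply: (inD_xg J GammaA); rewrite ?bE //; right.
    by rewrite -addr_eq0 -natrD nat0.
  apply: (main beta (fun k => - l * k.+1%:R)) => // k; first by rewrite !bE.
    by rewrite mulf_neq0 ?oppr_eq0 ?nat0.
  have -> : beta k.+1 = sig + beta k by rewrite /beta -mulrS.
  rewrite m0 scale0r addr0 xu_dE0 bE.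
  by rewrite -(xgM J sigG (bG k)); xu_ring Gamma J.
(* The scalars that occur are [1 - k + b]: a bad [b] is replaced by [2 b] or
   [- 2 b]. *)
have [b bG bP] : exists2 b : F, single b p3 \in Gamma & forall k, 1 - k%:R + b != 0.
  have [b b0 bG] := axis_exists GammaA p3.
  have sM n : single (b *+ n) p3 = single b p3 *+ n.
    by apply/rowP=> q; rewrite mulmxnE !mxE; case: ifP; rewrite ?mul0rn.
  have [[k kb]|no] := pselect (exists k, 1 - k%:R + b = 0); last first.
    by exists b => // k; apply/eqP=> kb; apply: no; exists k.
  case: k kb => [|[|k]] kb.
  - exists (b *+ 2); first by rewrite sM rpredMn.
    move=> k; have -> : 1 - k%:R + b *+ 2 = - (k.+1%:R).
      have -> : b = - 1 by apply/eqP; rewrite -addr_eq0 addrC -kb subr0.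
      by rewrite mulr2n -addn1 natrD; ring.
    by rewrite oppr_eq0 nat0.
  - by rewrite subrr add0r in kb; rewrite kb eqxx in b0.
  - exists (- (b *+ 2)).
      have -> : single (- (b *+ 2)) p3 = - single (b *+ 2) p3.
        by apply/rowP=> q; rewrite !mxE; case: ifP; rewrite ?oppr0.
      by rewrite rpredN sM rpredMn.
    move=> j; have -> : 1 - j%:R - b *+ 2 = - (k + k + j).+1%:R.
      have -> : b = k.+1%:R by apply/eqP; rewrite -subr_eq0 -kb -!natr1; apply/eqP; ring.
      by rewrite mulr2n -!natr1 !natrD; ring.
    by rewrite oppr_eq0 nat0.
pose beta (k : nat) := single b p3.
have bE k : (beta k 0 p1 = 0) * (beta k 0 p2 = 0) * (beta k 0 p3 = b) * (beta k 0 p4 = 0).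
  by rewrite /beta !singleE.
exists (xg (beta 0%N)).
  split; last by apply: wspace00_xg; rewrite !bE.
  by apply: (inD_xg J GammaA); rewrite ?bE //; left; rewrite eq_sym oner_eq0.
apply: (main beta (fun k => - m * (1 - k%:R + b))) => // k; first by rewrite !bE.
  by rewrite mulf_neq0 ?oppr_eq0.
by rewrite !xu_dE0 !bE scale0r mulr0 scaler0 add0r; xu_ring Gamma J.
Qed.

(** For the order with positive cone [C], the component of the largest
    possible weight of [ad_poly P (u1 + u2) v] comes from the leading
    coefficient of [P] and from [u1] alone. *)
Lemma ad_nilp_top (x : F * F) (C : F * F -> Prop) u1 u2 v :
    (forall x y, C x -> C y -> C (x + y)) -> ~ C 0 -> C x ->
    wsupp (fun y => y = x) u1 -> wsupp (fun y => C (x - y)) u2 -> wsupp (fun y => y = 0) v ->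
  lfin (u1 + u2) v -> ad_nilp u1 v.
Proof.
move=> CD C0 Cx S1 S2 Sv [P [P0 uv]].
have CM n : C (x *+ n.+1) by elim: n => [//|n IH]; rewrite mulrS; apply: CD.
have top k : wsupp (fun y => y = x *+ k) (iter k (lie u1) v).
  elim: k => [//|k IH]; apply: wsupp_lie S1 IH => y z -> ->.
  by rewrite mulrS.
have low k : wsupp (fun y => C (x *+ k - y)) (iter k (lie (u1 + u2)) v - iter k (lie u1) v).
  elim: k => [|k IH]; first by rewrite subrr; apply: supp_in0.
  set r := (X in wsupp _ X) in IH.
  have -> : iter k.+1 (lie (u1 + u2)) v - iter k.+1 (lie u1) v
      = [lie u1 + u2, r] + [lie u2, iter k (lie u1) v].
    rewrite /r lieBr !iterS [in RHS](lieDl u1 u2 (iter k (lie u1) v)).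
    move: [lie u1 + u2, _] [lie u1, _] [lie u2, _] => X a b.
    by rewrite opprD addrA subrK.
  apply: supp_inD.
    have S12 : wsupp (fun y => y = x \/ C (x - y)) (u1 + u2).
      by apply: supp_inD; [apply: supp_inS S1 => k0 ->; left|apply: supp_inS S2 => k0; right].
    apply: (wsupp_lie (Q'' := fun y => C (x *+ k.+1 - y)) _ S12 IH) => y z [->|yC] zC; rewrite mulrS opprD addrACA; last exact: CD.
    by rewrite subrr add0r.
  apply: (wsupp_lie (Q'' := fun y => C (x *+ k.+1 - y)) _ S2 (top k)) => y z yC ->.
  by rewrite mulrS opprD addrACA subrr addr0.
(* [T] projects to the largest possible weight. *)
pose T (w : A) := @sgpart F _ (fun k => wt2 k == x *+ (size P).-1) w.
have T0 w : wsupp (fun y => y <> x *+ (size P).-1) w -> T w = 0.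
  move=> S; apply/sgalgP=> l; rewrite sgpartE linear0.
  by case: ifP => // /eqP E; apply/eqP/negP=> /negP/S.
exists (size P).-1.
have TE : T (iter (size P).-1 (lie u1) v) = iter (size P).-1 (lie u1) v.
  apply/sgalgP=> l; rewrite sgpartE; case: ifP => // /eqP ne.
  by apply/esym/eqP/negP=> /negP/top.
rewrite -TE.
have TP a (w w' : A) : T (a *: w + w') = a *: T w + T w'.
  exact: sgext_is_linear.
have Tlow k w : (k <= (size P).-1)%N -> wsupp (fun y => C (x *+ k - y)) w -> T w = 0.
  move=> kK S; apply: T0; apply: supp_inS S => l + E.
  rewrite E; move: kK; rewrite leq_eqVlt => /orP[/eqP->|kK]; first by rewrite subrr.
  case e: ((size P).-1 - k)%N => [|n]; first by lia.
  move=> Cn; apply: C0; have := CD _ _ Cn (CM n).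
  by rewrite -e mulrnBr 1?ltnW // addrC addrA subrK subrr.
have := ad_poly_top TP P0 uv; rewrite -[X in T X = 0](subrK (iter (size P).-1 (lie u1) v)).
rewrite -[_ - _]scale1r TP (Tlow _ _ (leqnn _) (low _)) scaler0 add0r; apply => k kK.
rewrite -[iter _ _ _](subrK (iter k (lie u1) v)) -[_ - _]scale1r TP (Tlow _ _ (ltnW kK) (low _)).
rewrite scaler0 add0r; apply: T0; apply: supp_inS (top k) => l -> E.
case e: ((size P).-1 - k)%N => [|n]; first by lia.
by apply: C0; have := CM n; rewrite -e mulrnBr 1?ltnW // -E subrr.
Qed.

(** Otherwise [C] can be chosen so that a weight of [u] is positive. The top
    component of [u] is then locally nilpotent, and so are its highest
    shifted derivatives along the torus, which are vectors of a nonzero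
    weight; this contradicts [not_nilp_weight]. *)
Lemma lfin_weight0 u : lfinw u -> wsupp (fun x => x = 0) u.
Proof.
move=> lf k0 k0u; apply: contrapT => wk0.
have F2_tf (x : F * F) n : x *+ n.+1 = 0 -> x = 0.
  have E m : x *+ m = (x.1 *+ m, x.2 *+ m).
    by elim: m => [|m IH]; rewrite ?mulr0n // !mulrS IH.
  have tf (y : F) : y *+ n.+1 = 0 -> y = 0.
    by move=> /eqP; rewrite -mulr_natr mulf_eq0 nat0 orbF => /eqP.
  by rewrite E => -[/tf E1 /tf E2]; case: x E1 E2 {E} => a b /= -> ->.
have [C [CD C0 Ctot Ck0]] : exists C : F * F -> Prop,
    [/\ forall x y, C x -> C y -> C (x + y), ~ C 0, forall x, x <> 0 -> C x \/ C (- x) & C (wt2 k0)].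
  have [C [CD C0 Ctot]] := total_cone_exists F2_tf.
  have [Ck|Ck] := Ctot _ wk0; first by exists C.
  exists (fun x => C (- x)); split=> // [x y||x]; first by rewrite opprD; apply: CD.
    by rewrite oppr0.
  by move=> /Ctot; rewrite opprK or_comm.
have u0 : u != 0 by apply: contraNneq k0u => ->; rewrite linear0.
have [k [u1 [u2 [uE u1k S1 S2 _]]]] := top_part (@wt2 F Gamma J) CD Ctot u0.
have Ck : C (wt2 k).
  case: (eqVneq (sgcoeff k0 u1) 0) => [E|/S1<-//].
  have : sgcoeff k0 u2 != 0 by move: k0u; rewrite uE linearD /= E add0r.
  by move/S2 => C2; have := CD _ _ Ck0 C2; rewrite addrC subrK.
have u10 : u1 != 0 by apply: contraNneq u1k => ->; rewrite linear0.
have nil1 v : inD v -> wspace 0 0 v -> ad_nilp u1 v.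
  move=> vD vW; apply: (ad_nilp_top CD C0 Ck S1 S2) => [[[al aG] [i iJ]] vk|].
    have [v2 v4] := vW; have c0 : xcoeff al i v != 0 by rewrite xcoeffE.
    by rewrite /wt2 /= (eig_supp char0 v2 c0).1 (eig_supp char0 v4 c0).1.
  by rewrite -uE; apply: lf vW.
move: (wt2 k) S1 S2 Ck => x S1 S2 Ck.
have nZ : ~ (u1 = 0) by apply/eqP.
have p2E : p2 = p2 \/ p2 = p4 by left.
have p4E : p4 = p2 \/ p4 = p4 by right.
(* Highest nonzero shifted derivatives in both directions of the torus. *)
have [n0 n0P] := shifted_d_nil p2E S1; rewrite /= in n0P.
have [n [nZn Zn]] := @last_iter _ (fun w => w = 0) _ _ _ nZ n0P.
have [m0 m0P] := shifted_d_nil p4E S1; rewrite /= in m0P.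
set w := iter n _ u1 in nZn.
have m0P' : iter m0 (shifted_d p4 x.2) w = 0 by rewrite iter_shifted_d_comm m0P iter_shifted_d0.
have [m [nZm Zm]] := @last_iter _ (fun w => w = 0) _ _ _ nZn m0P'.
set w' := iter m _ w in nZm.
have W' : wspace x.1 x.2 w'.
  split; apply/eqP; rewrite -subr_eq0; apply/eqP; last exact: Zm.
  have E1 : shifted_d p2 x.1 w' = iter m (shifted_d p4 x.2) (shifted_d p2 x.1 w) := iter_shifted_d_comm p2 x.1 p4 x.2 1 m w.
  have E2 : shifted_d p2 x.1 w = 0 := Zn.
  by have := E1; rewrite E2 iter_shifted_d0.
have [|v [vD vW] nv] := not_nilp_weight _ W' (introN eqP nZm).
  move=> E; apply: C0; suff <- : x = 0 by [].
  by rewrite [x]surjective_pairing E.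
apply: nv; have [v2 v4] := vW.
apply: (leibniz_nil char0 (m := 0) p4E) => [y||]; first by rewrite Zm lie0l.
  by rewrite /shifted_d v4 subrr.
apply: (leibniz_nil char0 (m := 0) p2E) => [y||]; first by rewrite Zn lie0l.
  by rewrite /shifted_d v2 subrr.
exact: nil1.
Qed.

(** The weight is [0] by [lfin_weight0], and then both derivatives along the
    torus are central by [lfin_d_central]. *)
Lemma lfin_span u : lfinw u -> exists s t : F, inZ (u - s *: xg (- sig) - t%:A).
Proof.
move=> lf; have uS := lfin_weight0 lf.
apply: (lfin_central_ends char0 GammaA) => //.
  by apply: (@lfin_d_central p2 p4) => //; left.
by apply: (@lfin_d_central p4 p2) => //; right.
Qed.
End LocallyFinite2.

(** * Cyclic weight vectors are monomials *)

Section Cyclic.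
Context (F : closedFieldType) (char0 : [pchar F] =i pred0).
Context (Gamma : zmodClosed 'rV[F]_4) (J : jtype).
Local Notation A := (xu_A4 Gamma J).
Local Notation xmon := (xmon Gamma J).
Local Notation xg alpha := (xmon alpha 0).
Local Notation d := (@xu_d F Gamma J).
Local Notation sig := (sigma F).
Local Notation wspace := (@wspace F Gamma J).
Implicit Types (u v w g : A) (alpha beta : 'rV[F]_4) (i j : 'rV[nat]_4) (p q : 'I_4) (P : {poly F}).
Hypothesis GammaA : conditionA Gamma.

Let sigG : sig \in Gamma. Proof. by case: GammaA. Qed.
Let nat0 n : (n%:R == 0 :> F) = (n == 0%N) := natf_eq0_char0 char0 n.

Let two : 2%:R = 1 + 1 :> F. Proof. exact: (natrD _ 1 1). Qed.
Let three : 3%:R = 1 + (1 + 1) :> F. Proof. by rewrite -two -(natrD _ 1 2). Qed.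

(** Brackets of vectors of opposite nonzero weights act on weight spaces by
    multiplications ([lie_wspace0]). They are the multiplications that can be
    expressed inside the derived algebra, and so are transported by
    isomorphisms. *)
Definition stable (S : A -> Prop) :=
  (forall a u v, S u -> S v -> S (a *: u + v)) /\
  (forall l m (p q s : A), (l, m) <> (0, 0) -> wspace l m p -> wspace (- l) (- m) q ->
     S s -> S [lie [lie p, q], s]).

Definition cyclic l m u := forall S, stable S -> S u -> forall w, wspace l m w -> S w.

(** The multiplication by which [f] acts on vectors of weight [(l, m)], see
    [lie_wspace0]. *)
Definition wmult l m (f : A) : A := l *: (xg sig * d p1 f) + m *: (f + d p3 f).

Lemma wspace_mult l m f : wspace 0 0 f -> wspace 0 0 (wmult l m f).
Proof.
move=> f0; have f0' p : wspace 0 0 (d p f) by apply: wspace_d.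
apply: wspaceP; last by apply: wspaceZ; apply: wspaceD.
by have := wspaceM (@wspace00_xg _ Gamma J sig _ _) (f0' p1); rewrite !addr0 !sigmaE; apply.
Qed.

Lemma wspace1 : wspace 0 0 1.
Proof. by split; rewrite d1 scale0r. Qed.

Lemma wspace_opp_lie l m u v : wspace l m u -> wspace (- l) (- m) v -> wspace 0 0 [lie u, v].
Proof. by move=> uW vW; have := wspace_lie uW vW; rewrite !addrN. Qed.

(** The multiples of [u] by elements of weight [0] form a stable subspace. If
    it is the whole weight space, it contains a monomial, so [u] is
    invertible. *)
Lemma cyclic_mon l m u : wspace l m u -> u != 0 -> cyclic l m u ->
  exists alpha c, [/\ alpha \in Gamma, c != 0 & u = c *: xg alpha].
Proof.
move=> uW u0 ucyc.
have [al [i [aG iJ c0]]] := xcoeff_neq0 u0.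
have [u2 u4] := uW.
have [|||g [g0 E]] := ucyc (fun w => exists g, wspace 0 0 g /\ w = u * g) _ _ (xg al).
- split=> [a _ _ [g [g0 ->]] [h [h0 ->]]|l' m' p q _ lm0 pW qW [g [g0 ->]]].
    exists (a *: g + h); split; first exact: wspaceP.
    by rewrite mulrDr scalerAr.
  have f0 := wspace_opp_lie pW qW.
  exists (wmult l m [lie p, q] * g); split.
    by have := wspaceM (wspace_mult l m f0) g0; rewrite !addr0.
  have ugW : wspace l m (u * g) by have := wspaceM uW g0; rewrite !addr0.
  by rewrite (lie_wspace0 f0 ugW) -/(wmult l m _) mulrCA.
- by exists 1; rewrite mulr1; split=> //; apply: wspace1.
- by rewrite -(eig_supp char0 u2 c0).1 -(eig_supp char0 u4 c0).1; apply: wspace_xg.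
apply: (@xu_unit _ char0 _ _ u (g * xg (- al))).
by rewrite mulrA -E xgV.
Qed.

(** If the square of [a] is one of the excluded values, the square of [6 a]
    is not. *)
Lemma good_axis p : exists2 a : F, a != 0 /\ single a p \in Gamma &
  [/\ a * a != 1, a * a != 4%:R & 4%:R * (a * a) != 1].
Proof.
have [a a0 aG] := axis_exists GammaA p.
have nat_eq m n : (m%:R == n%:R :> F) = (m == n).
  wlog mn : m n / (m <= n)%N => [H|].
    by case: (leqP m n) => [/H//|/ltnW/H]; rewrite eq_sym => ->; rewrite eq_sym.
  rewrite eq_sym -subr_eq0 -natrB // nat0 subn_eq0 [RHS]eqn_leq mn /=; by [].
have [/and3P[h1 h2 h3]|] := boolP [&& a * a != 1, a * a != 4%:R & 4%:R * (a * a) != 1].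
  by exists a.
rewrite !negb_and !negbK => bad.
(* The squares become 36, 144 and 9. *)
exists (6%:R * a); first split; first by rewrite mulf_neq0 ?nat0.
  have -> : single (6%:R * a) p = single a p *+ 6.
    by apply/rowP=> q; rewrite mulmxnE !mxE; case: ifP; rewrite ?mul0rn // mulr_natl.
  by rewrite rpredMn.
have -> : 6%:R * a * (6%:R * a) = 36%:R * (a * a) by rewrite mulrACA -natrM.
have h4 : 4%:R != 0 :> F by rewrite nat0.
case/or3P: bad => /eqP E.
- by rewrite E mulr1 -natrM -[1]/(1%:R) !nat_eq.
- by rewrite E -!natrM -[1]/(1%:R) !nat_eq.
have -> : 36%:R = 9%:R * 4%:R :> F by rewrite -natrM.
by rewrite -mulrA E mulr1 -natrM -[1]/(1%:R) !nat_eq.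
Qed.

Section Multipliers.
Context (l m : F) (S : A -> Prop).
Hypothesis Sst : stable S.

Definition multiplier g := wspace 0 0 g /\ forall s, wspace l m s -> S s -> S (g * s).

Lemma multiplierP a g h : multiplier g -> multiplier h -> multiplier (a *: g + h).
Proof.
move=> [g0 gS] [h0 hS]; split=> [|s sW Ss]; first exact: wspaceP.
by rewrite mulrDl -scalerAl; apply: Sst.1; [apply: gS|apply: hS].
Qed.

Let S0 s : S s -> S 0.
Proof. by move=> Ss; have := Sst.1 (- 1) s s Ss Ss; rewrite scaleN1r addNr. Qed.

Lemma multiplierZ a g : multiplier g -> multiplier (a *: g).
Proof.
move=> gM; rewrite -[_ *: g]addr0; apply: multiplierP => //.
split=> [|s sW Ss]; first exact: wspace0.
by rewrite mul0r; apply: S0 Ss.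
Qed.

Lemma multiplierZr a g : a != 0 -> multiplier (a *: g) -> multiplier g.
Proof. by move=> a0 /(multiplierZ a^-1); rewrite scalerA mulVf // scale1r. Qed.

Lemma multiplierM g h : multiplier g -> multiplier h -> multiplier (g * h).
Proof.
move=> [g0 gS] [h0 hS]; split=> [|s sW Ss]; first by have := wspaceM g0 h0; rewrite !addr0.
rewrite -mulrA; apply: gS; last exact: hS.
by have := wspaceM h0 sW; rewrite !add0r.
Qed.

Lemma multiplier_lie l' m' (p q : A) : (l', m') <> (0, 0) -> wspace l' m' p -> wspace (- l') (- m') q ->
  multiplier (wmult l m [lie p, q]).
Proof.
move=> lm0 pW qW; have f0 := wspace_opp_lie pW qW.
split=> [|s sW Ss]; first exact: wspace_mult.
by rewrite /wmult -(lie_wspace0 f0 sW); apply: (Sst.2 l' m').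
Qed.

Lemma wmultZ a f : wmult l m (a *: f) = a *: wmult l m f.
Proof. by rewrite /wmult !xu_dZ; xu_ring Gamma J. Qed.

(** Up to a scalar, [xg sig * d p1 g] is the bracket of the monomials [n_[2]]
    and [- n_[2]], the second one multiplied by [g]. *)
Lemma multiplier_12 g : wspace 0 0 g -> multiplier (wmult l m (xg sig * d p1 g)).
Proof.
move=> gW; have [g2 g4] := gW; have [n n0 nG] := axis_exists GammaA p2.
have NW := @wspace_xg _ Gamma J (single n p2).
have NW' := @wspace_xg _ Gamma J (- single n p2).
rewrite !coordE /= in NW NW'; rewrite oppr0 in NW'.
have NW'' : wspace (- n) (- 0) (xg (- single n p2) * g).
  by have := wspaceM NW' gW; rewrite !addr0 oppr0.
have nn0 : (n, 0 : F) <> (0, 0) by move=> [/eqP]; rewrite (negPf n0).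
apply: (multiplierZr (a := - n)); first by rewrite oppr_eq0.
rewrite -wmultZ; suff <- : [lie xg (single n p2), xg (- single n p2) * g] = - n *: (xg sig * d p1 g).
  exact: multiplier_lie nn0 NW NW''.
rewrite bracketE !xu_dM !xu_dE0 !coordE /= g2 g4 oppr0 !scale0r.
have := xgV J nG; set e := xg (single n p2); set e' := xg (- single n p2) => ee.
transitivity (- n *: ((e * e') * (xg sig * d p1 g))); first by xu_ring Gamma J.
by rewrite ee mul1r.
Qed.

(** The analogue of [multiplier_12] for the second summand of the bracket,
    with [n_[4]] in place of [n_[2]]. *)
Lemma multiplier_34 g : wspace 0 0 g -> multiplier (wmult l m (2%:R *: g + d p3 g)).
Proof.
move=> gW; have [g2 g4] := gW; have [n n0 nG] := axis_exists GammaA p4.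
have NW := @wspace_xg _ Gamma J (single n p4).
have NW' := @wspace_xg _ Gamma J (- single n p4).
rewrite !coordE /= in NW NW'; rewrite oppr0 in NW'.
have NW'' : wspace (- 0) (- n) (xg (- single n p4) * g).
  by have := wspaceM NW' gW; rewrite !addr0 oppr0.
have nn0 : (0 : F, n) <> (0, 0) by move=> [/eqP]; rewrite (negPf n0).
apply: (multiplierZr (a := - n)); first by rewrite oppr_eq0.
rewrite -wmultZ; suff <- : [lie xg (single n p4), xg (- single n p4) * g] = - n *: (2%:R *: g + d p3 g).
  exact: multiplier_lie nn0 NW NW''.
rewrite bracketE !xu_dM !xu_dE0 !coordE /= g2 g4 oppr0 !scale0r.
have := xgV J nG; set e := xg (single n p4); set e' := xg (- single n p4) => ee.
transitivity (- n *: ((e * e') * (2%:R *: g + d p3 g))); first by rewrite !two; xu_ring Gamma J.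
by rewrite ee mul1r.
Qed.

Let d_sig p g : d p (xg sig * g) = xg sig * (sig 0 p *: g + d p g).
Proof. by rewrite xu_dM xu_dE0; xu_ring Gamma J. Qed.

(* As a function of [a], [psi1 a g] is quadratic, with leading coefficient
   [l *: (xg sig * xg sig * g)]: differences in [a] recover [g]. *)
Let psi1 a g : A := l *: (xg sig * xg sig * (d p1 (d p1 g) + (a + a + 1) *: d p1 g + (a * a + a) *: g))
  + m *: (xg sig * (d p3 (d p1 g) + a *: d p3 g + 2%:R *: d p1 g + (a + a) *: g)).

Let psi1E a g : single a p1 \in Gamma ->
  wmult l m (xg sig * d p1 (xg (single a p1) * g)) = xg (single a p1) * psi1 a g.
Proof.
move=> aG; rewrite /wmult !d_sig !xu_dM !xu_dE0 !coordE /= !(xu_dD, xu_dM, xu_dZ, xu_dE0) !coordE /=.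
by rewrite !scale0r /psi1 !two; xu_ring Gamma J.
Qed.

(** For the exponent [a_[1] - 2 sigma], [multiplier_12] gives back a multiple
    of the monomial [a_[1]], with coefficient [l (a - 1) (a - 2)]. *)
Lemma multiplier_axis1 a : single a p1 \in Gamma -> l != 0 -> a != 1 -> a != 2%:R ->
  multiplier (xg (single a p1)).
Proof.
move=> aG l0 a1 a2.
pose g := xg (single a p1 - sig - sig).
have gW : wspace 0 0 g.
  by apply: wspace00_xg; rewrite !coordE /= !subr0.
have gE p : d p g = (single a p1 0 p - sig 0 p - sig 0 p) *: g.
  by rewrite /g xu_dE0 !rvD !rvN.
apply: (multiplierZr (a := l * ((a - 1) * (a - 2%:R)))).
  by rewrite !mulf_neq0 // subr_eq0.
suff <- : wmult l m (xg sig * d p1 g) = (l * ((a - 1) * (a - 2%:R))) *: xg (single a p1).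
  exact: multiplier_12.
have <- : xg sig * xg sig * g = xg (single a p1).
  rewrite !xgM ?rpredD ?rpredN //; congr (xmon _ _).
  by rewrite addrC addrA !subrK.
rewrite /wmult !d_sig !(gE, xu_dZ) !coordE /= !two.
xu_ring Gamma J.
Qed.

Lemma single_opp (a : F) p : single (- a) p = - single a p.
Proof. by apply/rowP=> q; rewrite !mxE; case: ifP; rewrite ?oppr0. Qed.

Lemma single_dbl (a : F) p : single (a + a) p = single a p + single a p.
Proof. by apply/rowP=> q; rewrite !mxE; case: ifP; rewrite ?addr0. Qed.

Let good_excl (a : F) (k : nat) : (k == 1%N) || (k == 2%N) -> 
  [/\ a * a != 1, a * a != 4%:R & 4%:R * (a * a) != 1] ->
  [/\ a != k%:R, - a != k%:R, a + a != k%:R & - (a + a) != k%:R].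
Proof.
move=> kE [h1 h2 h3].
have sq x y : x * x != y * y -> x != y /\ - x != y.
  by move=> xy; split; apply: contraNneq xy => <-; rewrite ?mulrNN.
have : a * a != k%:R * k%:R.
  by case/orP: kE => /eqP->; rewrite -natrM.
have : (a + a) * (a + a) != k%:R * k%:R.
  have -> : (a + a) * (a + a) = 4%:R * (a * a) by ring.
  case/orP: kE => /eqP->; first by rewrite mulr1.
  by rewrite -natrM -{2}[4%:R]mulr1 (inj_eq (mulfI _)) // nat0.
by move=> /sq[? ?] /sq[? ?]; split.
Qed.

(** The second difference of [psi1] at [0], [a], [2 a] is [2 a^2 l] times [xg
    sig * xg sig * h]; each of the three values is a multiplier, after
    cancellation of a monomial of the first axis by [multiplier_axis1]. *)
Lemma multiplier_all1 g : l != 0 -> wspace 0 0 g -> multiplier g.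
Proof.
move=> l0 gW; have [a [a0 aG] agood] := good_axis p1.
have [a1 a1' a11 a11'] := good_excl (k := 1) isT agood.
have [a2 a2' a22 a22'] := good_excl (k := 2) isT agood.
have NG : single (- a) p1 \in Gamma by rewrite single_opp rpredN.
have DG : single (a + a) p1 \in Gamma by rewrite single_dbl rpredD.
have NDG : single (- (a + a)) p1 \in Gamma by rewrite single_opp rpredN.
have psiM b h : single b p1 \in Gamma -> - b != 1 -> - b != 2%:R -> wspace 0 0 h -> multiplier (psi1 b h).
  move=> bG b1 b2 hW.
  have bGN : single (- b) p1 \in Gamma by rewrite single_opp rpredN.
  have -> : psi1 b h = xg (single (- b) p1) * (xg (single b p1) * psi1 b h).
    by rewrite mulrA [X in X * _]mulrC single_opp xgV // mul1r.
  rewrite -psi1E //; apply: multiplierM; first exact: multiplier_axis1.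
  apply: multiplier_12.
  have bW : wspace 0 0 (xg (single b p1)) by apply: wspace00_xg; rewrite !coordE.
  by have := wspaceM bW hW; rewrite !addr0.
have sW : wspace 0 0 (xg (- sig)) by apply: wspace00_xg; rewrite !coordE oppr0.
pose h := xg (- sig) * (xg (- sig) * g).
have hW : wspace 0 0 h.
  by have := wspaceM sW (wspaceM sW gW); rewrite !addr0.
have z0 : single (0 : F) p1 = 0 by apply/rowP=> q; rewrite !mxE if_same.
have psi0 : multiplier (psi1 0 h).
  have := multiplier_12 hW.
  have := @psi1E 0 h; rewrite z0 => /(_ (rpred0 Gamma)).
  by rewrite xg0 !mul1r => ->.
apply: (multiplierZr (a := l * (2%:R * (a * a)))); first by rewrite !mulf_neq0 ?nat0.
suff -> : (l * (2%:R * (a * a))) *: g = 1 *: psi1 (a + a) h + ((- 2%:R) *: psi1 a h + psi1 0 h).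
  by apply: multiplierP; [apply: psiM|apply: multiplierP => //; apply: psiM].
have <- : xg sig * xg sig * h = g.
  by rewrite /h mulrA -[_ * _ * xg (- sig)]mulrA xgV // mulr1 mulrA xgV // mul1r.
rewrite /psi1 !two !addr0 !mulr0 !scale0r !addr0.
xu_ring Gamma J.
Qed.

(* Quadratic in [b], with leading coefficient [m *: g]. *)
Let psi3 b g : A := l *: (xg sig * (d p3 (d p1 g) + (2%:R + b) *: d p1 g))
  + m *: (d p3 (d p3 g) + (b + b + 3%:R) *: d p3 g + ((b + 1) * (b + 2%:R)) *: g).

Let psi3E b g : single b p3 \in Gamma ->
  wmult l m (2%:R *: (xg (single b p3) * g) + d p3 (xg (single b p3) * g)) = xg (single b p3) * psi3 b g.
Proof.
move=> bG; rewrite /wmult !(xu_dD, xu_dZ, xu_dM, xu_dE0) !coordE /= (xu_dC p1 p3).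
rewrite !scale0r /psi3 ?three !two.
by xu_ring Gamma J.
Qed.

Lemma multiplier_axis3 b : single b p3 \in Gamma -> m != 0 -> b != - 1 -> b != - 2%:R ->
  multiplier (xg (single b p3)).
Proof.
move=> bG m0 b1 b2.
have := @multiplier_34 (xg (single b p3) * 1) _; rewrite psi3E //.
have -> : psi3 b 1 = (m * ((b + 1) * (b + 2%:R))) *: 1.
  by rewrite /psi3 !(d1, xu_d0) !scaler0 !addr0 !add0r mulr0 scaler0 add0r scalerA.
rewrite -scalerAr mulr1 => H; apply: (multiplierZr (a := m * ((b + 1) * (b + 2%:R)))).
  by rewrite !mulf_neq0 ?addr_eq0.
by apply: H; apply: wspace00_xg; rewrite !coordE.
Qed.

(** The argument of [multiplier_all1], on the third axis. *)
Lemma multiplier_all3 g : m != 0 -> wspace 0 0 g -> multiplier g.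
Proof.
move=> m0 gW; have [a [a0 aG] agood] := good_axis p3.
have [a1 a1' a11 a11'] := good_excl (k := 1) isT agood.
have [a2 a2' a22 a22'] := good_excl (k := 2) isT agood.
have NG : single (- a) p3 \in Gamma by rewrite single_opp rpredN.
have DG : single (a + a) p3 \in Gamma by rewrite single_dbl rpredD.
have psiM b : single b p3 \in Gamma -> b != 1 -> b != 2%:R -> multiplier (psi3 b g).
  move=> bG b1 b2.
  have bGN : single (- b) p3 \in Gamma by rewrite single_opp rpredN.
  have -> : psi3 b g = xg (single (- b) p3) * (xg (single b p3) * psi3 b g).
    by rewrite mulrA [X in X * _]mulrC single_opp xgV // mul1r.
  rewrite -psi3E //; apply: multiplierM.
    by apply: multiplier_axis3; rewrite // eqr_opp.
  apply: multiplier_34.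
  have bW : wspace 0 0 (xg (single b p3)) by apply: wspace00_xg; rewrite !coordE.
  by have := wspaceM bW gW; rewrite !addr0.
have z0 : single (0 : F) p3 = 0 by apply/rowP=> q; rewrite !mxE if_same.
have psi0 : multiplier (psi3 0 g).
  have := multiplier_34 gW.
  have := @psi3E 0 g; rewrite z0 => /(_ (rpred0 Gamma)).
  by rewrite xg0 !mul1r => ->.
apply: (multiplierZr (a := m * (2%:R * (a * a)))); first by rewrite !mulf_neq0 ?nat0.
suff -> : (m * (2%:R * (a * a))) *: g = 1 *: psi3 (a + a) g + ((- 2%:R) *: psi3 a g + psi3 0 g).
  by apply: multiplierP; [apply: psiM|apply: multiplierP => //; apply: psiM].
rewrite /psi3 ?three !two !addr0 !add0r.
xu_ring Gamma J.
Qed.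
End Multipliers.

(** Each vector of the weight space is a weight [0] multiple of the
    invertible [xg alpha], and every weight [0] element is a multiplier. *)
Lemma mon_cyclic l m alpha : (l, m) <> (0, 0) -> alpha \in Gamma ->
  wspace l m (xg alpha) -> cyclic l m (xg alpha).
Proof.
move=> lm0 aG aW S Sst Sa w wW.
have aW' : wspace (- l) (- m) (xg (- alpha)).
  have [a2 a4] := aW; have := @wspace_xg _ Gamma J alpha; move=> [b2 b4].
  have eqc x y : x *: xg alpha = y *: xg alpha -> x = y.
    move/(congr1 (xcoeff alpha 0)); rewrite !linearZ /= xcoeff_mon ?jset0 // !eqxx !mulr1.
    by [].
  have <- := eqc _ _ (etrans (esym b2) a2); have <- := eqc _ _ (etrans (esym b4) a4).
  by have := @wspace_xg _ Gamma J (- alpha); rewrite !rvN.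
have gW : wspace 0 0 (w * xg (- alpha)).
  by have := wspaceM wW aW'; rewrite !subrr.
have -> : w = (w * xg (- alpha)) * xg alpha.
  by rewrite -mulrA [X in _ * X]mulrC xgV // mulr1.
suff [_] : multiplier l m S (w * xg (- alpha)) by apply.
have [l0|l0] := eqVneq l 0; last exact: multiplier_all1.
apply: multiplier_all3 => //; apply/eqP => m0.
by apply: lm0; rewrite l0 m0.
Qed.
End Cyclic.

(** * Correspondences *)

Section AdPolyMul.
Context (F : closedFieldType) (Gamma : zmodClosed 'rV[F]_4) (J : jtype).
Local Notation A := (xu_A4 Gamma J).
Local Notation d := (@xu_d F Gamma J).
Implicit Types (u v w : A) (P Q : {poly F}) (p : 'I_4).

Lemma ad_polyEw n P u v : (size P <= n)%N ->
  ad_poly P u v = \sum_(i < n) P`_i *: iter i (lie u) v.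
Proof.
move=> Pn; rewrite /ad_poly (big_ord_widen n (fun i => P`_i *: iter i (lie u) v)) //.
rewrite big_mkcond; apply: eq_bigr => i _; case: ltnP => // Pi.
by rewrite nth_default // scale0r.
Qed.

Lemma ad_polyP a P Q u v : ad_poly (a *: P + Q) u v = a *: ad_poly P u v + ad_poly Q u v.
Proof.
pose n := maxn (size (a *: P + Q)) (maxn (size P) (size Q)).
rewrite !(@ad_polyEw n) ?leq_max ?leqnn ?orbT // scaler_sumr -big_split.
by apply: eq_bigr => i _; rewrite coefD coefZ scalerDl scalerA.
Qed.

Lemma ad_polyMX P u v : ad_poly (P * 'X) u v = [lie u, ad_poly P u v].
Proof.
have [->|P0] := eqVneq P 0.
  by rewrite mul0r /ad_poly size_poly0 big_ord0 linear0.
rewrite /ad_poly size_mulX // big_ord_recl coefMX eqxx scale0r add0r linear_sum.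
by apply: eq_bigr => i _; rewrite coefMX /= linearZ.
Qed.

Lemma ad_poly0 u v : ad_poly 0 u v = 0.
Proof. by rewrite /ad_poly size_poly0 big_ord0. Qed.

Lemma ad_polyM P Q u v : ad_poly (P * Q) u v = ad_poly P u (ad_poly Q u v).
Proof.
elim/poly_ind: P => [|P c IH]; first by rewrite mul0r !ad_poly0.
have -> : (P * 'X + c%:P) * Q = c *: Q + P * Q * 'X.
  by rewrite mulrDl mul_polyC addrC mulrAC.
rewrite ad_polyP ad_polyMX IH -ad_polyMX.
have -> : P * 'X + c%:P = c *: 1 + P * 'X by rewrite addrC alg_polyC.
by rewrite ad_polyP /ad_poly size_poly1 big_ord1 coef1 scale1r.
Qed.

Lemma ad_polyZr P a u v w : ad_poly P u (a *: v + w) = a *: ad_poly P u v + ad_poly P u w.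
Proof.
rewrite /ad_poly scaler_sumr -big_split; apply: eq_bigr => i _ /=.
have -> : iter i (lie u) (a *: v + w) = a *: iter i (lie u) v + iter i (lie u) w.
  by elim: (nat_of_ord i) => //= n ->; rewrite linearP.
by rewrite scalerDr !scalerA mulrC.
Qed.

Lemma lfinP u a v w : lfin u v -> lfin u w -> lfin u (a *: v + w).
Proof.
move=> [P [P0 uv]] [Q [Q0 uw]]; exists (P * Q); split; first by rewrite mulf_neq0.
have ad0 T : ad_poly T u 0 = 0.
  by have := ad_polyZr T (- 1) u 0 0; rewrite scaler0 addr0 scaleN1r addNr.
by rewrite ad_polyZr [in ad_poly _ u v]mulrC !ad_polyM uv uw !ad0 scaler0 addr0.
Qed.

(** On a monomial [d p] is the sum of a scalar and of a nilpotent operator. *)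
Lemma lfin_derivation u p s : (forall v, [lie u, v] = s *: d p v) -> forall v, lfin u v.
Proof.
move=> uE; elim/xu_ind => [|a v w|al i aG iJ]; last 2 first.
- exact: lfinP.
- exists (('X - (s * al 0 p)%:P) ^+ (i 0%R p).+1); split.
    by rewrite expf_neq0 // polyXsubC_eq0.
  have E v : ad_poly ('X - (s * al 0 p)%:P) u v = s *: shifted_d p (al 0 p) v.
    have -> : 'X - (s * al 0 p)%:P = (- (s * al 0 p)) *: 1 + 1 * 'X :> {poly F}.
      by rewrite scaleNr alg_polyC mul1r addrC.
    rewrite ad_polyP ad_polyMX /ad_poly size_poly1 big_ord1 coef1 /= scale1r uE /shifted_d.
    by xu_ring Gamma J.
  have -> k v : ad_poly (('X - (s * al 0 p)%:P) ^+ k) u v = s ^+ k *: iter k (shifted_d p (al 0 p)) v.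
    elim: k => [|k IH]; first by rewrite expr0 /ad_poly size_poly1 big_ord1 coef1.
    rewrite exprS ad_polyM IH E; rewrite shifted_dZ.
    by rewrite scalerA -exprS.
  by rewrite shifted_d_mon_nil // scaler0.
exists 1; split; first exact: oner_neq0.
by rewrite /ad_poly size_poly1 big_ord1 coef1 scale1r.
Qed.
End AdPolyMul.

Section Torus.
Context (F : closedFieldType) (char0 : [pchar F] =i pred0).
Context (Gamma : zmodClosed 'rV[F]_4) (J : jtype).
Local Notation A := (xu_A4 Gamma J).
Local Notation xmon := (xmon Gamma J).
Local Notation xg alpha := (xmon alpha 0).
Local Notation d := (@xu_d F Gamma J).
Local Notation sig := (sigma F).
Local Notation sig1 := (sigma1 F).
Local Notation inZ := (@inZ F Gamma J).
Local Notation wspace := (@wspace F Gamma J).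
Implicit Types (u v w : A) (p : 'I_4).
Hypothesis sigG : sig \in Gamma.

Definition torelt s t : A := s *: xg (- sig) + t%:A.
Local Notation tor := torelt.

Lemma lie_tor s t u : [lie tor s t, u] = - s *: d p2 u + t *: d p4 u.
Proof. by rewrite lieDl !lieZl lie_X // lie_1 scalerN scaleNr. Qed.

Lemma tor_inZ s t : inZ (tor s t) -> s = 0 /\ t = 0.
Proof.
move=> [c E].
have coefs alpha : alpha \in Gamma -> alpha <> sig1 ->
    s * (alpha == - sig)%:R + t * (alpha == 0)%:R = 0.
  move=> aG a1; have := congr1 (xcoeff alpha 0) E.
  have NsG : - sig \in Gamma by rewrite rpredN.
  rewrite linearD !linearZ /= -(xg0 Gamma J) (xcoeff_mon _ _ NsG (jset0 J)).
  rewrite (xcoeff_mon _ _ (rpred0 Gamma) (jset0 J)) eqxx !andbT => ->.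
  have [sG|sG] := boolP (sig1 \in Gamma); last by rewrite xmon_outl // linear0 mulr0.
  by rewrite xcoeff_mon ?jset0 // (introF eqP a1) mulr0.
have s0 : sig != 0 by apply/eqP=> /rowP/(_ p1); rewrite sigmaE rv0 => /eqP; rewrite oner_eq0.
split.
  have := coefs (- sig) _ _; rewrite eqxx oppr_eq0 (negPf s0) mulr1 mulr0 addr0; apply.
    by rewrite rpredN.
  by move/rowP/(_ p1); rewrite !coordE => /eqP; rewrite oppr_eq0 oner_eq0.
have := coefs 0 (rpred0 Gamma) _; rewrite eqxx eq_sym oppr_eq0 (negPf s0) mulr1 mulr0 add0r; apply.
by move/rowP/(_ p3); rewrite !coordE rv0 => /eqP; rewrite eq_sym oppr_eq0 oner_eq0.
Qed.

Lemma lfin_tor10 v : lfin (tor 1 0) v.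
Proof.
apply: (@lfin_derivation _ _ _ _ p2 (- 1)) => w.
by rewrite lie_tor scale0r addr0.
Qed.

Lemma lfin_tor01 v : lfin (tor 0 1) v.
Proof.
apply: (@lfin_derivation _ _ _ _ p4 1) => w.
by rewrite lie_tor oppr0 scale0r add0r.
Qed.

(** The derivations [d p2] and [d p4] kill the centre, so the defect of one
    with a nonzero eigenvalue can be absorbed; the other defect then
    vanishes, as they commute. *)
Lemma wspace_modZ l m u : (l, m) <> (0, 0) -> inZ (d p2 u - l *: u) -> inZ (d p4 u - m *: u) ->
  exists2 z, inZ z & wspace l m (u + z).
Proof.
move=> lm0 u2 u4.
have E2 : d p2 (d p4 u - m *: u) = 0 by apply: dZ2.
have E4 : d p4 (d p2 u - l *: u) = 0 by apply: dZ4.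
have [l0|l0] := eqVneq l 0; last first.
  exists (l^-1 *: (d p2 u - l *: u)); first exact: inZZ.
  have W2 : d p2 (u + l^-1 *: (d p2 u - l *: u)) = l *: (u + l^-1 *: (d p2 u - l *: u)).
    rewrite xu_dD xu_dZ (dZ2 u2) scaler0 addr0 scalerDr scalerA divff // scale1r.
    by rewrite addrC subrK.
  split=> //; set v := u + _ in W2 *.
  have vZ : inZ (d p4 v - m *: v).
    have -> : d p4 v - m *: v = d p4 u - m *: u + l^-1 *: (d p4 (d p2 u - l *: u)) - (m * l^-1) *: (d p2 u - l *: u).
      rewrite /v xu_dD xu_dZ; xu_ring Gamma J.
    by rewrite E4 scaler0 addr0; apply: inZB => //; apply: inZZ.
  have := dZ2 vZ; rewrite xu_dD xu_dN xu_dZ (xu_dC p2 p4) W2 xu_dZ.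
  have -> : l *: d p4 v - m *: (l *: v) = l *: (d p4 v - m *: v) by xu_ring Gamma J.
  by move/eqP; rewrite scaler_eq0 (negPf l0) subr_eq0 => /eqP.
have m0 : m != 0 by apply/eqP => m0; rewrite l0 m0 in lm0.
exists (m^-1 *: (d p4 u - m *: u)); first exact: inZZ.
have W4 : d p4 (u + m^-1 *: (d p4 u - m *: u)) = m *: (u + m^-1 *: (d p4 u - m *: u)).
  rewrite xu_dD xu_dZ (dZ4 u4) scaler0 addr0 scalerDr scalerA divff // scale1r.
  by rewrite addrC subrK.
split=> //; set v := u + _ in W4 *.
have vZ : inZ (d p2 v - l *: v).
  have -> : d p2 v - l *: v = d p2 u - l *: u + m^-1 *: (d p2 (d p4 u - m *: u)) - (l * m^-1) *: (d p4 u - m *: u).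
    rewrite /v xu_dD xu_dZ; xu_ring Gamma J.
  by rewrite E2 scaler0 addr0; apply: inZB => //; apply: inZZ.
have := dZ4 vZ; rewrite xu_dD xu_dN xu_dZ (xu_dC p4 p2) W4 xu_dZ.
have -> : m *: d p2 v - l *: (m *: v) = m *: (d p2 v - l *: v) by xu_ring Gamma J.
by move/eqP; rewrite scaler_eq0 (negPf m0) subr_eq0 => /eqP.
Qed.
End Torus.

Definition xu_D (F : fieldType) (Gamma : zmodClosed 'rV[F]_4) (J : jtype) (u : xu_A4 Gamma J) : Prop :=
  lie_pi (sigma1_ideal Gamma J) u \in @derived_pred F (xu_B4 Gamma J).

(** An isomorphism between derived algebras of central quotients, seen as a
    relation between representatives in the algebras [xu_A4], so that none
    has to be chosen. *)
Record xu_corr (F : fieldType) (Gamma Gamma' : zmodClosed 'rV[F]_4) (J J' : jtype)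
    (R : xu_A4 Gamma J -> xu_A4 Gamma' J' -> Prop) : Prop := XuCorr {
  corrP : forall c a b a' b', R a a' -> R b b' -> R (c *: a + b) (c *: a' + b');
  corr_lie : forall a b a' b', R a a' -> R b b' -> R [lie a, b] [lie a', b'];
  corr_inZ : forall a a', R a a' -> inZ a <-> inZ a';
  corr_Z : forall a a', inZ a -> inZ a' -> R a a';
  corr_dom : forall a, xu_D a -> exists a', R a a';
  corr_cod : forall a', xu_D a' -> exists a, R a a'
}.

Lemma xu_corr_sym (F : fieldType) (Gamma Gamma' : zmodClosed 'rV[F]_4) (J J' : jtype)
    (R : xu_A4 Gamma J -> xu_A4 Gamma' J' -> Prop) :
  xu_corr R -> xu_corr (fun a' a => R a a').
Proof.
move=> [RP Rl RiZ RZ Rd Rc]; split=> //.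
- by move=> c a b a' b'; apply: RP.
- by move=> a b a' b'; apply: Rl.
- by move=> a' a /RiZ[? ?]; split.
- by move=> a' a a'Z aZ; apply: RZ.
Qed.

Section Correspondence.
Context (F : closedFieldType) (char0 : [pchar F] =i pred0).
Context (Gamma Gamma' : zmodClosed 'rV[F]_4) (J J' : jtype).
Local Notation A := (xu_A4 Gamma J).
Local Notation A' := (xu_A4 Gamma' J').
Local Notation xg alpha := (xmon Gamma J alpha 0).
Local Notation xg' alpha := (xmon Gamma' J' alpha 0).
Local Notation d := (@xu_d F Gamma J).
Local Notation d' := (@xu_d F Gamma' J').
Local Notation sig := (sigma F).
Local Notation wspace' := (@wspace F Gamma' J').
Local Notation wspace := (@wspace F Gamma J).
Local Notation tor := (@torelt F Gamma J).
Local Notation tor' := (@torelt F Gamma' J').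
Hypothesis GammaA : conditionA Gamma.
Hypothesis GammaA' : conditionA Gamma'.
Let sigG : sig \in Gamma. Proof. by case: GammaA. Qed.
Let sigG' : sig \in Gamma'. Proof. by case: GammaA'. Qed.

Variable R : A -> A' -> Prop.
Hypothesis Rcorr : xu_corr R.

Lemma corrZ c a a' : R a a' -> R (c *: a) (c *: a').
Proof.
move=> Ra; rewrite -[c *: a]addr0 -[c *: a']addr0; apply: corrP Rcorr _ _ _ _ _ Ra _.
by apply: (corr_Z Rcorr); apply: inZ0.
Qed.

Lemma corrD a b a' b' : R a a' -> R b b' -> R (a + b) (a' + b').
Proof. by move=> Ra Rb; rewrite -[a]scale1r -[a']scale1r; apply: (corrP Rcorr). Qed.

Lemma corrB a b a' b' : R a a' -> R b b' -> R (a - b) (a' - b').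
Proof. by move=> Ra /(corrZ (- 1)); rewrite !scaleN1r; apply: corrD. Qed.

Lemma corr_modZ a a' b b' : R a a' -> inZ (b - a) -> inZ (b' - a') -> R b b'.
Proof.
by move=> Ra bZ b'Z; rewrite -[b](subrK a) -[b'](subrK a'); apply: corrD => //; apply: (corr_Z Rcorr).
Qed.

Lemma corr_uniq a a' b' : R a a' -> R a b' -> inZ (a' - b').
Proof.
by move=> Ra Rb; apply/(corr_inZ Rcorr (corrB Ra Rb)); rewrite subrr; apply: inZ0.
Qed.

Lemma corr_ad_poly P u u' v v' : R u u' -> R v v' -> R (ad_poly P u v) (ad_poly P u' v').
Proof.
move=> Ru Rv; rewrite /ad_poly.
elim/big_rec2: _ => [|i a' a _ Ra]; first by apply: (corr_Z Rcorr); apply: inZ0.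
apply: (corrP Rcorr) => //; elim: (nat_of_ord i) => //= n IH; exact: (corr_lie Rcorr).
Qed.

(** If [P] annihilates the preimage of [v'], the image of this relation holds
    modulo the centre; one more bracket with [u'] removes the central term,
    whence the factor [X] of the polynomial. *)
Lemma corr_lfin u u' : R u u' -> (forall v, lfin u v) -> lfinw u'.
Proof.
move=> Ru lf l m v' v'D _; have [v Rv] := corr_cod Rcorr v'D.
have [P [P0 uv]] := lf v; exists (P * 'X); split.
  by rewrite mulf_neq0 ?polyX_eq0.
rewrite ad_polyMX lie_Zr //; apply/(corr_inZ Rcorr (corr_ad_poly P Ru Rv)).
by rewrite uv; apply: inZ0.
Qed.

Lemma corr_tor u : (forall v, lfin u v) -> xu_D u -> exists s t : F, R u (tor' s t).
Proof.
move=> lf uD; have [u' Ru] := corr_dom Rcorr uD.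
have [s [t E]] := lfin_span char0 GammaA' (corr_lfin Ru lf).
exists s, t; apply: (corr_modZ Ru); first by rewrite subrr; apply: inZ0.
have -> : tor' s t - u' = - (u' - s *: xg' (- sig) - t%:A) by rewrite /torelt; xu_ring Gamma' J'.
exact: inZN.
Qed.

Lemma tor_inD (s t : F) : xu_D (tor s t).
Proof.
apply: inDP; first by apply: (inD_xg J GammaA); rewrite ?rpredN // !coordE ?oppr0 //; left;
  rewrite -subr_eq0 -opprD oppr_eq0 -(natrD _ 1 1) natf_eq0_char0.
apply: inDZ; rewrite -(xg0 Gamma J); apply: (inD_xg J GammaA); rewrite ?rpred0 // rv0 //.
by left; rewrite eq_sym oner_eq0.
Qed.

Section Weights.
Variables (a b c e : F).
Hypothesis RX : R (tor 1 0) (tor' a b).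
Hypothesis RY : R (tor 0 1) (tor' c e).

Lemma corr_tor_gen s t : R (tor s t) (tor' (s * a + t * c) (s * b + t * e)).
Proof.
have -> : tor s t = s *: tor 1 0 + t *: tor 0 1 by rewrite /torelt; xu_ring Gamma J.
have -> : tor' (s * a + t * c) (s * b + t * e) = s *: tor' a b + t *: tor' c e.
  by rewrite /torelt; xu_ring Gamma' J'.
by apply: (corrP Rcorr) => //; apply: corrZ.
Qed.

Lemma corr_det : a * e - b * c != 0.
Proof.
apply/negP=> /eqP D0.
have ker s t : s * a + t * c = 0 -> s * b + t * e = 0 -> s = 0 /\ t = 0.
  move=> E1 E2; have := corr_tor_gen s t; rewrite E1 E2 /torelt !scale0r addr0 => H.
  by apply: (tor_inZ sigG); apply/(corr_inZ Rcorr H); apply: inZ0.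
have [e0 b0] : e = 0 /\ - b = 0 by apply: ker; [rewrite mulNr mulrC|rewrite mulNr mulrC subrr].
have [c0 a0] : c = 0 /\ - a = 0.
  apply: ker; first by rewrite mulNr mulrC subrr.
  by rewrite -[RHS]oppr0 -D0; ring.
move/eqP: a0; rewrite oppr_eq0 => /eqP a0; move/eqP: b0; rewrite oppr_eq0 => /eqP b0.
have [/eqP] : 1 = 0 :> F /\ 0 = 0 :> F.
  by apply: ker; rewrite ?a0 ?b0 ?c0 ?e0 !mulr0 addr0.
by rewrite oner_eq0.
Qed.

(** The weight of the image of a vector of weight [(l, m)], by the rule of
    Cramer; see [corr_wspace]. *)
Definition wl l m := (e * l + b * m) / (a * e - b * c).
Definition wm l m := (c * l + a * m) / (a * e - b * c).

Lemma wlmE l m : - a * wl l m + b * wm l m = - l /\ - c * wl l m + e * wm l m = m.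
Proof. by split; rewrite /wl /wm; field; exact: corr_det. Qed.

Lemma wlm_neq0 l m : (l, m) <> (0, 0) -> (wl l m, wm l m) <> (0, 0).
Proof.
move=> lm0 [E1 E2]; apply: lm0; have [] := wlmE l m; rewrite E1 E2 !mulr0 addr0.
by move=> /esym/eqP; rewrite oppr_eq0 => /eqP-> <-.
Qed.

Lemma wlmN l m : wl (- l) (- m) = - wl l m /\ wm (- l) (- m) = - wm l m.
Proof. by split; rewrite /wl /wm !mulrN -opprD mulNr. Qed.

Lemma corr_wspace l m u u' : (l, m) <> (0, 0) -> R u u' -> wspace l m u ->
  exists2 u'', R u u'' & wspace' (wl l m) (wm l m) u''.
Proof.
move=> lm0 Ru [u2 u4].
have HX : inZ ([lie tor' a b, u'] + l *: u').
  apply/(corr_inZ Rcorr (corrD (corr_lie Rcorr RX Ru) (corrZ l Ru))).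
  by rewrite lie_tor // u2 u4 scale0r addr0 scaleN1r addNr; apply: inZ0.
have HY : inZ ([lie tor' c e, u'] - m *: u').
  apply/(corr_inZ Rcorr (corrB (corr_lie Rcorr RY Ru) (corrZ m Ru))).
  by rewrite lie_tor // u2 u4 oppr0 scale0r add0r scale1r subrr; apply: inZ0.
rewrite !lie_tor // in HX HY.
have D0 := corr_det; set D := a * e - b * c in D0.
have [E1 E2] := wlmE l m; set l' := wl l m in E1 E2 *; set m' := wm l m in E1 E2 *.
have lE : l = a * l' - b * m' by rewrite -[l]opprK -E1; ring.
have [| |z zZ zW] := @wspace_modZ F Gamma' J' l' m' u' (wlm_neq0 lm0).
- have -> : d' p2 u' - l' *: u' = D^-1 *: (- e *: (- a *: d' p2 u' + b *: d' p4 u' + l *: u')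
      + b *: (- c *: d' p2 u' + e *: d' p4 u' - m *: u')).
    apply: (scalerI D0); rewrite scalerA divff // scale1r /D lE -E2.
    by xu_ring Gamma' J'.
  by apply: inZZ; apply: inZP; [|apply: inZZ].
- have -> : d' p4 u' - m' *: u' = D^-1 *: (- c *: (- a *: d' p2 u' + b *: d' p4 u' + l *: u')
      + a *: (- c *: d' p2 u' + e *: d' p4 u' - m *: u')).
    apply: (scalerI D0); rewrite scalerA divff // scale1r /D lE -E2.
    by xu_ring Gamma' J'.
  by apply: inZZ; apply: inZP; [|apply: inZZ].
exists (u' + z) => //; apply: (corr_modZ Ru); first by rewrite subrr; apply: inZ0.
by rewrite addrC addKr.
Qed.

Lemma corr_wspace_inv l m u u' : (l, m) <> (0, 0) -> R u u' -> wspace' (wl l m) (wm l m) u' ->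
  exists2 v, R v u' & wspace l m v.
Proof.
move=> lm0 Ru [u2 u4]; have [E1 E2] := wlmE l m.
have HX : inZ ([lie tor 1 0, u] + l *: u).
  apply/(corr_inZ Rcorr (corrD (corr_lie Rcorr RX Ru) (corrZ l Ru))).
  rewrite lie_tor // u2 u4 !scalerA -!scalerDl E1 addNr scale0r; exact: inZ0.
have HY : inZ ([lie tor 0 1, u] - m *: u).
  apply/(corr_inZ Rcorr (corrB (corr_lie Rcorr RY Ru) (corrZ m Ru))).
  rewrite lie_tor // u2 u4 !scalerA -!scalerDl E2 subrr; exact: inZ0.
rewrite !lie_tor // in HX HY.
have [| |z zZ zW] := @wspace_modZ F Gamma J l m u lm0.
- suff -> : d p2 u - l *: u = - (- 1 *: d p2 u + 0 *: d p4 u + l *: u) by apply: inZN.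
  by xu_ring Gamma J.
- suff -> : d p4 u - m *: u = - 0 *: d p2 u + 1 *: d p4 u - m *: u by [].
  by xu_ring Gamma J.
exists (u + z) => //; apply: (corr_modZ Ru); last by rewrite subrr; apply: inZ0.
by rewrite addrC addKr.
Qed.

(** The definition of [cyclic] refers only to linear combinations, weights
    and brackets. *)
Lemma corr_cyclic l m u u' : (l, m) <> (0, 0) -> R u u' -> wspace' (wl l m) (wm l m) u' ->
  cyclic l m u -> cyclic (wl l m) (wm l m) u'.
Proof.
move=> lm0 Ru u'W ucyc S' S'st S'u w' w'W.
have w'D : xu_D w' by apply: (wspace_inD sigG' (wlm_neq0 lm0) w'W).
have [w0 Rw0] := corr_cod Rcorr w'D.
have [w Rw wW] := corr_wspace_inv lm0 Rw0 w'W.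
pose S w := exists w', [/\ R w w', S' w' & wspace' (wl l m) (wm l m) w'].
have Sst : stable S.
  split=> [k w1 w2 [x [Rx Sx xW]] [y [Ry Sy yW]]|l1 m1 p q s lm1 pW qW [s' [Rs Ss sW]]].
    exists (k *: x + y); split; [exact: (corrP Rcorr)|exact: S'st.1|exact: wspaceP].
  have nlm1 : (- l1, - m1) <> (0, 0).
    by move=> [/eqP + /eqP]; rewrite !oppr_eq0 => /eqP l10 /eqP m10; apply: lm1; rewrite l10 m10.
  have [p0 Rp0] := corr_dom Rcorr (wspace_inD sigG lm1 pW).
  have [q0 Rq0] := corr_dom Rcorr (wspace_inD sigG nlm1 qW).
  have [p' Rp p'W] := corr_wspace lm1 Rp0 pW.
  have [q' Rq q'W] := corr_wspace nlm1 Rq0 qW.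
  rewrite (wlmN l1 m1).1 (wlmN l1 m1).2 in q'W.
  exists [lie [lie p', q'], s']; split.
  - by apply: (corr_lie Rcorr) => //; apply: (corr_lie Rcorr).
  - exact: (S'st.2 _ _ _ _ _ (wlm_neq0 lm1) p'W q'W).
  - by have := wspace_lie (wspace_opp_lie p'W q'W) sW; rewrite !add0r.
have Su : S u by exists u'.
have [w'' [Rw'' Sw'' w''W]] := ucyc S Sst Su w wW.
suff <- : w'' = w' by [].
apply/eqP; rewrite -subr_eq0; apply/eqP; apply: (wspaceZ0 (wlm_neq0 lm0)); last exact: corr_uniq Rw'' Rw.
by rewrite -scaleN1r; apply: wspaceD => //; apply: wspaceZ.
Qed.

(** By [mon_cyclic] the monomial is cyclic, so is its image, and cyclic
    vectors are monomials by [cyclic_mon]. *)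
Lemma corr_mon alpha : alpha \in Gamma -> (alpha 0 p2, alpha 0 p4) <> (0, 0) ->
  exists alpha' k, [/\ alpha' \in Gamma', k != 0, R (xg alpha) (k *: xg' alpha'),
    alpha' 0 p2 = wl (alpha 0 p2) (alpha 0 p4) & alpha' 0 p4 = wm (alpha 0 p2) (alpha 0 p4)].
Proof.
move=> aG lm0; have aW := @wspace_xg F Gamma J alpha.
have [u0 Ru0] := corr_dom Rcorr (wspace_inD sigG lm0 aW).
have [u' Ru u'W] := corr_wspace lm0 Ru0 aW.
have u'0 : u' != 0.
  apply: contraNneq (xg_neq0 J aG) => u'0; apply/eqP/(wspaceZ0 lm0 aW).
  by apply/(corr_inZ Rcorr Ru); rewrite u'0; apply: inZ0.
have ucyc := corr_cyclic lm0 Ru u'W (mon_cyclic char0 GammaA lm0 aG aW).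
have [al' [k [aG' k0 E]]] := cyclic_mon char0 u'W u'0 ucyc.
exists al', k; rewrite -E; split=> //.
  have : d' p2 u' = al' 0 p2 *: u' by rewrite E xu_dZ xu_dE0; xu_ring Gamma' J'.
  by rewrite u'W.1 => /eqP; rewrite -subr_eq0 -scalerBl scaler_eq0 (negPf u'0) orbF subr_eq0 => /eqP.
have : d' p4 u' = al' 0 p4 *: u' by rewrite E xu_dZ xu_dE0; xu_ring Gamma' J'.
by rewrite u'W.2 => /eqP; rewrite -subr_eq0 -scalerBl scaler_eq0 (negPf u'0) orbF subr_eq0 => /eqP.
Qed.
End Weights.
End Correspondence.

(** * The two distinguished lines of the torus *)

Section Monomials.
Context (F : closedFieldType) (char0 : [pchar F] =i pred0).
Context (Gamma : zmodClosed 'rV[F]_4) (J : jtype).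
Local Notation A := (xu_A4 Gamma J).
Local Notation xg alpha := (xmon Gamma J alpha 0).
Implicit Types (u v : A) (alpha beta gamma : 'rV[F]_4).

Lemma xcoeff_xg alpha beta : beta \in Gamma -> xcoeff alpha 0 (xg beta) = (alpha == beta)%:R.
Proof. by move=> bG; rewrite xcoeff_mon ?jset0 // eqxx andbT. Qed.

Lemma xcoeff_inZ alpha u : alpha <> sigma1 F -> inZ u -> xcoeff alpha 0 u = 0.
Proof.
move=> a1 [c ->]; rewrite linearZ /=.
have [sG|sG] := boolP (sigma1 F \in Gamma); last by rewrite xmon_outl // linear0 mulr0.
by rewrite xcoeff_xg // (introF eqP a1) mulr0.
Qed.

Lemma neq_sigma1 alpha p : p = p2 \/ p = p4 -> alpha 0 p != 0 -> alpha <> sigma1 F.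
Proof. by case=> ->; move=> /[swap] ->; rewrite sigma1E eqxx. Qed.

Lemma scale_xg_inj a b alpha : alpha \in Gamma -> a *: xg alpha = b *: xg alpha -> a = b.
Proof.
by move=> aG /(congr1 (xcoeff alpha 0)); rewrite !linearZ /= xcoeff_xg // eqxx !mulr1.
Qed.

Lemma xg_inj a alpha beta : alpha \in Gamma -> beta \in Gamma -> a != 0 ->
  forall b, a *: xg alpha = b *: xg beta -> alpha = beta.
Proof.
move=> aG bG a0 b /(congr1 (xcoeff alpha 0)); rewrite !linearZ /= !xcoeff_xg // eqxx mulr1.
by case: eqP => // _; rewrite mulr0 => a00; rewrite a00 eqxx in a0.
Qed.

(** Otherwise the sum has nonzero coefficients at both [alpha] and [beta]. *)
Lemma xg_add_mono a b c alpha beta gamma : alpha \in Gamma -> beta \in Gamma -> gamma \in Gamma ->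
  a != 0 -> b != 0 -> a *: xg alpha + b *: xg beta = c *: xg gamma -> alpha = beta.
Proof.
move=> aG bG gG a0 b0 E; apply/eqP/negP => /negP ab.
have := congr1 (xcoeff alpha 0) E; have := congr1 (xcoeff beta 0) E.
rewrite !linearD !linearZ /= !xcoeff_xg // !eqxx (eq_sym beta) (negPf ab) !mulr0 !mulr1 add0r addr0.
case: (eqVneq beta gamma) => [bg _|_]; last by rewrite mulr0 => b00; rewrite b00 eqxx in b0.
by rewrite -bg (negPf ab) mulr0 => a00; rewrite a00 eqxx in a0.
Qed.
End Monomials.

Section Lines.
Context (F : closedFieldType) (char0 : [pchar F] =i pred0).
Context (Gamma Gamma' : zmodClosed 'rV[F]_4) (J J' : jtype).
Local Notation A := (xu_A4 Gamma J).
Local Notation A' := (xu_A4 Gamma' J').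
Local Notation xg alpha := (xmon Gamma J alpha 0).
Local Notation xg' alpha := (xmon Gamma' J' alpha 0).
Local Notation d' := (@xu_d F Gamma' J').
Local Notation sig := (sigma F).
Local Notation sig1 := (sigma1 F).
Local Notation wspace' := (@wspace F Gamma' J').
Local Notation wspace := (@wspace F Gamma J).
Local Notation tor := (@torelt F Gamma J).
Local Notation tor' := (@torelt F Gamma' J').
Hypothesis GammaA : conditionA Gamma.
Hypothesis GammaA' : conditionA Gamma'.
Let sigG : sig \in Gamma. Proof. by case: GammaA. Qed.
Let sigG' : sig \in Gamma'. Proof. by case: GammaA'. Qed.
Variable R : A -> A' -> Prop.
Hypothesis Rcorr : xu_corr R.
Variables (a b c e : F).
Hypothesis RX : R (tor 1 0) (tor' a b).
Hypothesis RY : R (tor 0 1) (tor' c e).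

Let D0 : a * e - b * c != 0. Proof. exact: (corr_det GammaA Rcorr RX RY). Qed.

Lemma corr_mon_inv beta' : beta' \in Gamma' -> (beta' 0 p2, beta' 0 p4) <> (0, 0) ->
  exists beta k, [/\ beta \in Gamma, k != 0, R (k *: xg beta) (xg' beta')
    & (beta 0 p2, beta 0 p4) <> (0, 0)].
Proof.
move=> bG b0; have Rs := xu_corr_sym Rcorr.
have [s [t RX']] := corr_tor char0 GammaA Rs (lfin_tor10 sigG') (tor_inD char0 _ GammaA' 1 0).
have [s' [t' RY']] := corr_tor char0 GammaA Rs (lfin_tor01 sigG') (tor_inD char0 _ GammaA' 0 1).
have [be [k [beG k0 Rk E1 E2]]] := corr_mon char0 GammaA' GammaA Rs RX' RY' bG b0.
exists be, k; split=> //; rewrite E1 E2; exact: (wlm_neq0 GammaA' Rs RX' RY').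
Qed.

Lemma wspace_xg_neq0 alpha l m : alpha \in Gamma -> wspace l m (xg alpha) -> l = alpha 0 p2 /\ m = alpha 0 p4.
Proof.
move=> aG [a2 a4]; rewrite !xu_dE0 in a2 a4.
by split; [have := scale_xg_inj aG a2|have := scale_xg_inj aG a4].
Qed.

(** The image [f'] of [[p, q]] acts on a monomial [beta] by multiplication by
    [beta_2 D1 + beta_4 D3], where [D1] and [D3] come from the gradient of
    [f']; as it sends monomials to monomials, these combinations are
    multiples of monomials. If [s'] and [t'] were both nonzero, neither [D1]
    nor [D3] would vanish, so they would be multiples of one monomial.
    Commutation of the partial derivatives then makes it the monomial [1],
    and [f'] falls into the torus by [span_of_gradient], against the
    hypothesis on [[p, q]]. *)
Lemma corr_line l1 m1 p q s t s' t' :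
    (l1, m1) <> (0, 0) -> wspace l1 m1 p -> wspace (- l1) (- m1) q ->
    (forall x y, ~ inZ ([lie p, q] - tor x y)) ->
    (forall beta, beta \in Gamma -> exists gamma x, gamma \in Gamma /\ [lie [lie p, q], xg beta] = x *: xg gamma) ->
    (forall beta, beta \in Gamma -> [lie [lie p, q], xg beta] = 0 -> [lie tor s t, xg beta] = 0) ->
  R (tor s t) (tor' s' t') -> s' = 0 \/ t' = 0.
Proof.
move=> lm1 pW qW fspan fmono fkill Rst.
have nlm1 : (- l1, - m1) <> (0, 0).
  by move=> [/eqP + /eqP]; rewrite !oppr_eq0 => /eqP l10 /eqP m10; apply: lm1; rewrite l10 m10.
have [p0 Rp0] := corr_dom Rcorr (wspace_inD sigG lm1 pW).
have [q0 Rq0] := corr_dom Rcorr (wspace_inD sigG nlm1 qW).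
have [p' Rp p'W] := corr_wspace GammaA GammaA' Rcorr RX RY lm1 Rp0 pW.
have [q' Rq q'W] := corr_wspace GammaA GammaA' Rcorr RX RY nlm1 Rq0 qW.
rewrite (wlmN a b c e l1 m1).1 (wlmN a b c e l1 m1).2 in q'W.
have Rf := corr_lie Rcorr Rp Rq; have f0' := wspace_opp_lie p'W q'W.
have f0 := wspace_opp_lie pW qW.
move: {p q pW qW p0 Rp0 q0 Rq0 Rp Rq}[lie p, q] [lie p', q'] Rf f0 f0' fspan fmono fkill.
move=> f f' Rf f0 f0' fspan fmono fkill.
pose D1 := xg' sig * d' p1 f'; pose D3 := f' + d' p3 f'.
(* Multiplication by the combination of [D1] and [D3] sends [xg' beta'] to a
   multiple of a monomial, as its preimage does. *)
have main beta' : beta' \in Gamma' -> (beta' 0 p2, beta' 0 p4) <> (0, 0) ->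
    exists delta y, [/\ delta \in Gamma', beta' 0 p2 *: D1 + beta' 0 p4 *: D3 = y *: xg' delta
      & y = 0 -> - s' * beta' 0 p2 + t' * beta' 0 p4 = 0].
  move=> bG' b0'; have [be [k [bG k0 Rb b0]]] := corr_mon_inv bG' b0'.
  have b'W := @wspace_xg F Gamma' J' beta'; have bW := @wspace_xg F Gamma J be.
  have E' := lie_wspace0 f0' b'W; rewrite -/D1 -/D3 in E'.
  have RE := corr_lie Rcorr Rf Rb; rewrite lieZr E' in RE.
  set M := (_ + _) in E' RE *.
  have M0W : wspace' 0 0 M := wspace_mult _ _ f0'.
  have MW : wspace' (beta' 0 p2) (beta' 0 p4) (M * xg' beta').
    by have := wspaceM M0W b'W; rewrite !add0r.
  have [ga [x [gG Ex]]] := fmono be bG.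
  have [x0|x0] := eqVneq x 0.
    exists 0, 0; rewrite scale0r rpred0; split=> //.
      rewrite Ex x0 scale0r scaler0 in RE.
      have : inZ (M * xg' beta') by apply/(corr_inZ Rcorr RE); apply: inZ0.
      move/(wspaceZ0 b0' MW)/(xu_mul_eq0 char0) => [//|/eqP].
      by rewrite (negPf (xg_neq0 J' bG')).
    have hk : [lie tor s t, xg be] = 0 by apply: fkill => //; rewrite Ex x0 scale0r.
    move=> _; have := corr_lie Rcorr Rst Rb; rewrite lieZr hk scaler0.
    rewrite lie_tor // !xu_dE0 !scalerA -scalerDl => H.
    have : inZ ((- s' * beta' 0 p2 + t' * beta' 0 p4) *: xg' beta').
      by apply/(corr_inZ Rcorr H); apply: inZ0.
    move/(wspaceZ0 b0' (wspaceZ _ b'W))/eqP; rewrite scaler_eq0 (negPf (xg_neq0 J' bG')) orbF.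
    by move/eqP.
  have xgW : wspace (be 0 p2) (be 0 p4) (xg ga).
    have := wspace_lie f0 bW; rewrite !add0r Ex => /(wspaceZ x^-1).
    by rewrite scalerA (mulVf x0) scale1r.
  have [e2 e4] := wspace_xg_neq0 gG xgW; rewrite e2 e4 in b0.
  have [ga' [k' [gG' k'0 Rg _ _]]] := corr_mon char0 GammaA GammaA' Rcorr RX RY gG b0.
  have RE2 := corrZ Rcorr k (corrZ Rcorr x Rg); rewrite -Ex in RE2.
  have uZ := corr_uniq Rcorr RE RE2.
  have ee : M * xg' beta' = k *: (x *: (k' *: xg' ga')).
    apply/eqP; rewrite -subr_eq0; apply/eqP.
    apply: xcoeffP => al i aG iJ; rewrite [RHS]linear0.
    have [/eqP a2|a2] := eqVneq (al 0 p2, al 0 p4) (0, 0); last first.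
      have na : al <> sig1 by move=> Ea; rewrite Ea !sigma1E eqxx in a2.
      have [z zE] := uZ; rewrite zE linearZ /=.
      have [sG|sG] := boolP (sig1 \in Gamma'); last by rewrite xmon_outl // linear0 mulr0.
      by rewrite xcoeff_mon ?jset0 // (introF eqP na) mulr0.
    have [sE|sE] := eqVneq ga' sig1.
      exfalso; move: Rg; rewrite sE => Rg.
      have : inZ (xg ga) by apply/(corr_inZ Rcorr Rg); exists k'.
      have gW := @wspace_xg F Gamma J ga.
      by move/(wspaceZ0 b0 gW)/eqP; rewrite (negPf (xg_neq0 J gG)).
    have [z zE] := uZ.
    have [/eqP aE|an] := eqVneq al sig1; last first.
      rewrite zE linearZ /=.
      have [sG|sG] := boolP (sig1 \in Gamma'); last by rewrite xmon_outl // linear0 mulr0.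
      by rewrite xcoeff_mon ?jset0 // (negPf an) mulr0.
    rewrite linearB !linearZ /= (xcoeff_mon _ _ gG' (jset0 J')) (eqP aE) eq_sym (negPf sE) !mulr0 subr0.
    apply/eqP/negP => /negP c0; have [W2 W4] := MW.
    have [q2 _] := eig_supp char0 W2 c0; have [q4 _] := eig_supp char0 W4 c0.
    by apply: b0'; rewrite -q2 -q4 !sigma1E.
  exists (ga' - beta'), (k * x * k'); split; first by rewrite rpredB.
    have -> : M = M * xg' beta' * xg' (- beta') by rewrite -mulrA xgV // mulr1.
    by rewrite ee !scalerA -scalerAl xgM // rpredN.
  by move/eqP; rewrite !mulf_eq0 (negPf k0) (negPf x0) (negPf k'0).
have [s0|s0] := eqVneq s' 0; [by left|right]; apply/eqP/negP => /negP t0.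
have [n n0 nG] := axis_exists GammaA' p2; have [m m0 mG] := axis_exists GammaA' p4.
have [|d1 [y1 [dG1 E1 K1]]] := main _ nG.
  by rewrite !singleE /= => -[/eqP]; rewrite (negPf n0).
have [|d3 [y3 [dG3 E3 K3]]] := main _ mG.
  by rewrite !singleE /= => -[/eqP]; rewrite (negPf m0).
have [|d13 [y13 [dG13 E13 _]]] := main _ (rpredD nG mG).
  by rewrite !coordE /= addr0 => -[/eqP]; rewrite (negPf n0).
rewrite !coordE /= ?add0r ?addr0 ?mulr0 ?scale0r ?add0r ?addr0 in E1 E3 E13 K1 K3.
have y10 : y1 != 0.
  by apply/eqP => /K1/eqP; rewrite ?addr0 mulf_eq0 oppr_eq0 (negPf s0) (negPf n0).
have y30 : y3 != 0.
  by apply/eqP => /K3/eqP; rewrite ?add0r mulf_eq0 (negPf t0) (negPf m0).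
rewrite E1 E3 in E13.
have dd := xg_add_mono dG1 dG3 dG13 y10 y30 E13; subst d3.
have F1 : d' p1 f' = (n^-1 * y1) *: xg' (d1 - sig).
  apply: (xu_mulI char0 (xg_neq0 J' sigG')); apply: (scalerI n0).
  by rewrite -/D1 E1 -scalerAr xgM ?rpredB // scalerA mulrA divff // mul1r addrC subrK.
have F3 : f' + d' p3 f' = (m^-1 * y3) *: xg' d1.
  by apply: (scalerI m0); rewrite -/D3 E3 scalerA mulrA divff // mul1r.
have ny1 : n^-1 * y1 != 0 by rewrite mulf_neq0 // invr_eq0.
have my3 : m^-1 * y3 != 0 by rewrite mulf_neq0 // invr_eq0.
(* Two expressions of the mixed derivative of [f' + d' p3 f']. *)
have comm : (n^-1 * y1 * d1 0 p3) *: xg' (d1 - sig) = (m^-1 * y3 * d1 0 p1) *: xg' d1.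
  have <- : d' p1 (f' + d' p3 f') = (m^-1 * y3 * d1 0 p1) *: xg' d1.
    by rewrite F3 xu_dZ xu_dE0 scalerA.
  rewrite xu_dD (xu_dC p1 p3) F1 xu_dZ xu_dE0 !coordE.
  by xu_ring Gamma' J'.
have dsG : d1 - sig \in Gamma' by rewrite rpredB.
have dn : d1 - sig <> d1.
  by move=> /rowP/(_ p1)/eqP; rewrite !coordE -subr_eq0 addrAC subrr add0r oppr_eq0 oner_eq0.
have dc3 : d1 0 p3 = 0.
  have [//|h] := eqVneq (d1 0 p3) 0.
  by exfalso; apply: dn; apply: xg_inj dsG dG1 _ _ comm; rewrite mulf_neq0.
have dc1 : d1 0 p1 = 0.
  have [//|h] := eqVneq (d1 0 p1) 0.
  by exfalso; apply: dn; apply: esym; apply: xg_inj dG1 dsG _ _ (esym comm); rewrite mulf_neq0.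
have d1W : wspace' 0 0 (xg' d1).
  have : wspace' 0 0 (f' + d' p3 f') by apply: wspaceD => //; apply: wspace_d.
  by rewrite F3 => /(wspaceZ (m^-1 * y3)^-1); rewrite scalerA mulVf // scale1r.
have dz : d1 = 0.
  have [d2 d4] := d1W; rewrite !xu_dE0 scale0r in d2 d4.
  move/eqP: d2; rewrite scaler_eq0 (negPf (xg_neq0 J' dG1)) orbF => /eqP d2.
  move/eqP: d4; rewrite scaler_eq0 (negPf (xg_neq0 J' dG1)) orbF => /eqP d4.
  by apply: rV4P; rewrite rv0.
rewrite dz sub0r in F1; rewrite dz xg0 in F3.
have fZ := span_of_gradient char0 f0' F1 F3.
set y := n^-1 * y1 in fZ; set y' := m^-1 * y3 in fZ.
pose x1 := (e * - y - c * y') / (a * e - b * c); pose x2 := (a * y' - b * - y) / (a * e - b * c).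
apply: (fspan x1 x2).
have Rt := corr_tor_gen Rcorr RX RY x1 x2.
apply/(corr_inZ Rcorr (corrB Rcorr Rf Rt)).
have -> : x1 * a + x2 * c = - y by rewrite /x1 /x2; field.
have -> : x1 * b + x2 * e = y' by rewrite /x1 /x2; field.
suff -> : f' - tor' (- y) y' = f' + y *: xg' (- sig) - y'%:A by [].
by rewrite /torelt; xu_ring Gamma' J'.
Qed.

Lemma xg_not_span gamma : gamma \in Gamma -> gamma <> 0 -> gamma <> - sig -> gamma <> sig1 ->
  forall x y, ~ inZ (xg gamma - tor x y).
Proof.
move=> gG g0 gs g1 x y /(xcoeff_inZ g1) /eqP.
rewrite linearB linearD !linearZ /= -(xg0 Gamma J) xcoeff_xg // xcoeff_xg ?rpredN //.
rewrite xcoeff_xg ?rpred0 // eqxx (introF eqP g0) (introF eqP gs) !mulr0 addr0 subr0.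
by rewrite oner_eq0.
Qed.

(** [corr_line] applies to the monomial [y_[3]], whose bracket with a
    monomial vanishes iff the one of [1] does, and to the monomial [x_[1] -
    sigma], which has the same property with respect to [X]. *)
Lemma corr_lines : (b = 0 /\ c = 0) \/ (a = 0 /\ e = 0).
Proof.
have [x [x0 xG] [xx _ _]] := good_axis char0 GammaA p1.
have [y [y0 yG] [yy _ _]] := good_axis char0 GammaA p3.
have sq1 (z : F) : z * z != 1 -> z != 1 /\ z != - 1.
  by move=> z1; split; apply: contraNneq z1 => ->; rewrite ?mulrNN mulr1.
have [x1 _] := sq1 x xx; have [_ y1] := sq1 y yy.
have y1' : y + 1 != 0 by rewrite addr_eq0.
have [n n0 nG] := axis_exists GammaA p2; have [m m0 mG] := axis_exists GammaA p4.
have nW := @wspace_xg F Gamma J (single n p2).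
have mW := @wspace_xg F Gamma J (single m p4).
rewrite !singleE /= in nW mW.
have ce : c = 0 \/ e = 0.
  have yGb : single y p3 - sig - single n p2 \in Gamma by rewrite !rpredB.
  have qW := @wspace_xg F Gamma J (single y p3 - sig - single n p2).
  rewrite !coordE /= !oppr0 !addr0 add0r in qW.
  have fE : [lie n^-1 *: xg (single n p2), xg (single y p3 - sig - single n p2)] = xg (single y p3).
    rewrite lieZl lie_xg // !coordE /= !(oppr0, add0r, addr0, mulr0, mul0r, subr0, sub0r, mulN1r, opprK).
    rewrite scale0r addr0 scalerA mulVf // scale1r; congr (xmon _ _ _ _).
    by rewrite [X in X + _]addrC !subrK.
  apply: (@corr_line n 0 (n^-1 *: xg (single n p2)) (xg (single y p3 - sig - single n p2)) 0 1) RY.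
  - by move=> [/eqP]; rewrite (negPf n0).
  - exact: wspaceZ.
  - by rewrite oppr0.
  - rewrite fE; apply: xg_not_span => //; move/rowP=> E.
    + by have := E p3; rewrite rv0 !coordE /= => y00; rewrite y00 eqxx in y0.
    + by have := E p1; rewrite !coordE /= => /eqP; rewrite eq_sym oppr_eq0 oner_eq0.
    + by have := E p3; rewrite !coordE /= => y00; rewrite y00 eqxx in y1.
  - move=> be bG; rewrite fE lie_xg // !coordE /= !(mul0r, mulr0, subr0) scale0r add0r.
    by exists (single y p3 + be), ((y + 1) * be 0 p4); rewrite rpredD.
  move=> be bG; rewrite fE lie_xg // !coordE /= !(mul0r, mulr0, subr0) scale0r add0r.
  move/eqP; rewrite scaler_eq0 (negPf (xg_neq0 J (rpredD yG bG))) orbF mulf_eq0 (negPf y1') /= => /eqP b4.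
  by rewrite lie_tor // !xu_dE0 b4 oppr0 !scale0r ?scaler0 addr0.
have ab : a = 0 \/ b = 0.
  have xGb : single x p1 - sig - single m p4 \in Gamma by rewrite !rpredB.
  have qW := @wspace_xg F Gamma J (single x p1 - sig - single m p4).
  rewrite !coordE /= !oppr0 !addr0 add0r in qW.
  have xsG : single x p1 - sig \in Gamma by rewrite rpredB.
  have fE : [lie (- m^-1) *: xg (single m p4), xg (single x p1 - sig - single m p4)] = xg (single x p1 - sig).
    rewrite lieZl lie_xg // !coordE /= !(oppr0, add0r, addr0, mulr0, mul0r, subr0, sub0r, mul1r, addNr).
    by rewrite scale0r add0r scalerA mulrNN mulVf // scale1r [X in xmon _ _ X]addrC subrK.
  apply: (@corr_line 0 m ((- m^-1) *: xg (single m p4)) (xg (single x p1 - sig - single m p4)) 1 0) RX.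
  - by move=> [/eqP]; rewrite (negPf m0).
  - exact: wspaceZ.
  - by rewrite oppr0.
  - rewrite fE; apply: xg_not_span => //; move/rowP=> E.
    + by have := E p3; rewrite rv0 !coordE /= sub0r => /eqP; rewrite oppr_eq0 oner_eq0.
    + have := E p1; rewrite !coordE /= => /eqP; rewrite subr_eq addNr => /eqP x00.
      by rewrite x00 eqxx in x0.
    + have := E p1; rewrite !coordE /= => /eqP; rewrite subr_eq0 => /eqP x11.
      by rewrite x11 eqxx in x1.
  - move=> be bG; rewrite fE lie_xg // !coordE /= !(mul0r, mulr0, subr0, sub0r, addNr, oppr0) scale0r addr0.
    exists (single x p1 - sig + be + sig), ((x - 1) * be 0 p2); split=> //.
    by rewrite !rpredD // rpredN.
  move=> be bG; rewrite fE lie_xg // !coordE /= !(mul0r, mulr0, subr0, sub0r, addNr, oppr0) scale0r addr0.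
  have gG : single x p1 - sig + be + sig \in Gamma by rewrite !rpredD // rpredN.
  move/eqP; rewrite scaler_eq0 (negPf (xg_neq0 J gG)) orbF mulf_eq0 subr_eq0 (negPf x1) /= => /eqP b2.
  by rewrite lie_tor // !xu_dE0 b2 !scale0r ?scaler0 addr0.
case: ab ce => [a0|b0] [c0|e0]; [|by right|by left|].
- by move: D0; rewrite a0 c0 !(mul0r, mulr0) subrr eqxx.
- by move: D0; rewrite b0 e0 !(mul0r, mulr0) subrr eqxx.
Qed.
End Lines.

(** * The action on exponents *)

Section Diagonal.
Context (F : closedFieldType) (char0 : [pchar F] =i pred0).
Context (Gamma Gamma' : zmodClosed 'rV[F]_4) (J J' : jtype).
Local Notation A := (xu_A4 Gamma J).
Local Notation A' := (xu_A4 Gamma' J').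
Local Notation xg alpha := (xmon Gamma J alpha 0).
Local Notation xg' alpha := (xmon Gamma' J' alpha 0).
Local Notation sig := (sigma F).
Local Notation sig1 := (sigma1 F).
Local Notation tor := (@torelt F Gamma J).
Local Notation tor' := (@torelt F Gamma' J').
Implicit Types (alpha beta gamma : 'rV[F]_4).
Hypothesis GammaA : conditionA Gamma.
Hypothesis GammaA' : conditionA Gamma'.
Let sigG : sig \in Gamma. Proof. by case: GammaA. Qed.
Let sigG' : sig \in Gamma'. Proof. by case: GammaA'. Qed.
Variable R : A -> A' -> Prop.
Hypothesis Rcorr : xu_corr R.
Variables (a e : F).
Hypothesis RX : R (tor 1 0) (tor' a 0).
Hypothesis RY : R (tor 0 1) (tor' 0 e).

Let D0 : a * e - 0 * 0 != 0. Proof. exact: (corr_det GammaA Rcorr RX RY). Qed.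
Lemma diag_a0 : a != 0.
Proof. by apply: contraNneq D0 => ->; rewrite !mul0r subrr. Qed.
Lemma diag_e0 : e != 0.
Proof. by apply: contraNneq D0 => ->; rewrite mulr0 mul0r subrr. Qed.
Let a0 := diag_a0.
Let e0 := diag_e0.

Definition monR alpha alpha' (k : F) := [/\ alpha \in Gamma, alpha' \in Gamma', k != 0
  & R (xg alpha) (k *: xg' alpha')].

Lemma monR_weight alpha alpha' k : monR alpha alpha' k -> (alpha 0 p2, alpha 0 p4) <> (0, 0) ->
  alpha 0 p2 = a * alpha' 0 p2 /\ alpha 0 p4 = e * alpha' 0 p4.
Proof.
move=> [aG aG' k0 Rk] lm0.
have nZ : ~ inZ (k *: xg' alpha').
  move/(corr_inZ Rcorr Rk)/(wspaceZ0 lm0 (@wspace_xg F Gamma J alpha)).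
  by move/eqP; rewrite (negPf (xg_neq0 J aG)).
have key x : inZ (x *: (k *: xg' alpha')) -> x = 0.
  have [//|x0] := eqVneq x 0 => /(inZZ x^-1); rewrite (scalerK x0) => H.
  by case: nZ.
have H2 := corrD Rcorr (corr_lie Rcorr RX Rk) (corrZ Rcorr (alpha 0 p2) Rk).
have H4 := corrB Rcorr (corr_lie Rcorr RY Rk) (corrZ Rcorr (alpha 0 p4) Rk).
rewrite !lie_tor // !xu_dZ !xu_dE0 !scale0r addr0 scaleN1r addNr in H2.
rewrite !lie_tor // !xu_dZ !xu_dE0 oppr0 !scale0r add0r scale1r subrr in H4.
split; apply/eqP; rewrite -subr_eq0; apply/eqP; apply: key.
  have /(corr_inZ Rcorr H2) : inZ (0 : A) by apply: inZ0.
  suff -> : - a *: (k *: (alpha' 0 p2 *: xg' alpha')) + 0 + alpha 0 p2 *: (k *: xg' alpha')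
    = (alpha 0 p2 - a * alpha' 0 p2) *: (k *: xg' alpha') by [].
  by xu_ring Gamma' J'.
have /(corr_inZ Rcorr H4) : inZ (0 : A) by apply: inZ0.
move/inZN; suff -> : - (0 + e *: (k *: (alpha' 0 p4 *: xg' alpha')) - alpha 0 p4 *: (k *: xg' alpha'))
  = (alpha 0 p4 - e * alpha' 0 p4) *: (k *: xg' alpha') by [].
by xu_ring Gamma' J'.
Qed.

Lemma monR_exists alpha : alpha \in Gamma -> (alpha 0 p2, alpha 0 p4) <> (0, 0) ->
  exists alpha' k, monR alpha alpha' k.
Proof.
move=> aG lm0; have [al [k [aG' k0 Rk _ _]]] := corr_mon char0 GammaA GammaA' Rcorr RX RY aG lm0.
by exists al, k.
Qed.

Lemma monR_weight2 alpha alpha' k : monR alpha alpha' k -> alpha 0 p2 != 0 -> 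
  alpha 0 p2 = a * alpha' 0 p2 /\ alpha 0 p4 = e * alpha' 0 p4.
Proof. by move=> H l0; apply: (monR_weight H) => -[/eqP]; rewrite (negPf l0). Qed.

Lemma weight2_neq0 alpha : alpha 0 p2 != 0 -> (alpha 0 p2, alpha 0 p4) <> (0, 0).
Proof. by move=> l0 [/eqP]; rewrite (negPf l0). Qed.

(** A bracket with [x_[1] - sigma] shifts the first exponent by [x]. Its
    image is a multiple of a monomial with the same behaviour, which shifts
    the exponent by some [x'_[1]] on the other side. *)
Lemma corr_shift x : single x p1 \in Gamma -> x != 0 -> x != 1 ->
  exists x' kappa, [/\ single x' p1 \in Gamma', x' != 0 &
    forall beta beta' k, beta 0 p2 != 0 -> monR beta beta' k ->
      monR (beta + single x p1) (beta' + single x' p1) (kappa * k)].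
Proof.
move=> xG x0 x1.
have [m m0 mG] := axis_exists GammaA p4.
have mw : (single m p4 0 p2, single m p4 0 p4) <> (0, 0).
  by rewrite !singleE /= => -[/eqP]; rewrite (negPf m0).
have rG : single x p1 - sig - single m p4 \in Gamma by rewrite !rpredB.
have rw : ((single x p1 - sig - single m p4) 0 p2, (single x p1 - sig - single m p4) 0 p4) <> (0, 0).
  by rewrite !coordE /= oppr0 !addr0 add0r => -[/eqP]; rewrite oppr_eq0 (negPf m0).
have [mu [km Hm]] := monR_exists mG mw; have [rho [kr Hr]] := monR_exists rG rw.
have [mu2 mu4] := monR_weight Hm mw; have [rho2 rho4] := monR_weight Hr rw.
have [_ mG' km0 Rm] := Hm; have [_ rG' kr0 Rr] := Hr.
rewrite !coordE /= ?oppr0 ?addr0 ?add0r in mu2 mu4 rho2 rho4.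
have {}mu2 : mu 0 p2 = 0 by apply/eqP; move/eqP: mu2; rewrite eq_sym mulf_eq0 (negPf a0).
have {}rho2 : rho 0 p2 = 0 by apply/eqP; move/eqP: rho2; rewrite eq_sym mulf_eq0 (negPf a0).
have rm4 : rho 0 p4 = - mu 0 p4.
  by apply: (mulfI e0); rewrite -rho4 mulrN -mu4.
have mu40 : mu 0 p4 != 0 by apply: contraNneq m0 => E; rewrite mu4 E mulr0.
pose f := xg (single x p1 - sig).
have fG : single x p1 - sig \in Gamma by rewrite rpredB.
have fE : [lie xg (single m p4), xg (single x p1 - sig - single m p4)] = (- m) *: f.
  rewrite lie_xg // !coordE /= !(oppr0, add0r, addr0, mulr0, mul0r, subr0, sub0r, mul1r, addNr).
  by rewrite scale0r add0r /f [X in xmon _ _ X]addrC subrK.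
have [y Rf] : exists y, R f (y *: xg' (mu + rho)).
  have := corrZ Rcorr (- m)^-1 (corr_lie Rcorr Rm Rr).
  rewrite fE scalerA mulVf ?oppr_eq0 // scale1r lieZl lieZr lie_xg //.
  rewrite mu2 rho2 !mulr0 subrr scale0r add0r !scalerA => H.
  by eexists; exact: H.
set gam := mu + rho in Rf.
have gG' : gam \in Gamma' by rewrite rpredD.
have g2 : gam 0 p2 = 0 by rewrite rvD mu2 rho2 addr0.
have g4 : gam 0 p4 = 0 by rewrite rvD rm4 subrr.
clearbody gam.
have y0 : y != 0.
  apply/eqP=> y0; move: Rf; rewrite y0 scale0r => Rf.
  have fZ : inZ f by apply/(corr_inZ Rcorr Rf); apply: inZ0.
  have nz : single x p1 - sig <> sig1.
    by move/rowP/(_ p1)/eqP; rewrite !coordE /= subr_eq0 (negPf x1).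
  by have /eqP := xcoeff_inZ nz fZ; rewrite xcoeff_xg // eqxx oner_eq0.
have g3 : gam 0 p3 = - 1.
  have H := corr_lie Rcorr Rf Rm.
  have E0 : [lie f, xg (single m p4)] = 0.
    rewrite /f lie_xg // !coordE /= !(oppr0, add0r, addr0, mulr0, mul0r, subr0, addNr, subrr).
    by rewrite !scale0r addr0.
  rewrite E0 lieZl lieZr lie_xg // g2 mu2 g4 !(mulr0, subr0) scale0r add0r in H.
  have : inZ (y *: (km *: (((gam 0 p3 + 1) * mu 0 p4) *: xg' (gam + mu)))).
    by apply/(corr_inZ Rcorr H); apply: inZ0.
  have nz : (gam + mu) <> sig1 by apply: (@neq_sigma1 F _ p4); [right|rewrite rvD g4 add0r].
  move/(xcoeff_inZ nz)/eqP; rewrite !linearZ /= xcoeff_xg ?rpredD // eqxx mulr1.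
  rewrite !mulf_eq0 (negPf y0) (negPf km0) (negPf mu40) orbF /= => /eqP E.
  by apply/eqP; rewrite -addr_eq0 E.
pose x' := gam 0 p1 + 1.
have xE' : single x' p1 = gam + sig.
  by apply: rV4P; rewrite !coordE /= ?g2 ?g3 ?g4 ?addr0 ?addNr.
have xG' : single x' p1 \in Gamma' by rewrite xE' rpredD.
pose kap := y * gam 0 p1 / ((x - 1) * a).
have shift beta beta' k : beta 0 p2 != 0 -> monR beta beta' k ->
    R (xg (beta + single x p1)) ((kap * k) *: xg' (beta' + single x' p1)).
  move=> b0 H; have [b2 _] := monR_weight2 H b0; have [bG bG' k0 Rk] := H.
  have := corr_lie Rcorr Rf Rk.
  rewrite lieZl lieZr !lie_xg // !coordE /= g2 g3 g4 addNr.
  rewrite !(oppr0, add0r, addr0, mulr0, mul0r, subr0, addNr, subrr) !scale0r !addr0.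
  have -> : single x p1 - sig + beta + sig = beta + single x p1 by rewrite addrAC subrK addrC.
  have -> : gam + beta' + sig = beta' + single x' p1 by rewrite xE' addrAC addrC.
  move=> H1; have := corrZ Rcorr ((x - 1) * beta 0 p2)^-1 H1.
  have xb : (x - 1) * beta 0 p2 != 0 by rewrite mulf_neq0 // subr_eq0.
  have b0' : beta' 0 p2 != 0 by apply: contraNneq b0; rewrite b2 => ->; rewrite mulr0.
  rewrite [X in R X _]scalerA (mulVf xb) scale1r.
  have -> // : (kap * k) *: xg' (beta' + single x' p1) = ((x - 1) * beta 0 p2)^-1 *:
     (y *: (k *: ((gam 0 p1 * beta' 0 p2) *: xg' (beta' + single x' p1)))).
  rewrite !scalerA; congr (_ *: _); rewrite /kap b2; field.
  by rewrite b0' a0 /= subr_eq0.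
have [n n0 nG] := axis_exists GammaA p2.
have nw : single n p2 0 p2 != 0 by rewrite singleE.
have [nu [kn Hn]] := monR_exists nG (weight2_neq0 nw).
have nxw : ((single n p2 + single x p1) 0 p2, (single n p2 + single x p1) 0 p4) <> (0, 0).
  by rewrite !coordE /= addr0 => -[/eqP]; rewrite (negPf n0).
have kap0 : kap != 0.
  apply/eqP=> kap0; have := shift _ _ _ nw Hn; rewrite kap0 mul0r scale0r => H.
  have : inZ (xg (single n p2 + single x p1)) by apply/(corr_inZ Rcorr H); apply: inZ0.
  move/(wspaceZ0 nxw (@wspace_xg _ _ _ _)) /eqP.
  by rewrite (negPf (xg_neq0 J (rpredD nG xG))).
exists x', kap; split=> //.
  apply/eqP=> x'0; have := shift _ _ _ nw Hn; rewrite x'0.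
  have -> : single (0 : F) p1 = 0 by apply/rowP=> q; rewrite !mxE if_same.
  rewrite addr0 => H; have [_ _ _ Rn] := Hn.
  have := corrB Rcorr H (corrZ Rcorr kap Rn); rewrite scalerA subrr => H0.
  have : inZ (xg (single n p2 + single x p1) - kap *: xg (single n p2)).
    by apply/(corr_inZ Rcorr H0); apply: inZ0.
  have nz : single n p2 + single x p1 <> sig1.
    by apply: (@neq_sigma1 F _ p2); [left|rewrite !coordE /= addr0].
  move/(xcoeff_inZ nz)/eqP; rewrite linearB linearZ /= !xcoeff_xg ?rpredD // eqxx.
  case: (single n p2 + single x p1 =P single n p2) => [/rowP/(_ p1)/eqP|_].
    by rewrite !coordE /= add0r (negPf x0).
  by rewrite mulr0 subr0 oner_eq0.
move=> be be' k b0 H; have [bG bG' k0 _] := H; split; [by rewrite rpredD|by rewrite rpredD|by rewrite mulf_neq0|exact: shift b0 H].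
Qed.

(** In the bracket of the monomials [alpha] and [beta] only the coefficient
    of [alpha + beta + sigma] changes, by a multiple of [x], when [alpha] is
    shifted by [x_[1]]. The same holds on the other side, so the difference
    of the two brackets identifies the image of [alpha + beta + sigma], and
    then the coefficients of this monomial can be compared. *)
Lemma corr_pair x x' kappa alpha alpha' k1 beta beta' k2 :
    single x p1 \in Gamma -> x != 0 -> single x' p1 \in Gamma' -> x' != 0 ->
    (forall beta beta' k, beta 0 p2 != 0 -> monR beta beta' k ->
      monR (beta + single x p1) (beta' + single x' p1) (kappa * k)) ->
    monR alpha alpha' k1 -> monR beta beta' k2 ->
    alpha 0 p2 != 0 -> beta 0 p2 != 0 -> alpha 0 p2 + beta 0 p2 != 0 ->
  monR (alpha + beta + sig) (alpha' + beta' + sig) (k1 * k2 * x' / (x * a)) /\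
  alpha' 0 p1 * beta 0 p2 - beta' 0 p1 * alpha 0 p2
    = x' / x * (alpha 0 p1 * beta 0 p2 - beta 0 p1 * alpha 0 p2).
Proof.
move=> xG x0 xG' x'0 shift Ha Hb al20 be20 ab20.
have abw : (alpha + beta) 0 p2 != 0 by rewrite rvD.
have absw : (alpha + beta + sig) 0 p2 != 0 by rewrite !coordE addr0.
have [aG aG' k10 Ra] := Ha; have [bG bG' k20 Rb] := Hb.
have abG : alpha + beta \in Gamma by rewrite rpredD.
have absG : alpha + beta + sig \in Gamma by rewrite rpredD.
have [v1 [K1 H1]] := monR_exists absG (weight2_neq0 absw).
have [v2 [K2 H2]] := monR_exists abG (weight2_neq0 abw).
have [a2 _] := monR_weight2 Ha al20; have [b2 _] := monR_weight2 Hb be20.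
have [_ v1G K10 R1] := H1; have [_ v2G K20 R2] := H2.
have [Sa Sb] := (shift _ _ _ al20 Ha, shift _ _ _ be20 Hb).
have S1 := shift _ _ _ absw H1; have S2 := shift _ _ _ abw H2.
have [asG asG' kk1 Rsa] := Sa.
have kap0 : kappa != 0 by apply: contraNneq kk1 => ->; rewrite mul0r.
have s0 : single x p1 0 p2 = 0 by rewrite singleE.
have s0' : single x' p1 0 p2 = 0 by rewrite singleE.
(* The coefficients of the two brackets, by [lie_xg]. *)
pose p := alpha 0 p1 * beta 0 p2 - beta 0 p1 * alpha 0 p2.
pose q := (alpha 0 p3 + 1) * beta 0 p4 - (beta 0 p3 + 1) * alpha 0 p4.
pose p' := alpha' 0 p1 * beta' 0 p2 - beta' 0 p1 * alpha' 0 p2.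
pose q' := (alpha' 0 p3 + 1) * beta' 0 p4 - (beta' 0 p3 + 1) * alpha' 0 p4.
set s := alpha' + beta'.
have sG : s \in Gamma' by rewrite rpredD.
have nz gamma : gamma 0 p2 != 0 -> gamma <> sig1 by move=> g2; apply: (@neq_sigma1 F _ p2); [left|].
have E0 gamma : gamma 0 p2 != 0 ->
    k1 * k2 * (p' * (gamma == s + sig)%:R + q' * (gamma == s)%:R)
    = p * (K1 * (gamma == v1)%:R) + q * (K2 * (gamma == v2)%:R).
  move=> g2; have B := corr_lie Rcorr Ra Rb; rewrite lieZl lieZr !lie_xg // in B.
  have := corr_uniq Rcorr B (corrP Rcorr p R1 (corrZ Rcorr q R2)).
  move/(xcoeff_inZ (nz _ g2))/eqP; rewrite linearB subr_eq0 => /eqP.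
  rewrite !(linearD, linearZ) /= !xcoeff_xg ?rpredD // => E; rewrite -E -/s.
  by rewrite -/p' -/q' mulrA.
have E1 gamma : gamma 0 p2 != 0 ->
    kappa * (k1 * k2) * ((p' + x' * beta' 0 p2) * (gamma == s + sig)%:R + q' * (gamma == s)%:R)
    = kappa * ((p + x * beta 0 p2) * (K1 * (gamma == v1)%:R) + q * (K2 * (gamma == v2)%:R)).
  move=> g2; have B := corr_lie Rcorr Rsa Rb; rewrite lieZl lieZr !lie_xg // in B.
  have g2' : (gamma + single x' p1) 0 p2 != 0 by rewrite rvD s0' addr0.
  have [_ _ _ R1s] := S1; have [_ _ _ R2s] := S2.
  have r (V : zmodType) (t1 t2 t3 t4 : V) : t1 + t2 + t3 + t4 = t1 + t3 + t4 + t2.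
    by rewrite (addrAC t1) (addrAC _ t2).
  rewrite !rvD !singleE /= !addr0 !(r _ _ (single _ _)) !(addrAC _ (single _ _) beta) !(addrAC _ (single _ _) beta') in B.
  have cE : (alpha 0 p1 + x) * beta 0 p2 - beta 0 p1 * alpha 0 p2 = p + x * beta 0 p2 by rewrite /p; ring.
  rewrite cE in B.
  have := corr_uniq Rcorr B (corrP Rcorr (p + x * beta 0 p2) R1s (corrZ Rcorr q R2s)).
  move/(xcoeff_inZ (nz _ g2'))/eqP; rewrite linearB subr_eq0 => /eqP.
  rewrite !(linearD, linearZ) /= !xcoeff_xg ?rpredD // !(inj_eq (addIr (single x' p1))) => E.
  transitivity (k2 * (kappa * k1 * (((alpha' 0 p1 + x') * beta' 0 p2 - beta' 0 p1 * alpha' 0 p2) * (gamma == s + sig)%:R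
      + q' * (gamma == s)%:R))); first by rewrite /p'; ring.
  transitivity ((p + x * beta 0 p2) * (kappa * K1 * (gamma == v1)%:R) + q * (kappa * K2 * (gamma == v2)%:R)); last by ring.
  by rewrite -E -/s -/q'; ring.
(* The difference of [E1] and [E0]. *)
have E2 gamma : gamma 0 p2 != 0 ->
    k1 * k2 * (x' * beta' 0 p2) * (gamma == s + sig)%:R = x * beta 0 p2 * K1 * (gamma == v1)%:R.
  move=> g2; have h0 := E0 _ g2; have /(mulfI kap0) h1 : kappa * (k1 * k2 * ((p' + x' * beta' 0 p2) * (gamma == s + sig)%:R + q' * (gamma == s)%:R)) =
    kappa * ((p + x * beta 0 p2) * (K1 * (gamma == v1)%:R) + q * (K2 * (gamma == v2)%:R)).
    by rewrite -E1 // mulrA.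
  have : k1 * k2 * ((p' + x' * beta' 0 p2) * (gamma == s + sig)%:R + q' * (gamma == s)%:R)
      - k1 * k2 * (p' * (gamma == s + sig)%:R + q' * (gamma == s)%:R)
    = (p + x * beta 0 p2) * (K1 * (gamma == v1)%:R) + q * (K2 * (gamma == v2)%:R)
      - (p * (K1 * (gamma == v1)%:R) + q * (K2 * (gamma == v2)%:R)) by rewrite h0 h1.
  move=> E; transitivity (k1 * k2 * ((p' + x' * beta' 0 p2) * (gamma == s + sig)%:R + q' * (gamma == s)%:R)
      - k1 * k2 * (p' * (gamma == s + sig)%:R + q' * (gamma == s)%:R)); first by ring.
  by rewrite E; ring.
have be20' : beta' 0 p2 != 0 by apply: contraNneq be20; rewrite b2 => ->; rewrite mulr0.
have [v12 _] := monR_weight2 H1 absw; have [v22 _] := monR_weight2 H2 abw.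
have v1n0 : v1 0 p2 != 0 by apply: contraNneq absw; rewrite v12 => ->; rewrite mulr0.
have Kx : x * beta 0 p2 * K1 != 0 by rewrite !mulf_neq0.
have v1E : v1 = s + sig.
  have := E2 _ v1n0; rewrite eqxx mulr1; case: (v1 =P s + sig) => // _.
  by rewrite mulr0 => /esym/eqP; rewrite (negPf Kx).
have KE : k1 * k2 * x' / (x * a) = K1.
  have := E2 _ v1n0; rewrite v1E eqxx !mulr1 b2 => E.
  apply: (mulfI x0); apply: (mulfI a0); apply: (mulfI be20').
  transitivity (k1 * k2 * (x' * beta' 0 p2)); first by field; rewrite x0 a0.
  by rewrite E; ring.
split; first by rewrite KE -v1E.
have v12n : v1 <> v2.
  move=> v12'; move: H1 H2 => [_ _ _ R1'] [_ _ _ R2']; rewrite v12' in R1'.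
  have H := corrB Rcorr (corrZ Rcorr K1^-1 R1') (corrZ Rcorr K2^-1 R2').
  rewrite !scalerA !mulVf // subrr in H.
  have : inZ (K1^-1 *: xg (alpha + beta + sig) - K2^-1 *: xg (alpha + beta)).
    by apply/(corr_inZ Rcorr H); apply: inZ0.
  move/(xcoeff_inZ (nz _ absw))/eqP; rewrite linearB !linearZ /= !xcoeff_xg // eqxx.
  case: (alpha + beta + sig =P alpha + beta) => [/rowP/(_ p1)/eqP|_].
    by rewrite rvD -[X in _ == X]addr0 (inj_eq (addrI _)) sigmaE oner_eq0.
  by rewrite mulr0 subr0 mulr1 invr_eq0 (negPf K10).
have ns : (s + sig == s) = false.
  by rewrite -[X in _ == X]addr0 (inj_eq (addrI _)); apply/eqP=> /rowP/(_ p1)/eqP; rewrite rv0 sigmaE oner_eq0.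
have := E0 _ v1n0; rewrite (introF eqP v12n) v1E eqxx ns !mulr0 !addr0 !mulr1 -KE => E.
have k12 : k1 * k2 != 0 by rewrite mulf_neq0.
apply: (mulfI (invr_neq0 a0)); apply: (mulfI k12).
transitivity (k1 * k2 * p'); last by rewrite E -/p; field; rewrite x0 a0.
by rewrite /p' a2 b2; field.
Qed.

(** Comparing the first coordinates of the images of [n_[2]] and of
    [2 n_[2] + sigma] shows that the shift by [x] is the shift by [x' = x]. *)
Lemma corr_coord1 : exists a1 : F,
  (forall alpha alpha' k, monR alpha alpha' k -> alpha 0 p2 != 0 -> alpha' 0 p1 = alpha 0 p1 + a1 * alpha 0 p2) /\
  (forall alpha alpha' k, monR alpha alpha' k -> alpha 0 p2 != 0 -> 
     monR (alpha + alpha + sig) (alpha' + alpha' + sig) (k * k / a)).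
Proof.
have [x [x0 xG] [xx _ _]] := good_axis char0 GammaA p1.
have x1 : x != 1 by apply: contraNneq xx => ->; rewrite mulr1.
have [x' [kap [xG' x'0 shift]]] := corr_shift xG x0 x1.
have [n n0 nG] := axis_exists GammaA p2.
pose N := single n p2; have Nw : N 0 p2 != 0 by rewrite singleE.
have [N' [k HN]] := monR_exists nG (weight2_neq0 Nw).
have dbl y : y != 0 -> y + y != 0 :> F.
  by move=> y0; rewrite -mulr2n -mulr_natr mulf_neq0 // natf_eq0_char0.
have [H2 _] := corr_pair xG x0 xG' x'0 shift HN HN Nw Nw (dbl _ Nw).
pose M := N + N + sig.
have Mc : (M 0 p1 = 1) * (M 0 p2 = n + n).
  by rewrite /M !rvD !sigmaE !singleE /= !addr0 add0r.
have Nc : (N 0 p1 = 0) * (N 0 p2 = n) by rewrite /N !singleE.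
have Mw : M 0 p2 != 0 by rewrite Mc; apply: dbl.
have NM : N 0 p2 + M 0 p2 != 0.
  rewrite Mc Nc; have -> : n + (n + n) = n * 3%:R by rewrite !mulrS mulr0n; ring.
  by rewrite mulf_neq0 // natf_eq0_char0.
have [_] := corr_pair xG x0 xG' x'0 shift HN H2 Nw Mw NM.
rewrite !Mc !Nc !rvD sigmaE => E.
have xx' : x' = x.
  have : x' / x = 1.
    apply: (mulIf n0); apply: oppr_inj; rewrite mul1r.
    transitivity (x' / x * (0 * (n + n) - 1 * n)); first by ring.
    by rewrite -E; ring.
  by move/(congr1 (fun z => z * x)); rewrite divfK // mul1r.
rewrite xx' in shift xG' x'0 *.
exists (N' 0 p1 / n); split=> [al al' k' H al0|al al' k' H al0]; last first.
  have [] := corr_pair xG x0 xG' x'0 shift H H al0 al0 (dbl _ al0).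
  suff -> : k' * k' * x / (x * a) = k' * k' / a by [].
  by field; rewrite x0 a0.
have [s0|s0] := eqVneq (al 0 p2 + n) 0; last first.
  have [|_] := corr_pair xG x0 xG' x'0 shift H HN al0 Nw; first by rewrite Nc.
  rewrite divff // mul1r !Nc mul0r subr0 => E'.
  apply: (mulIf n0); rewrite mulrDl -E'; field; exact: n0.
have sM : al 0 p2 + M 0 p2 != 0 by rewrite Mc addrA s0 add0r.
have [_] := corr_pair xG x0 xG' x'0 shift H H2 al0 Mw sM.
rewrite divff // mul1r !Mc !rvD sigmaE => E'.
apply: (mulIf (dbl _ n0)).
transitivity (al' 0 p1 * (n + n) - (N' 0 p1 + N' 0 p1 + 1) * al 0 p2 + (N' 0 p1 + N' 0 p1 + 1) * al 0 p2); first by ring.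
by rewrite E'; field; exact: n0.
Qed.
End Diagonal.

Section Polynomial.
Context (F : closedFieldType) (char0 : [pchar F] =i pred0).
Context (Gamma Gamma' : zmodClosed 'rV[F]_4) (J J' : jtype).
Local Notation A := (xu_A4 Gamma J).
Local Notation A' := (xu_A4 Gamma' J').
Local Notation xg alpha := (xmon Gamma J alpha 0).
Local Notation xg' alpha := (xmon Gamma' J' alpha 0).
Local Notation d := (@xu_d F Gamma J).
Local Notation d' := (@xu_d F Gamma' J').
Local Notation sig := (sigma F).
Local Notation sig1 := (sigma1 F).
Local Notation wspace := (@wspace F Gamma J).
Local Notation tor := (@torelt F Gamma J).
Local Notation tor' := (@torelt F Gamma' J').
Implicit Types (alpha beta gamma : 'rV[F]_4).
Hypothesis GammaA : conditionA Gamma.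
Hypothesis GammaA' : conditionA Gamma'.
Let sigG : sig \in Gamma. Proof. by case: GammaA. Qed.
Let sigG' : sig \in Gamma'. Proof. by case: GammaA'. Qed.
Variable R : A -> A' -> Prop.
Hypothesis Rcorr : xu_corr R.
Variables (a e : F).
Hypothesis RX : R (tor 1 0) (tor' a 0).
Hypothesis RY : R (tor 0 1) (tor' 0 e).

Let a0 : a != 0. Proof. exact: (diag_a0 GammaA Rcorr RX RY). Qed.
Let e0 : e != 0. Proof. exact: (diag_e0 GammaA Rcorr RX RY). Qed.

(* The exponent of the variable [t_p], in the form in which [xcoeff_d] produces
   it. *)
Local Notation iota p := (0 + single 1%N p).

Lemma iota_jset (K : jtype) p : iota p \in jset K = K p.
Proof. by rewrite jsetD1 jset0. Qed.

Lemma d_iota p q alpha : J p ->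
  d q (xmon Gamma J alpha (iota p)) =
    alpha 0 q *: xmon Gamma J alpha (iota p) + (if q == p then xg alpha else 0).
Proof.
move=> Jp; rewrite xu_dE ?iota_jset // jincE mxE; congr (_ + _).
case: eqVneq => [->|_] /=; last by rewrite scale0r.
rewrite scale1r; congr xmon; apply/rowP=> r.
by rewrite jdecE jincE !mxE; case: eqP.
Qed.

Lemma xcoeff_d0 p alpha (u : A') : ~~ J' p ->
  xcoeff alpha 0 (d' p u) = alpha 0 p * xcoeff alpha 0 u.
Proof.
move=> Jp; rewrite xcoeff_d ?jset0 // (xcoeff_outr _ (i := iota p)) ?mulr0 ?addr0 //.
by rewrite iota_jset.
Qed.

(** These are the exponents on which the three lemmas below test the images
    of [x^N t_1] and [x^N t_2], for [N = n_[2]]. *)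
Lemma mon_n2 (a1 : F) :
    (forall alpha alpha' k, monR R alpha alpha' k -> alpha 0 p2 != 0 ->
      alpha' 0 p1 = alpha 0 p1 + a1 * alpha 0 p2) ->
    (forall alpha alpha' k, monR R alpha alpha' k -> alpha 0 p2 != 0 -> 
      monR R (alpha + alpha + sig) (alpha' + alpha' + sig) (k * k / a)) ->
  exists n N' k, [/\ n != 0, monR R (single n p2) N' k,
    [/\ n = a * N' 0 p2, N' 0 p4 = 0 & N' 0 p1 = a1 * n]
    & monR R (single n p2 + single n p2 + sig) (N' + N' + sig) (k * k / a)].
Proof.
move=> H1 H2; have [n n0 nG] := axis_exists GammaA p2.
have nw : single n p2 0 p2 != 0 by rewrite singleE.
have [N' [k HN]] := monR_exists char0 GammaA GammaA' Rcorr RX RY nG (weight2_neq0 nw).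
exists n, N', k; split=> //; last exact: H2 HN nw.
have [w2 w4] := monR_weight2 GammaA GammaA' Rcorr RX RY HN nw.
rewrite !singleE /= in w2 w4; split=> //.
  by apply: (mulfI e0); rewrite -w4 mulr0.
by rewrite (H1 _ _ _ HN nw) !singleE /= add0r.
Qed.

Section WithCoordinate.
Variables (a1 n : F) (N' : 'rV[F]_4) (k : F).
Hypotheses (n0 : n != 0) (HN : monR R (single n p2) N' k).
Hypotheses (w2 : n = a * N' 0 p2) (w4 : N' 0 p4 = 0) (w1 : N' 0 p1 = a1 * n).
Hypothesis H2 : monR R (single n p2 + single n p2 + sig) (N' + N' + sig) (k * k / a).
Local Notation N := (single n p2).

Let NG : N \in Gamma. Proof. by case: HN. Qed.
Let NG' : N' \in Gamma'. Proof. by case: HN. Qed.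
Let k0 : k != 0. Proof. by case: HN. Qed.
Let RN : R (xg N) (k *: xg' N'). Proof. by case: HN. Qed.
Let N'0 : N' 0 p2 != 0. Proof. by apply: contraNneq n0 => E; rewrite w2 E mulr0. Qed.
Let Nw : (n, 0 : F) <> (0, 0). Proof. by move=> [/eqP]; rewrite (negPf n0). Qed.
Let Nc : (N 0 p1 = 0) * (N 0 p2 = n) * (N 0 p3 = 0) * (N 0 p4 = 0).
Proof. by rewrite !singleE. Qed.
Let n2 : n + n != 0.
Proof. by rewrite -mulr2n -mulr_natr mulf_neq0 // (natf_eq0_char0 char0). Qed.
Let N2'0 : N' 0 p2 + N' 0 p2 != 0.
Proof. by rewrite -mulr2n -mulr_natr mulf_neq0 // (natf_eq0_char0 char0). Qed.
Let NNs' : N' + N' + sig <> sig1.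
Proof. by apply: (@neq_sigma1 F _ p2); [left|rewrite !coordE addr0]. Qed.
Let Ns' : N' <> sig1.
Proof. by apply: (@neq_sigma1 F _ p2); [left|]. Qed.

Let coef_shift (w : A') : xcoeff (N' + N' + sig) 0 (w * xg' (N' + sig)) = xcoeff N' 0 w.
Proof. by rewrite -addrA xcoeff_shift // rpredD. Qed.

(** The bracket of [x^N] and [x^N t_1] is a nonzero multiple of the monomial
    [2 N + sigma]. On the other side the coefficient at [2 N' + sigma] is the
    one of [(N'_1 - d'_1) u'] at [N'], which is zero if [t_1] does not occur. *)
Lemma corr_J1 : J p1 -> J' p1.
Proof.
move=> J1; apply: contraT => nJ1.
pose u := xmon Gamma J N (iota p1).
have uE q : d q u = N 0 q *: u + (if q == p1 then xg N else 0) by apply: d_iota.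
have uW : wspace n 0 u by split; rewrite uE Nc /= addr0.
have [u0 Ru0] := corr_dom Rcorr (wspace_inD sigG Nw uW).
have [u' Ru u'W] := corr_wspace GammaA GammaA' Rcorr RX RY Nw Ru0 uW.
have [u'2 u'4] := u'W.
have NW := @wspace_xg F Gamma J N; rewrite !Nc in NW.
have wE : wl a 0 0 e n 0 = N' 0 p2 /\ wm a 0 0 e n 0 = 0.
  rewrite /wl /wm !(mul0r, mulr0, addr0, subr0); split=> //.
  by rewrite w2; field; rewrite a0 e0.
rewrite wE.1 wE.2 scale0r in u'2 u'4.
have B := corr_lie Rcorr RN Ru.
have E1 : [lie xg N, u] = (- n) *: xg (N + N + sig).
  rewrite bracketE !xu_dE0 !uE !Nc /= !addr0 !scale0r !add0r -!xgM ?rpredD //.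
  by xu_ring Gamma J.
have [_ _ _ RNN] := H2.
have := corr_uniq Rcorr B _; rewrite E1 => /(_ _ (corrZ Rcorr (- n) RNN)).
move/(xcoeff_inZ NNs')/eqP; rewrite linearB !linearZ /= xcoeff_xg ?rpredD // eqxx mulr1.
have -> : [lie k *: xg' N', u'] = (k * N' 0 p2) *: ((N' 0 p1 *: u' - d' p1 u') * xg' (N' + sig)).
  rewrite bracketE !xu_dZ !xu_dE0 u'2 u'4 w4 !scale0r -xgM //.
  by xu_ring Gamma' J'.
rewrite linearZ /= coef_shift linearB linearZ /= xcoeff_d0 // subrr mulr0 sub0r mulNr opprK.
by rewrite !mulf_eq0 invr_eq0 (negPf n0) (negPf k0) (negPf a0).
Qed.

(* The defect of [u] from being a weight vector is [x^N]; the same defect of the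
   image comes from a term in [x^N' t_2]. *)
Let Rt2 (u : A) (u' : A') : R u u' -> d p2 u = n *: u + xg N ->
  xcoeff N' (iota p2) u' = k / a /\ J' p2.
Proof.
move=> Ru u2; have B := corr_lie Rcorr RX Ru.
have B2 := corrZ Rcorr (- 1) (corrP Rcorr n Ru RN).
have E : [lie tor 1 0, u] = - 1 *: (n *: u + xg N) by rewrite lie_tor // scale0r addr0 u2.
rewrite E in B; have := corr_uniq Rcorr B B2.
move/(xcoeff_inZ Ns')/eqP; rewrite linearB subr_eq0 lie_tor // scale0r addr0 !(linearZ, linearD) /=.
rewrite xcoeff_d ?jset0 // xcoeff_xg // eqxx mxE mulr1 mul1r w2 => /eqP E'.
have ak : a * xcoeff N' (iota p2) u' = k.
  apply: (addrI (a * N' 0 p2 * xcoeff N' 0 u')); apply: oppr_inj.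
  by rewrite -[RHS]mulN1r -E'; ring.
have c0 : xcoeff N' (iota p2) u' = k / a by rewrite -ak mulrAC divff // mul1r.
split=> //; apply: contraT => nJ.
have := c0; rewrite xcoeff_outr ?iota_jset // => /esym/eqP.
by rewrite mulf_eq0 invr_eq0 (negPf a0) (negPf k0).
Qed.

Let u2E : J p2 -> forall q, d q (xmon Gamma J N (iota p2)) = N 0 q *: xmon Gamma J N (iota p2) + (if q == p2 then xg N else 0).
Proof. by move=> J2 q; apply: d_iota. Qed.

Let u2D : J p2 -> xu_D (xmon Gamma J N (iota p2)).
Proof.
move=> J2; have E : [lie tor (- 1) 0, xmon Gamma J N (iota p2)] = n *: xmon Gamma J N (iota p2) + xg N.
  by rewrite lie_tor // opprK scale1r scale0r addr0 u2E // Nc eqxx.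
have NW := @wspace_xg F Gamma J N; rewrite !Nc in NW.
apply: (inDZr n0); rewrite -[n *: _](addrK (xg N)) -E.
rewrite -scaleN1r addrC; apply: inDP; last exact: inD_lie.
exact: (wspace_inD sigG Nw NW).
Qed.

Lemma corr_J2 : J p2 -> J' p2.
Proof.
move=> J2; have [u' Ru] := corr_dom Rcorr (u2D J2).
by have [] := Rt2 Ru _; first by rewrite u2E // Nc eqxx.
Qed.

(** The bracket of [x^N] and [x^N t_2] vanishes, as [N_1] does. On the other
    side the coefficient at [2 N' + sigma] is a nonzero multiple of [N'_1 =
    a1 * n], if [t_1] does not occur to compensate it. *)
Lemma corr_a1 : ~~ J' p1 -> J p2 -> a1 = 0.
Proof.
move=> nJ1 J2; have [u' Ru] := corr_dom Rcorr (u2D J2).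
have [c0 _] : xcoeff N' (iota p2) u' = k / a /\ J' p2.
  by apply: Rt2 Ru _; rewrite u2E // Nc eqxx.
set u := xmon _ _ _ _ in Ru.
have uE := u2E J2; rewrite -/u in uE.
have d4Z : inZ (d' p4 u').
  have B := corr_lie Rcorr RY Ru.
  have E : [lie tor 0 1, u] = 0.
    by rewrite lie_tor // oppr0 scale0r add0r scale1r uE Nc scale0r addr0.
  rewrite E lie_tor // oppr0 scale0r add0r in B.
  have : inZ (e *: d' p4 u') by apply/(corr_inZ Rcorr B); apply: inZ0.
  by move/(inZZ e^-1); rewrite (scalerK e0).
have E1 : [lie xg N, u] = 0.
  by rewrite bracketE !xu_dE0 !uE !Nc /= !addr0 !scale0r !(mulr0, mul0r, subr0, add0r, oppr0, addr0, sub0r).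
have B := corr_lie Rcorr RN Ru; rewrite E1 in B.
have : inZ [lie k *: xg' N', u'] by apply/(corr_inZ Rcorr B); apply: inZ0.
have [z zE] := d4Z.
have -> : [lie k *: xg' N', u'] = k *: ((N' 0 p1 *: d' p2 u' - N' 0 p2 *: d' p1 u') * xg' (N' + sig))
    + (k * (1 + N' 0 p3) * z) *: (xg' sig1 * xg' N').
  rewrite bracketE !xu_dZ !xu_dE0 zE w4 !scale0r -xgM //.
  by xu_ring Gamma' J'.
move/(xcoeff_inZ NNs')/eqP; rewrite linearD !linearZ /= coef_shift linearD !linearZ /= linearN mulrN /=.
rewrite (@xcoeff_d0 p1 _ _ nJ1) xcoeff_d ?jset0 // c0 mxE mul1r.
have -> : xcoeff (N' + N' + sig) 0 (xg' sig1 * xg' N') = 0.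
  have [sG|sG] := boolP (sig1 \in Gamma'); last by rewrite xmon_outl // mul0r linear0.
  rewrite xgM // xcoeff_xg ?rpredD //; case: (N' + N' + sig =P sig1 + N') => // /rowP/(_ p2)/eqP.
  by rewrite !coordE !addr0 add0r -subr_eq0 addrK (negPf N'0).
rewrite mulr0 addr0.
have -> : N' 0 p1 * (N' 0 p2 * xcoeff N' 0 u' + k / a) - N' 0 p2 * (N' 0 p1 * xcoeff N' 0 u') = N' 0 p1 * k / a by ring.
rewrite !mulf_eq0 invr_eq0 (negPf a0) (negPf k0) /= orbF w1 mulf_eq0 (negPf n0) !orbF.
by move/eqP.
Qed.
End WithCoordinate.

Lemma corr_first : exists a1 : F,
  [/\ forall alpha alpha' k, monR R alpha alpha' k -> alpha 0 p2 != 0 ->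
        [/\ alpha' 0 p1 = alpha 0 p1 + a1 * alpha 0 p2, alpha 0 p2 = a * alpha' 0 p2 &
            alpha 0 p4 = e * alpha' 0 p4],
      J p1 -> J' p1, J p2 -> J' p2 & ~~ J' p1 -> J p2 -> a1 = 0].
Proof.
have [a1 [H1 H2]] := corr_coord1 char0 GammaA GammaA' Rcorr RX RY.
have [n [N' [k [n0 HN [w2 w4 w1] HNN]]]] := mon_n2 H1 H2.
exists a1; split.
- move=> al al' k' H al0; have [? ?] := monR_weight2 GammaA GammaA' Rcorr RX RY H al0.
  by split=> //; apply: H1 H al0.
- exact: (corr_J1 n0 HN w2 w4 HNN).
- exact: (corr_J2 n0 HN w2).
- exact: (corr_a1 n0 HN w2 w4 w1).
Qed.
End Polynomial.

(** * Isomorphisms of the algebras *)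

(** The inverse map is part of the data, which makes symmetry and composition
    immediate. *)
Record xu_iso (F : fieldType) (Gamma Gamma' : zmodClosed 'rV[F]_4) (J J' : jtype)
    (f : xu_A4 Gamma J -> xu_A4 Gamma' J') (g : xu_A4 Gamma' J' -> xu_A4 Gamma J) : Prop := XuIso {
  iso_linear : forall a u v, f (a *: u + v) = a *: f u + f v;
  iso_linear' : forall a u v, g (a *: u + v) = a *: g u + g v;
  iso_lie : forall u v, f [lie u, v] = [lie f u, f v];
  iso_lie' : forall u v, g [lie u, v] = [lie g u, g v];
  iso_K : cancel f g;
  iso_K' : cancel g f;
  iso_Z : forall u, inZ u -> inZ (f u);
  iso_Z' : forall u, inZ u -> inZ (g u)
}.

Lemma xu_iso_sym (F : fieldType) (Gamma Gamma' : zmodClosed 'rV[F]_4) (J J' : jtype)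
    (f : xu_A4 Gamma J -> xu_A4 Gamma' J') g : xu_iso f g -> xu_iso g f.
Proof. by case=> *; split. Qed.

Lemma xu_iso_comp (F : fieldType) (Gamma Gamma' Gamma'' : zmodClosed 'rV[F]_4) (J J' J'' : jtype)
    (f : xu_A4 Gamma J -> xu_A4 Gamma' J') g (f' : xu_A4 Gamma' J' -> xu_A4 Gamma'' J'') g' :
  xu_iso f g -> xu_iso f' g' -> xu_iso (f' \o f) (g \o g').
Proof.
move=> [fL gL fl gl fK gK fZ gZ] [fL' gL' fl' gl' fK' gK' fZ' gZ']; split=> //=.
- by move=> a u v; rewrite fL fL'.
- by move=> a u v; rewrite gL' gL.
- by move=> u v; rewrite fl fl'.
- by move=> u v; rewrite gl' gl.
- by move=> u /=; rewrite fK' fK.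
- by move=> u /=; rewrite gK gK'.
- by move=> u /fZ/fZ'.
- by move=> u /gZ'/gZ.
Qed.

Section IsoSum.
Context (F : fieldType) (Gamma Gamma' : zmodClosed 'rV[F]_4) (J J' : jtype).
Local Notation A := (xu_A4 Gamma J).
Local Notation A' := (xu_A4 Gamma' J').
Local Notation pi := (lie_pi (sigma1_ideal Gamma J)).
Local Notation pi' := (lie_pi (sigma1_ideal Gamma' J')).
Variables (f : A -> A') (g : A' -> A).
Hypothesis fg : xu_iso f g.

Let f0 : f 0 = 0.
Proof. by have := iso_linear fg (- 1) 0 0; rewrite scaler0 addr0 scaleN1r addNr. Qed.

Let fB u v : f (u - v) = f u - f v.
Proof. by have := iso_linear fg (- 1) v u; rewrite !scaleN1r addrC => ->; rewrite addrC. Qed.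

Lemma pi_Z u : inZ u -> pi u = 0.
Proof.
by move=> uZ; rewrite -(linear0 pi); apply/inZ_pi; rewrite subr0.
Qed.

Lemma pi_inZ u : pi u = 0 -> inZ u.
Proof. by rewrite -(linear0 pi) => /inZ_pi; rewrite subr0. Qed.

Definition iso_quot (x : xu_B4 Gamma J) : xu_B4 Gamma' J' := pi' (f (lie_repr x)).

Lemma iso_quot_pi u : iso_quot (pi u) = pi' (f u).
Proof.
apply/inZ_pi; rewrite -fB; apply: (iso_Z fg); apply/inZ_pi; exact: lie_reprK.
Qed.

Lemma iso_quot_linear a x y : iso_quot (a *: x + y) = a *: iso_quot x + iso_quot y.
Proof.
rewrite -[x](lie_reprK (I := sigma1_ideal Gamma J)) -[y](lie_reprK (I := sigma1_ideal Gamma J)).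
by rewrite -linearP !iso_quot_pi (iso_linear fg) linearP.
Qed.

Lemma iso_quot_lie x y : iso_quot [lie x, y] = [lie iso_quot x, iso_quot y].
Proof.
rewrite -[x](lie_reprK (I := sigma1_ideal Gamma J)) -[y](lie_reprK (I := sigma1_ideal Gamma J)).
have piL u v : [lie pi u, pi v] = pi [lie u, v] by rewrite lie_pi_lie.
have piL' u v : [lie pi' u, pi' v] = pi' [lie u, v] by rewrite lie_pi_lie.
by rewrite piL !iso_quot_pi piL' (iso_lie fg).
Qed.

Lemma iso_quot_derived x : x \in @derived_pred F (xu_B4 Gamma J) ->
  iso_quot x \in @derived_pred F (xu_B4 Gamma' J').
Proof.
have q0 : iso_quot 0 = 0 by rewrite -(linear0 pi) iso_quot_pi f0 linear0.
have qD u v : iso_quot (u + v) = iso_quot u + iso_quot v.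
  by have := iso_quot_linear 1 u v; rewrite !scale1r.
move=> /derived_predP[s ->].
elim: s => [|p s IH]; first by rewrite big_nil q0 rpred0.
by rewrite big_cons qD rpredD // iso_quot_lie lie_derived.
Qed.

(** The induced map of the quotients by the central lines preserves sums of
    brackets. *)
Lemma iso_xu_D u : xu_D u -> xu_D (f u).
Proof. by rewrite /xu_D -iso_quot_pi; apply: iso_quot_derived. Qed.
End IsoSum.

Lemma xu_B_iso (F : fieldType) (Gamma Gamma' : zmodClosed 'rV[F]_4) (J J' : jtype)
    (f : xu_A4 Gamma J -> xu_A4 Gamma' J') g :
  xu_iso f g -> lie_isomorphic (xu_B Gamma J) (xu_B Gamma' J').
Proof.
move=> fg; have gf := xu_iso_sym fg.
pose h (b : xu_B Gamma J) : xu_B Gamma' J' :=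
  Derived (iso_quot_derived fg (valP b)).
pose h' (b : xu_B Gamma' J') : xu_B Gamma J :=
  Derived (iso_quot_derived gf (valP b)).
have quotK (Gamma1 Gamma2 : zmodClosed 'rV[F]_4) (J1 J2 : jtype)
    (f1 : xu_A4 Gamma1 J1 -> xu_A4 Gamma2 J2) g1 : xu_iso f1 g1 ->
    cancel (iso_quot f1) (iso_quot g1).
  move=> fg1 x; rewrite -[x](lie_reprK (I := sigma1_ideal Gamma1 J1)).
  by rewrite (iso_quot_pi fg1) (iso_quot_pi (xu_iso_sym fg1)) (iso_K fg1).
have h_linear : linear h.
  move=> a x y; apply: val_inj.
  change (iso_quot f (val (a *: x + y)) = a *: iso_quot f (val x) + iso_quot f (val y)).
  by rewrite -(iso_quot_linear fg).
pose hL : {linear xu_B Gamma J -> xu_B Gamma' J'} :=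
  HB.pack h (GRing.isLinear.Build F _ _ _ h h_linear).
exists hL; split.
  by exists h' => x; apply: val_inj; apply: quotK.
by move=> x y; apply: val_inj; apply: (iso_quot_lie fg).
Qed.

Section CorrOfIso.
Context (F : fieldType).

(** Representatives are related if their classes lie in the derived algebras
    and correspond to each other. *)
Lemma corr_of_iso (Gamma Gamma' : zmodClosed 'rV[F]_4) (J J' : jtype) :
  lie_isomorphic (xu_B Gamma J) (xu_B Gamma' J') ->
  exists R : xu_A4 Gamma J -> xu_A4 Gamma' J' -> Prop, xu_corr R.
Proof.
move=> [th [[th' thK th'K] thL]].
pose pi := lie_pi (sigma1_ideal Gamma J); pose pi' := lie_pi (sigma1_ideal Gamma' J').
exists (fun a a' => exists b : xu_B Gamma J, val b = pi a /\ val (th b) = pi' a'); split.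
- move=> c a b a' b' [x [x1 x2]] [y [y1 y2]]; exists (c *: x + y).
  by rewrite linearP /= x1 y1 x2 y2 /pi /pi' !linearP.
- move=> a b a' b' [x [x1 x2]] [y [y1 y2]]; exists [lie x, y].
  by rewrite thL /pi /pi' !lie_pi_lie -/pi -/pi' -x1 -x2 -y1 -y2.
- move=> a a' [x [x1 x2]]; split=> aZ.
    apply: pi_inZ; rewrite -[lie_pi _ _]x2; have -> : x = 0.
      by apply: val_inj; rewrite x1; exact: (pi_Z aZ).
    by rewrite linear0.
  apply: pi_inZ; rewrite -[lie_pi _ _]x1; have : th x = 0.
    by apply: val_inj; rewrite x2; exact: (pi_Z aZ).
  by rewrite -(linear0 th) => /(can_inj thK)->.
- move=> a a' aZ aZ'; exists 0; split; [|rewrite (linear0 th)]; apply: esym; [exact: (pi_Z aZ)|exact: (pi_Z aZ')].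
- move=> a aD; exists (lie_repr (val (th (Derived aD)))), (Derived aD); split=> //.
  by rewrite /pi' lie_reprK.
move=> a' aD; exists (lie_repr (val (th' (Derived aD)))), (th' (Derived aD)).
by rewrite th'K /pi lie_reprK.
Qed.

Lemma corr_comp (Gamma Gamma' Gamma'' : zmodClosed 'rV[F]_4) (J J' J'' : jtype)
    (R : xu_A4 Gamma J -> xu_A4 Gamma' J' -> Prop) (f : xu_A4 Gamma' J' -> xu_A4 Gamma'' J'') g :
  xu_corr R -> xu_iso f g -> xu_corr (fun a a'' => R a (g a'')).
Proof.
move=> Rc fg; split.
- by move=> c a b a' b' Ra Rb; rewrite (iso_linear' fg); apply: (corrP Rc).
- by move=> a b a' b' Ra Rb; rewrite (iso_lie' fg); apply: (corr_lie Rc).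
- move=> a a' Ra; rewrite (corr_inZ Rc Ra); split; last exact: (iso_Z' fg).
  by move/(iso_Z fg); rewrite (iso_K' fg).
- by move=> a a' aZ aZ'; apply: (corr_Z Rc) => //; apply: (iso_Z' fg).
- move=> a aD; have [a' Ra] := corr_dom Rc aD; exists (f a'); by rewrite (iso_K fg).
- move=> a' aD; apply: (corr_cod Rc); exact: (iso_xu_D (xu_iso_sym fg)).
Qed.
End CorrOfIso.

Section AlgInd.
Context (F : fieldType) (Gamma : zmodClosed 'rV[F]_4) (J : jtype).
Local Notation A := (xu_A4 Gamma J).
Local Notation xg alpha := (xmon Gamma J alpha 0).
Local Notation d := (@xu_d F Gamma J).

Definition xvar p : A := xmon Gamma J 0 (single 1%N p).

Lemma single_jset p : single 1%N p \in jset J = J p.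
Proof. by rewrite -[single _ _]add0r jsetD1 jset0. Qed.

Lemma xu_alg_ind (P : A -> Prop) :
    (forall a u v, P u -> P v -> P (a *: u + v)) -> (forall u v, P u -> P v -> P (u * v)) ->
    (forall alpha, alpha \in Gamma -> P (xg alpha)) -> (forall p, J p -> P (xvar p)) ->
  forall u, P u.
Proof.
move=> PD PM Pg Pt.
have P0 : P 0.
  have := PD (- 1) _ _ (Pg 0 (rpred0 Gamma)) (Pg 0 (rpred0 Gamma)).
  by rewrite scaleN1r addNr.
elim/xu_ind => // al i aG; move: {2}(\sum_p i 0%R p)%N (erefl (\sum_p i 0%R p)%N) => n.
elim: n i => [|n IH] i iE iJ.
  suff -> : i = 0 by apply: Pg.
  apply/rowP=> p; rewrite mxE; apply/eqP; rewrite -leqn0.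
  have : (i 0%R p <= \sum_q i 0%R q)%N by rewrite (bigD1 p) //= leq_addr.
  by rewrite iE.
have [p ip] : exists p, i 0%R p != 0%N.
  apply: contrapT => no; move: iE; rewrite big1 // => p _.
  by apply/eqP/negP => /negP ip; apply: no; exists p.
have iE' : i = jdec i p + single 1%N p.
  apply/rowP=> q; rewrite jincE jdecE; case: (eqVneq q p) => [->|_]; last by rewrite subn0 addn0.
  by rewrite subnK // lt0n.
have Jp : J p by move: iJ; rewrite iE' jsetD1 => /andP[].
have jJ := jdec_jset p iJ.
have -> : xmon Gamma J al i = xmon Gamma J al (jdec i p) * xvar p.
  by rewrite /xvar xmonM ?rpred0 ?single_jset // addr0 -iE'.
apply: PM; last exact: Pt.
apply: IH => //; apply: succn_inj; rewrite -iE [in RHS](bigD1 p) //= (bigD1 p) //=.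
rewrite jdecE eqxx -addSn subn1 prednK ?lt0n //; congr (_ + _)%N.
by apply: eq_bigr => q qp; rewrite jdecE (negPf qp) subn0.
Qed.

Lemma d_xt p q : J p -> d q (xvar p) = (q == p)%:R.
Proof.
move=> Jp; rewrite /xvar xu_dE ?single_jset // mxE scale0r add0r.
have -> : single 1%N p 0%R q = (q == p) :> nat by rewrite mxE; case: eqP.
case: eqP => [->|_]; last by rewrite scale0r.
rewrite scale1r; have -> : jdec (single 1%N p) p = 0; last exact: xg0.
by apply/rowP=> r; rewrite jdecE !mxE; case: eqP.
Qed.
End AlgInd.

(** * The triangular isomorphisms *)

Section AlgebraMorphism.
Context (F : fieldType) (Gamma Gamma' : zmodClosed 'rV[F]_4) (J J' : jtype).
Local Notation A := (xu_A4 Gamma J).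
Local Notation A' := (xu_A4 Gamma' J').
Local Notation xg alpha := (xmon Gamma J alpha 0).
Local Notation xg' alpha := (xmon Gamma' J' alpha 0).
Local Notation xt := (@xvar F Gamma J).
Variables (g : 'rV[F]_4 -> 'rV[F]_4) (chi : 'rV[F]_4 -> F) (T : 'I_4 -> A').
Hypothesis gD : forall x y, g (x + y) = g x + g y.
Hypothesis gG : forall x, x \in Gamma -> g x \in Gamma'.
Hypothesis chiD : forall x y, chi (x + y) = chi x * chi y.
Hypothesis chi0 : chi 0 = 1.
Implicit Types (u v : A).

(** The morphism of algebras that sends [xg alpha] to [chi alpha *: xg' (g
    alpha)] and the variable [t_p] to [T p]. *)
Definition xu_map u : A' := sgext (fun k : (gidx Gamma * jidx J)%type =>
  chi (gidx_val k.1) *: (xg' (g (gidx_val k.1)) * \prod_p T p ^+ jidx_val k.2 0%R p)) u.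

Lemma xu_mapP a u v : xu_map (a *: u + v) = a *: xu_map u + xu_map v.
Proof. exact: sgext_is_linear. Qed.

Lemma xu_map0 : xu_map 0 = 0.
Proof. by have := xu_mapP (- 1) 0 0; rewrite scaler0 addr0 scaleN1r addNr. Qed.

Lemma xu_mapD u v : xu_map (u + v) = xu_map u + xu_map v.
Proof. by have := xu_mapP 1 u v; rewrite !scale1r. Qed.

Lemma xu_mapZ a u : xu_map (a *: u) = a *: xu_map u.
Proof. by have := xu_mapP a u 0; rewrite xu_map0 !addr0. Qed.

Lemma xu_mapE alpha i : alpha \in Gamma -> i \in jset J ->
  xu_map (xmon Gamma J alpha i) = chi alpha *: (xg' (g alpha) * \prod_p T p ^+ i 0%R p).
Proof. by move=> aG iJ; rewrite /xu_map xmonE sgextU. Qed.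

Let g0 : g 0 = 0.
Proof. by apply: (addrI (g 0)); rewrite -gD !addr0. Qed.

Lemma xu_mapM u v : xu_map (u * v) = xu_map u * xu_map v.
Proof.
elim/xu_ind: u => [|a u u' IH IH'|al i aG iJ]; first by rewrite mul0r xu_map0 mul0r.
  by rewrite mulrDl -scalerAl !xu_mapP IH IH' mulrDl -scalerAl.
elim/xu_ind: v => [|a u u' IH IH'|be j bG jJ]; first by rewrite mulr0 xu_map0 mulr0.
  by rewrite mulrDr -scalerAr !xu_mapP IH IH' mulrDr -scalerAr.
rewrite xmonM // !xu_mapE ?rpredD // chiD gD -xgM ?gG //.
have -> : \prod_p T p ^+ ((i + j : 'rV[nat]_4)%R 0%R p) = (\prod_p T p ^+ i 0%R p) * \prod_p T p ^+ j 0%R p.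
  by rewrite -big_split; apply: eq_bigr => p _; rewrite mxE exprD.
by move: (\prod_p _) (\prod_p _) => X Y; xu_ring Gamma' J'.
Qed.

Lemma xu_map_xg alpha : alpha \in Gamma -> xu_map (xg alpha) = chi alpha *: xg' (g alpha).
Proof.
move=> aG; rewrite xu_mapE ?jset0 // big1 ?mulr1 // => p _.
by rewrite mxE expr0.
Qed.

Lemma xu_map1 : xu_map 1 = 1.
Proof. by rewrite -(xg0 Gamma J) xu_map_xg ?rpred0 // chi0 scale1r g0 xg0. Qed.

Lemma xu_map_xt p : J p -> xu_map (xt p) = T p.
Proof.
move=> Jp; rewrite /xvar xu_mapE ?rpred0 ?single_jset // chi0 scale1r g0 xg0 mul1r.
rewrite (bigD1 p) //= big1 => [|q qp]; first by rewrite mxE eqxx expr1 mulr1.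
by rewrite mxE (negPf qp) expr0.
Qed.

(** Both sides are derivations along [xu_map], so they agree as soon as they
    agree on the generators. *)
Lemma xu_map_derivation (D : A -> A) (D' : A' -> A') :
    (forall a u v, D (a *: u + v) = a *: D u + D v) -> (forall u v, D (u * v) = D u * v + u * D v) ->
    (forall a (u v : A'), D' (a *: u + v) = a *: D' u + D' v) -> (forall u v : A', D' (u * v) = D' u * v + u * D' v) ->
    (forall alpha, alpha \in Gamma -> D' (chi alpha *: xg' (g alpha)) = xu_map (D (xg alpha))) ->
    (forall p, J p -> D' (T p) = xu_map (D (xt p))) ->
  forall u, D' (xu_map u) = xu_map (D u).
Proof.
move=> DP DM DP' DM' Dg Dt; apply: xu_alg_ind => [a u v IHu IHv|u v IHu IHv|al aG|p Jp].
- by rewrite DP !xu_mapP DP' IHu IHv.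
- by rewrite xu_mapM DM' DM xu_mapD !xu_mapM IHu IHv.
- by rewrite xu_map_xg // Dg.
- by rewrite xu_map_xt // Dt.
Qed.
End AlgebraMorphism.

Section Triangular.
Context (F : closedFieldType).

Definition tri (a1 a2 a3 a4 : F) (b : 'rV[F]_4) : 'rV[F]_4 :=
  vec4 (b 0 p1 + a1 * b 0 p2) (a2 * b 0 p2) (b 0 p3 + a3 * b 0 p4) (a4 * b 0 p4).

Lemma vec4E (T : Type) (a b c e : T) : ((vec4 a b c e 0 p1 = a) * (vec4 a b c e 0 p2 = b) *
  (vec4 a b c e 0 p3 = c) * (vec4 a b c e 0 p4 = e))%type.
Proof. by rewrite /vec4 !mxE. Qed.

Lemma triD a1 a2 a3 a4 x y : tri a1 a2 a3 a4 (x + y) = tri a1 a2 a3 a4 x + tri a1 a2 a3 a4 y.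
Proof. by apply: rV4P; rewrite !(rvD, vec4E); ring. Qed.

Lemma tri_inv a1 a2 a3 a4 x : a2 != 0 -> a4 != 0 ->
  tri (- a1 / a2) a2^-1 (- a3 / a4) a4^-1 (tri a1 a2 a3 a4 x) = x.
Proof. by move=> a20 a40; apply: rV4P; rewrite !vec4E; field. Qed.

Lemma tri_inv' a1 a2 a3 a4 x : a2 != 0 -> a4 != 0 ->
  tri a1 a2 a3 a4 (tri (- a1 / a2) a2^-1 (- a3 / a4) a4^-1 x) = x.
Proof. by move=> a20 a40; apply: rV4P; rewrite !vec4E; field. Qed.

Context (Gamma Gamma' : zmodClosed 'rV[F]_4) (J : jtype).
Local Notation A := (xu_A4 Gamma J).
Local Notation A' := (xu_A4 Gamma' J).
Local Notation xg alpha := (xmon Gamma J alpha 0).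
Local Notation xg' alpha := (xmon Gamma' J alpha 0).
Local Notation xt' := (@xvar F Gamma' J).
Local Notation d := (@xu_d F Gamma J).
Local Notation d' := (@xu_d F Gamma' J).
Local Notation sig := (sigma F).
Local Notation sig1 := (sigma1 F).
Variables (a1 a2 a3 a4 : F) (chi : 'rV[F]_4 -> F).
Hypothesis sigG : sig \in Gamma.
Hypothesis triG : forall x, x \in Gamma -> tri a1 a2 a3 a4 x \in Gamma'.
Hypothesis chiD : forall x y, chi (x + y) = chi x * chi y.
Hypothesis chi0 : chi 0 = 1.
Hypothesis a1J : ~~ J p1 -> J p2 -> a1 = 0.
Hypothesis a3J : ~~ J p3 -> J p4 -> a3 = 0.

(** The substitution dual to [tri], so that the exponential with exponent
    [alpha] becomes the one with exponent [tri alpha]. *)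
Definition tri_var (p : 'I_4) : A' :=
  if p == p1 then xt' p1 else if p == p2 then a1 *: xt' p1 + a2 *: xt' p2
  else if p == p3 then xt' p3 else a3 *: xt' p3 + a4 *: xt' p4.

Definition tri_map : A -> A' := xu_map (tri a1 a2 a3 a4) chi tri_var.

Lemma ord4P (P : 'I_4 -> Prop) : P p1 -> P p2 -> P p3 -> P p4 -> forall p, P p.
Proof.
move=> P1 P2 P3 P4 [[|[|[|[|//]]]] lt4].
- by move: P1; congr P; apply: val_inj.
- by move: P2; congr P; apply: val_inj.
- by move: P3; congr P; apply: val_inj.
- by move: P4; congr P; apply: val_inj.
Qed.

Let mapM := xu_mapM (J := J) tri_var (triD a1 a2 a3 a4) triG chiD.
Let map1 := xu_map1 Gamma J tri_var (triD a1 a2 a3 a4) chi0.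

Let d_lin (G : zmodClosed 'rV[F]_4) (p q : 'I_4) (c : F) a (u v : xu_A4 G J) :
  xu_d p (a *: u + v) + c *: xu_d q (a *: u + v) = a *: (xu_d p u + c *: xu_d q u) + (xu_d p v + c *: xu_d q v).
Proof. by rewrite !xu_d_linear; xu_ring G J. Qed.

Let d_leib (G : zmodClosed 'rV[F]_4) (p q : 'I_4) (c : F) (u v : xu_A4 G J) :
  xu_d p (u * v) + c *: xu_d q (u * v) = (xu_d p u + c *: xu_d q u) * v + u * (xu_d p v + c *: xu_d q v).
Proof. by rewrite !xu_dM; xu_ring G J. Qed.

Let d_xt' p q : d' q (xt' p) = (J p && (q == p))%:R.
Proof.
case Jp: (J p); first by rewrite d_xt.
by rewrite /xvar xmon.unlock (insubT (mem Gamma') (rpred0 _)) insubN ?xu_d0 ?single_jset ?Jp.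
Qed.

Lemma tri_map_d1 u : d' p1 (tri_map u) = tri_map (d p1 u + a1 *: d p2 u).
Proof.
apply: (xu_map_derivation (D := fun u => d p1 u + a1 *: d p2 u) (D' := d' p1)
  (triD a1 a2 a3 a4) triG chiD chi0) u => [a u v|u v|a u v|u v|al aG|].
- exact: d_lin.
- exact: d_leib.
- exact: xu_d_linear.
- exact: xu_dM.
- rewrite !xu_dZ !xu_dE0 vec4E xu_mapD !xu_mapZ xu_map_xg //; xu_ring Gamma' J.
apply: ord4P => Jp; rewrite !d_xt //= /tri_var /= ?xu_dD ?xu_dZ ?d_xt' ?Jp /=
   ?andbF ?scaler0 ?addr0 ?add0r ?xu_map0 ?(xu_map1 _ _ _ (triD a1 a2 a3 a4) chi0) //.
case J1: (J p1); first by rewrite eqxx xu_mapZ map1.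
by rewrite a1J ?J1 // !scale0r xu_map0.
Qed.

Lemma tri_map_d2 u : d' p2 (tri_map u) = tri_map (a2 *: d p2 u).
Proof.
apply: (xu_map_derivation (D := fun u => a2 *: d p2 u) (D' := d' p2)
  (triD a1 a2 a3 a4) triG chiD chi0) u => [a u v|u v|a u v|u v|al aG|].
- by rewrite xu_d_linear; xu_ring Gamma J.
- by rewrite xu_dM; xu_ring Gamma J.
- exact: xu_d_linear.
- exact: xu_dM.
- rewrite !xu_dZ !xu_dE0 vec4E !xu_mapZ xu_map_xg //; xu_ring Gamma' J.
apply: ord4P => Jp; rewrite !d_xt //= /tri_var /= ?xu_dD ?xu_dZ ?d_xt' ?Jp /=
   ?andbF ?scaler0 ?addr0 ?add0r ?xu_map0 ?(xu_map1 _ _ _ (triD a1 a2 a3 a4) chi0) //.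
by rewrite xu_mapZ map1.
Qed.

Lemma tri_map_d3 u : d' p3 (tri_map u) = tri_map (d p3 u + a3 *: d p4 u).
Proof.
apply: (xu_map_derivation (D := fun u => d p3 u + a3 *: d p4 u) (D' := d' p3)
  (triD a1 a2 a3 a4) triG chiD chi0) u => [a u v|u v|a u v|u v|al aG|].
- exact: d_lin.
- exact: d_leib.
- exact: xu_d_linear.
- exact: xu_dM.
- rewrite !xu_dZ !xu_dE0 vec4E xu_mapD !xu_mapZ xu_map_xg //; xu_ring Gamma' J.
apply: ord4P => Jp; rewrite !d_xt //= /tri_var /= ?xu_dD ?xu_dZ ?d_xt' ?Jp /=
   ?andbF ?scaler0 ?addr0 ?add0r ?xu_map0 ?(xu_map1 _ _ _ (triD a1 a2 a3 a4) chi0) //.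
case J1: (J p3); first by rewrite eqxx xu_mapZ map1.
by rewrite a3J ?J1 // !scale0r xu_map0.
Qed.

Lemma tri_map_d4 u : d' p4 (tri_map u) = tri_map (a4 *: d p4 u).
Proof.
apply: (xu_map_derivation (D := fun u => a4 *: d p4 u) (D' := d' p4)
  (triD a1 a2 a3 a4) triG chiD chi0) u => [a u v|u v|a u v|u v|al aG|].
- by rewrite xu_d_linear; xu_ring Gamma J.
- by rewrite xu_dM; xu_ring Gamma J.
- exact: xu_d_linear.
- exact: xu_dM.
- rewrite !xu_dZ !xu_dE0 vec4E !xu_mapZ xu_map_xg //; xu_ring Gamma' J.
apply: ord4P => Jp; rewrite !d_xt //= /tri_var /= ?xu_dD ?xu_dZ ?d_xt' ?Jp /=
   ?andbF ?scaler0 ?addr0 ?add0r ?xu_map0 ?(xu_map1 _ _ _ (triD a1 a2 a3 a4) chi0) //.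
by rewrite xu_mapZ map1.
Qed.

Lemma tri_sigma : tri a1 a2 a3 a4 sig = sig.
Proof. by apply: rV4P; rewrite !vec4E ?sigmaE ?(mulr0, addr0). Qed.

Lemma tri_sigma1 : tri a1 a2 a3 a4 sig1 = sig1.
Proof. by apply: rV4P; rewrite !vec4E ?sigma1E ?(mulr0, addr0). Qed.

Hypothesis chis : chi sig = a2 / a4.
Hypothesis a20 : a2 != 0.
Hypothesis a40 : a4 != 0.

Definition tri_iso u : A' := a4^-1 *: tri_map u.

(** The derivation [d' p4] carries a factor [a4], which the factor [a4^-1] of
    [tri_iso] cancels in the quadratic expression; the first summand carries
    [a2] instead, and [chi sigma] makes up for the difference. *)
Lemma tri_iso_lie u v : tri_iso [lie u, v] = [lie tri_iso u, tri_iso v].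
Proof.
rewrite /tri_iso lieZl lieZr !bracketE !(tri_map_d1, tri_map_d2, tri_map_d3, tri_map_d4).
have E : xg' sig = (a4 / a2) *: tri_map (xg sig).
  rewrite /tri_map xu_map_xg // tri_sigma chis scalerA.
  by have -> : a4 / a2 * (a2 / a4) = 1 by [field; rewrite a20 a40]; rewrite scale1r.
rewrite E.
have mD x y : tri_map (x + y) = tri_map x + tri_map y by apply: xu_mapD.
have mZ a x : tri_map (a *: x) = a *: tri_map x by apply: xu_mapZ.
have mN x : tri_map (- x) = - tri_map x by rewrite -scaleN1r mZ scaleN1r.
have mM x y : tri_map (x * y) = tri_map x * tri_map y by apply: mapM.
rewrite !(mD, mN, mM, mZ).
move: (tri_map (xg sig)) (tri_map u) (tri_map v) (tri_map (d p1 u)) (tri_map (d p1 v)) (tri_map (d p2 u))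
  (tri_map (d p2 v)) (tri_map (d p3 u)) (tri_map (d p3 v)) (tri_map (d p4 u)) (tri_map (d p4 v)).
move=> s u0 v0 u1 v1 u2 v2 u3 v3 u4 v4.
apply: (scalerI a40); rewrite [LHS]scalerA [a4 *: (a4^-1 *: _)]scalerA divff // !scale1r.
transitivity ((a4^-1 * (a4 / a2) * a2) *: (s * (u1 * v2 - v1 * u2))
   + (a4^-1 * a4) *: ((u0 + u3) * v4 - (v0 + v3) * u4)); last by xu_ring Gamma' J.
have -> : a4^-1 * (a4 / a2) * a2 = 1 by field; rewrite a20 a40.
rewrite mulVf // !scale1r; ring.
Qed.
End Triangular.

Lemma xt_out (F : fieldType) (Gamma : zmodClosed 'rV[F]_4) (J : jtype) p : ~~ J p -> xvar Gamma J p = 0.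
Proof.
by move=> Jp; rewrite /xvar xmon.unlock (insubT (mem Gamma) (rpred0 _)) insubN // single_jset.
Qed.

Section TriangularInverse.
Context (F : closedFieldType) (Gamma Gamma' : zmodClosed 'rV[F]_4) (J : jtype).
Variables (a1 a2 a3 a4 b1 b2 b3 b4 : F) (chi chi' : 'rV[F]_4 -> F).
Hypothesis triG : forall x, x \in Gamma -> tri a1 a2 a3 a4 x \in Gamma'.
Hypothesis triG' : forall x, x \in Gamma' -> tri b1 b2 b3 b4 x \in Gamma.
Hypothesis triK : forall x, tri b1 b2 b3 b4 (tri a1 a2 a3 a4 x) = x.
Hypothesis chiD : forall x y, chi (x + y) = chi x * chi y.
Hypothesis chi0 : chi 0 = 1.
Hypothesis chiD' : forall x y, chi' (x + y) = chi' x * chi' y.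
Hypothesis chi0' : chi' 0 = 1.
Hypothesis chiK : forall x, chi x * chi' (tri a1 a2 a3 a4 x) = 1.
Hypothesis ab1 : a1 + a2 * b1 = 0.
Hypothesis ab2 : a2 * b2 = 1.
Hypothesis ab3 : a3 + a4 * b3 = 0.
Hypothesis ab4 : a4 * b4 = 1.

(** Checked on the generators, where it amounts to the inversion of a
    triangular matrix. *)
Lemma tri_mapK : cancel (@tri_map F Gamma Gamma' J a1 a2 a3 a4 chi)
                        (@tri_map F Gamma' Gamma J b1 b2 b3 b4 chi').
Proof.
rewrite /tri_map; set T := tri_var _ _ _ _ _ _; set T' := tri_var _ _ _ _ _ _.
have gD := triD a1 a2 a3 a4; have gD' := triD b1 b2 b3 b4.
have xtK p : xu_map (tri b1 b2 b3 b4) chi' T' (xvar Gamma' J p) = if J p then T' p else 0.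
  case: ifP => Jp; first by rewrite (xu_map_xt _ T' gD' chi0').
  by rewrite xt_out ?Jp // xu_map0.
apply: xu_alg_ind => [a u v IHu IHv|u v IHu IHv|al aG|p Jp].
- by rewrite !xu_mapP IHu IHv.
- by rewrite (xu_mapM T gD triG chiD) (xu_mapM T' gD' triG' chiD') IHu IHv.
- by rewrite xu_map_xg // xu_mapZ xu_map_xg ?triG // triK scalerA chiK scale1r.
rewrite (xu_map_xt _ T gD chi0) //; move: p Jp; apply: ord4P => Jp.
- by rewrite /T /tri_var /= xtK Jp.
- rewrite /T /tri_var /= xu_mapP xu_mapZ !xtK Jp /T' /tri_var /=.
  have -> : (if J p1 then xvar Gamma J p1 else 0) = xvar Gamma J p1.
    by case: ifP => // J1; rewrite xt_out ?J1.
  by rewrite scalerDr addrA !scalerA -scalerDl ab1 ab2 scale0r scale1r add0r.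
- by rewrite /T /tri_var /= xtK Jp.
rewrite /T /tri_var /= xu_mapP xu_mapZ !xtK Jp /T' /tri_var /=.
have -> : (if J p3 then xvar Gamma J p3 else 0) = xvar Gamma J p3.
  by case: ifP => // J3; rewrite xt_out ?J3.
by rewrite scalerDr addrA !scalerA -scalerDl ab3 ab4 scale0r scale1r add0r.
Qed.
End TriangularInverse.

Lemma tri_iso_inZ (F : closedFieldType) (Gamma Gamma' : zmodClosed 'rV[F]_4) (J : jtype)
    (a1 a2 a3 a4 : F) chi u :
  inZ u -> inZ (@tri_iso F Gamma Gamma' J a1 a2 a3 a4 chi u).
Proof.
move=> [c ->]; rewrite /tri_iso /tri_map xu_mapZ; do 2![apply: inZZ].
have [sG|sG] := boolP (sigma1 F \in Gamma); last by rewrite xmon_outl // xu_map0; apply: inZ0.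
by rewrite xu_map_xg // tri_sigma1; apply: inZZ; exists 1; rewrite scale1r.
Qed.

Lemma tri_iso_linear (F : closedFieldType) (Gamma Gamma' : zmodClosed 'rV[F]_4) (J : jtype)
    (a1 a2 a3 a4 : F) chi c u v :
  @tri_iso F Gamma Gamma' J a1 a2 a3 a4 chi (c *: u + v) =
  c *: @tri_iso F Gamma Gamma' J a1 a2 a3 a4 chi u + @tri_iso F Gamma Gamma' J a1 a2 a3 a4 chi v.
Proof. by rewrite /tri_iso /tri_map xu_mapP scalerDr !scalerA mulrC. Qed.

Lemma xu_iso_tri (F : closedFieldType) (char0 : [pchar F] =i pred0)
    (Gamma Gamma' : zmodClosed 'rV[F]_4) (J : jtype) (a1 a2 a3 a4 : F) :
    sigma F \in Gamma -> sigma F \in Gamma' -> a2 != 0 -> a4 != 0 ->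
    (~~ J p1 -> J p2 -> a1 = 0) -> (~~ J p3 -> J p4 -> a3 = 0) ->
    is_group_iso Gamma Gamma' (tri a1 a2 a3 a4) ->
  exists (f : xu_A4 Gamma J -> xu_A4 Gamma' J) g, xu_iso f g.
Proof.
move=> sG sG' a20 a40 a1J a3J [triG _ _ triS].
have [om [omD om0 om1]] := character_exists char0 (mulf_neq0 a20 (invr_neq0 a40)).
pose inv := tri (- a1 / a2) a2^-1 (- a3 / a4) a4^-1.
pose chi (al : 'rV[F]_4) := om (al 0 p1); pose chi' be := (chi (inv be))^-1.
have om_neq0 x : om x != 0.
  by apply/eqP => ox; have := omD x (- x); rewrite subrr ox mul0r om0 => /eqP; rewrite oner_eq0.
have chiD x y : chi (x + y) = chi x * chi y by rewrite /chi mxE omD.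
have chi0 : chi 0 = 1 by rewrite /chi mxE.
have chiD' x y : chi' (x + y) = chi' x * chi' y by rewrite /chi' /inv triD chiD invfM.
have inv0 : inv 0 = 0 by apply: rV4P; rewrite !vec4E !mxE !(mulr0, addr0).
have chi0' : chi' 0 = 1 by rewrite /chi' inv0 chi0 invr1.
have invG x : x \in Gamma' -> inv x \in Gamma.
  by move=> /triS[y yG <-]; rewrite /inv tri_inv.
have chis : chi (sigma F) = a2 / a4 by rewrite /chi sigmaE.
have chis' : chi' (sigma F) = a2^-1 / a4^-1.
  by rewrite /chi' /inv tri_sigma chis invfM.
exists (tri_iso Gamma' a1 a2 a3 a4 chi), (tri_iso Gamma (- a1 / a2) a2^-1 (- a3 / a4) a4^-1 chi'); split.
- exact: tri_iso_linear.
- exact: tri_iso_linear.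
- exact: tri_iso_lie.
- apply: tri_iso_lie => //; rewrite ?invr_eq0 // => J1 J2.
    by rewrite a1J // oppr0 mul0r.
  by rewrite a3J // oppr0 mul0r.
- move=> u; rewrite /tri_iso {1}/tri_map xu_mapZ scalerA invrK divff // scale1r.
  apply: tri_mapK => //; first by move=> x; rewrite tri_inv.
  + by move=> x; rewrite /chi' /inv tri_inv // divff // om_neq0.
  + by field.
  + by field.
  + by field.
  + by field.
- move=> u; rewrite /tri_iso {1}/tri_map xu_mapZ scalerA invrK mulVf // scale1r.
  apply: tri_mapK => //; first by move=> x; rewrite tri_inv'.
  + by move=> x; rewrite /chi' mulVf // om_neq0.
  + by field.
  + by field.
  + by field.
  + by field.
- exact: tri_iso_inZ.
- exact: tri_iso_inZ.
Qed.

(** * The exchange of the two pairs of coordinates *)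

Definition swap4 (p : 'I_4) : 'I_4 :=
  if p == p1 then p3 else if p == p2 then p4 else if p == p3 then p1 else p2.

Lemma swap4K : involutive swap4.
Proof. by apply: ord4P. Qed.

Definition swapv (F : fieldType) (b : 'rV[F]_4) : 'rV[F]_4 :=
  vec4 (b 0 p3) (b 0 p4) (b 0 p1) (b 0 p2).

Lemma swapvE (F : fieldType) (b : 'rV[F]_4) q : swapv b 0 q = b 0 (swap4 q).
Proof. by move: q; apply: ord4P; rewrite /swapv vec4E. Qed.

Lemma swapvD (F : fieldType) (b c : 'rV[F]_4) : swapv (b + c) = swapv b + swapv c.
Proof. by apply: rV4P; rewrite [RHS]mxE !swapvE mxE. Qed.

Lemma swapvN (F : fieldType) (b : 'rV[F]_4) : swapv (- b) = - swapv b.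
Proof. by apply: rV4P; rewrite [RHS]mxE !swapvE mxE. Qed.

Lemma swapv0 (F : fieldType) : swapv (0 : 'rV[F]_4) = 0.
Proof. by apply: rV4P; rewrite swapvE !mxE. Qed.

Lemma swapvK (F : fieldType) : involutive (@swapv F).
Proof. by move=> b; apply: rV4P; rewrite !swapvE swap4K. Qed.

Lemma swapv_sigma (F : fieldType) : swapv (sigma F) = sigma F.
Proof. by apply: rV4P; rewrite swapvE !sigmaE. Qed.

(** [Gamma'] is only assumed to have the right elements, so that the relation
    is symmetric: the exchange applied twice to a subgroup is not convertible
    to this subgroup. *)
Record swapped (F : fieldType) (Gamma Gamma' : zmodClosed 'rV[F]_4) (J J' : jtype) : Prop :=
  Swapped {
    swap_in : forall x, x \in Gamma -> swapv x \in Gamma';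
    swap_in' : forall x, x \in Gamma' -> swapv x \in Gamma;
    swap_J : forall p, J (swap4 p) = J' p
  }.

Lemma swapped_sym (F : fieldType) (Gamma Gamma' : zmodClosed 'rV[F]_4) (J J' : jtype) :
  swapped Gamma Gamma' J J' -> swapped Gamma' Gamma J' J.
Proof. by case=> G1 G2 JE; split=> // p; rewrite -JE swap4K. Qed.

Section Swap.
Context (F : closedFieldType) (Gamma Gamma' : zmodClosed 'rV[F]_4) (J J' : jtype).
Local Notation A := (xu_A4 Gamma J).
Local Notation A' := (xu_A4 Gamma' J').
Local Notation xg alpha := (xmon Gamma J alpha 0).
Local Notation xg' alpha := (xmon Gamma' J' alpha 0).
Local Notation xt' := (@xvar F Gamma' J').
Local Notation d := (@xu_d F Gamma J).
Local Notation d' := (@xu_d F Gamma' J').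
Local Notation sig := (sigma F).
Local Notation sig1 := (sigma1 F).

Definition swap_map : A -> A' :=
  xu_map (fun b => - swapv b) (fun=> 1) (fun p => - xt' (swap4 p)).

(** The factor [xg' (- sig)] makes the image of [1] the element [X] of the
    other algebra, and conversely. *)
Definition swap_iso (u : A) : A' := xg' (- sig) * swap_map u.

Hypothesis sw : swapped Gamma Gamma' J J'.
Hypothesis sigG : sig \in Gamma.

Let gD (x y : 'rV[F]_4) : - swapv (x + y) = - swapv x - swapv y.
Proof. by rewrite swapvD opprD. Qed.

Let gG x : x \in Gamma -> - swapv x \in Gamma'.
Proof. by rewrite rpredN; apply: swap_in sw x. Qed.

Let oneD (x y : 'rV[F]_4) : 1 = 1 * 1 :> F. Proof. by rewrite mulr1. Qed.

Let sigG' : sig \in Gamma'.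
Proof. by rewrite -swapv_sigma; apply: (swap_in sw). Qed.

Lemma swap_map_d q u : d' q (swap_map u) = - swap_map (d (swap4 q) u).
Proof.
transitivity (swap_map (- d (swap4 q) u)); last first.
  by rewrite -!scaleN1r /swap_map xu_mapZ.
apply: (xu_map_derivation (D := fun u => - d (swap4 q) u) (D' := d' q)
  gD gG oneD (erefl 1)) u => [a u v|u v|a u v|u v|al aG|p Jp].
- by rewrite xu_d_linear opprD scalerN.
- by rewrite xu_dM opprD mulNr mulrN.
- exact: xu_d_linear.
- exact: xu_dM.
- by rewrite xu_dZ !xu_dE0 mxE swapvE -scaleNr xu_mapZ xu_map_xg // !scale1r.
rewrite xu_dN !d_xt -?(swap_J sw) ?swap4K // -(inj_eq (can_inj swap4K)) swap4K.
rewrite -[RHS]/(swap_map _) /swap_map -scaleN1r -[in RHS]scaleN1r xu_mapZ; congr (_ *: _).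
by case: eqP => _; rewrite ?xu_map0 // (xu_map1 _ _ _ gD).
Qed.

Lemma swap_iso_linear a u v : swap_iso (a *: u + v) = a *: swap_iso u + swap_iso v.
Proof. by rewrite /swap_iso /swap_map xu_mapP mulrDr -scalerAr. Qed.

Lemma swap_iso_xg alpha : alpha \in Gamma -> swap_iso (xg alpha) = xg' (- sig - swapv alpha).
Proof.
by move=> aG; rewrite /swap_iso /swap_map xu_map_xg // scale1r xgM ?rpredN ?(swap_in sw).
Qed.

Lemma swap_iso_inZ u : inZ u -> inZ (swap_iso u).
Proof.
have s0 : swap_iso 0 = 0 by rewrite /swap_iso /swap_map xu_map0 mulr0.
have sZ a v : swap_iso (a *: v) = a *: swap_iso v.
  by have := swap_iso_linear a v 0; rewrite s0 !addr0.
move=> [c ->]; rewrite sZ; apply: inZZ.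
have [s1G|s1G] := boolP (sig1 \in Gamma); last by rewrite xmon_outl // s0; apply: inZ0.
rewrite swap_iso_xg //; have -> : - sig - swapv sig1 = sig1; last by exists 1; rewrite scale1r.
by apply: rV4P; rewrite !(rvD, rvN) swapvE !sigmaE ?sigma1E /sigma1 ?rvN !singleE /=; ring.
Qed.

Lemma swap_iso_tor s t : swap_iso (torelt Gamma J s t) = torelt Gamma' J' t s.
Proof.
rewrite /torelt -(xg0 Gamma J) -(xg0 Gamma' J') swap_iso_linear.
have := swap_iso_linear t (xg 0) 0; rewrite addr0 => ->.
rewrite !swap_iso_xg ?rpredN ?rpred0 // swapvN swapv_sigma swapv0 subr0 opprK addNr.
have -> : swap_iso 0 = 0 by rewrite /swap_iso /swap_map xu_map0 mulr0.
by rewrite addr0 addrC.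
Qed.

(** The operator [d' p1] takes the image of [u] to minus the image of [u + d
    p3 u], and the image of [u] plus its derivative [d' p3] is minus the
    image of [d p1 u]; so the two summands of the bracket are exchanged. *)
Lemma swap_iso_lie u v : swap_iso [lie u, v] = [lie swap_iso u, swap_iso v].
Proof.
rewrite !bracketE /swap_iso !xu_dM !swap_map_d !xu_dE0 ![(- sig) 0 _]mxE !sigmaE /=.
have mD x y : swap_map (x + y) = swap_map x + swap_map y by apply: xu_mapD.
have mN x : swap_map (- x) = - swap_map x by rewrite -!scaleN1r; apply: xu_mapZ.
have mM x y : swap_map (x * y) = swap_map x * swap_map y.
  by rewrite /swap_map (xu_mapM _ gD gG oneD).
have ms : swap_map (xg sig) = xg' (- sig).
  by rewrite /swap_map xu_map_xg // scale1r swapv_sigma.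
rewrite !(mD, mN, mM, ms) /swap4 /=.
have := xgV (Gamma := Gamma') J' sigG'.
move: (xg' sig) (xg' (- sig)) (swap_map u) (swap_map v) (swap_map (d p1 u)) (swap_map (d p1 v))
  (swap_map (d p2 u)) (swap_map (d p2 v)) (swap_map (d p3 u)) (swap_map (d p3 v))
  (swap_map (d p4 u)) (swap_map (d p4 v)).
move=> s w u0 v0 u1 v1 u2 v2 u3 v3 u4 v4 sw1.
rewrite !oppr0 !scale0r !mul0r !scaleN1r !mulrN.
transitivity (w * (w * (u1 * v2 - v1 * u2)) + (s * w) * w * ((u0 + u3) * v4 - (v0 + v3) * u4)).
  by rewrite sw1; ring.
ring.
Qed.
End Swap.

Section SwapIso.
Context (F : closedFieldType).

Lemma swap_isoK (Gamma Gamma' : zmodClosed 'rV[F]_4) (J J' : jtype) :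
    swapped Gamma Gamma' J J' -> sigma F \in Gamma ->
  cancel (@swap_iso F Gamma Gamma' J J') (@swap_iso F Gamma' Gamma J' J).
Proof.
move=> sw sG; have sw' := swapped_sym sw.
have sG' : sigma F \in Gamma' by rewrite -swapv_sigma; apply: (swap_in sw).
have gD (x y : 'rV[F]_4) : - swapv (x + y) = - swapv x - swapv y.
  by rewrite swapvD opprD.
have gG x : x \in Gamma -> - swapv x \in Gamma' by rewrite rpredN; apply: swap_in sw x.
have gG' x : x \in Gamma' -> - swapv x \in Gamma by rewrite rpredN; apply: swap_in sw' x.
have oneD (x y : 'rV[F]_4) : 1 = 1 * 1 :> F by rewrite mulr1.
move=> u; rewrite /swap_iso /swap_map (xu_mapM _ gD gG' oneD) xu_map_xg ?rpredN //.
rewrite swapvN swapv_sigma opprK scale1r mulrA (mulrC (xmon _ _ _ _)) xgV // mul1r.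
move: u; apply: xu_alg_ind => [a u v IHu IHv|u v IHu IHv|al aG|p Jp].
- by rewrite !xu_mapP IHu IHv.
- by rewrite (xu_mapM _ gD gG oneD) (xu_mapM _ gD gG' oneD) IHu IHv.
- by rewrite xu_map_xg // xu_mapZ xu_map_xg ?gG // swapvN swapvK opprK !scale1r.
rewrite (xu_map_xt _ _ gD) // -scaleN1r xu_mapZ (xu_map_xt _ _ gD) ?swap4K //.
  by rewrite scaleN1r opprK.
by rewrite -(swap_J sw) swap4K.
Qed.

Lemma xu_iso_swap (Gamma Gamma' : zmodClosed 'rV[F]_4) (J J' : jtype) :
    swapped Gamma Gamma' J J' -> sigma F \in Gamma ->
  xu_iso (@swap_iso F Gamma Gamma' J J') (@swap_iso F Gamma' Gamma J' J).
Proof.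
move=> sw sG; have sw' := swapped_sym sw.
have sG' : sigma F \in Gamma' by rewrite -swapv_sigma; apply: (swap_in sw).
split.
- exact: swap_iso_linear.
- exact: swap_iso_linear.
- exact: swap_iso_lie.
- exact: swap_iso_lie.
- exact: swap_isoK.
- exact: swap_isoK.
- exact: swap_iso_inZ.
- exact: swap_iso_inZ.
Qed.

Lemma swapped_exists (Gamma : zmodClosed 'rV[F]_4) (J : jtype) :
  exists (Gamma' : zmodClosed 'rV[F]_4) (J' : jtype), swapped Gamma Gamma' J J'.
Proof.
pose P : {pred 'rV[F]_4} := fun x => swapv x \in Gamma.
have P_closed : zmod_closed P.
  split=> [|x y xP yP]; rewrite unfold_in /P; first by rewrite swapv0 rpred0.
  by rewrite swapvD swapvN rpredB.
pose Gamma' : zmodClosed 'rV[F]_4 := HB.pack P (GRing.isZmodClosed.Build 'rV[F]_4 P P_closed).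
exists Gamma', [ffun p => J (swap4 p)]; split=> [x xG|x|p].
- by change (swapv (swapv x) \in Gamma); rewrite swapvK.
- by [].
- by rewrite ffunE.
Qed.

(** The two clauses on the coordinate pairs are exchanged. *)
Lemma conditionA_swap (Gamma Gamma' : zmodClosed 'rV[F]_4) (J J' : jtype) :
  swapped Gamma Gamma' J J' -> conditionA Gamma -> conditionA Gamma'.
Proof.
move=> sw [sG axG [a aG] [b bG]].
have swS (c : F) p : swapv (single c p) = single c (swap4 p).
  by apply: rV4P; rewrite swapvE !singleE; move: p; apply: ord4P.
split.
- by rewrite -swapv_sigma; apply: (swap_in sw).
- move=> p; have [c c0 cG] := axG (swap4 p); exists c => //.
  by rewrite -[p]swap4K -swS; apply: (swap_in sw).
- by exists b; have := swap_in sw bG; rewrite swapvD !swS.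
- by exists a; have := swap_in sw aG; rewrite swapvD !swS.
Qed.
End SwapIso.

(** * The isomorphism theorem *)

Lemma torZ (F : closedFieldType) (Gamma : zmodClosed 'rV[F]_4) (J : jtype) c s t :
  c *: torelt Gamma J s t = torelt Gamma J (c * s) (c * t).
Proof. by rewrite /torelt scalerDr !scalerA. Qed.

Section Conjugate.
Context (F : closedFieldType).

Lemma corr_swap (Gamma Gamma' Ga Ga' : zmodClosed 'rV[F]_4) (J J' I I' : jtype)
    (R : xu_A4 Gamma J -> xu_A4 Gamma' J' -> Prop) :
    xu_corr R -> sigma F \in Gamma -> sigma F \in Gamma' ->
    swapped Gamma Ga J I -> swapped Gamma' Ga' J' I' ->
  xu_corr (fun b b' => R (@swap_iso F Ga Gamma I J b) (@swap_iso F Ga' Gamma' I' J' b')).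
Proof.
move=> Rc sG sG' sw sw'.
have R1 := xu_corr_sym (corr_comp Rc (xu_iso_swap sw' sG')).
exact: xu_corr_sym (corr_comp R1 (xu_iso_swap sw sG)).
Qed.
End Conjugate.

Section Coordinates.
Context (F : closedFieldType) (char0 : [pchar F] =i pred0).
Context (Gamma Gamma' : zmodClosed 'rV[F]_4) (J J' : jtype).
Local Notation A := (xu_A4 Gamma J).
Local Notation A' := (xu_A4 Gamma' J').
Local Notation tor' := (@torelt F Gamma' J').
Local Notation tor := (@torelt F Gamma J).
Hypothesis GammaA : conditionA Gamma.
Hypothesis GammaA' : conditionA Gamma'.
Variable R : A -> A' -> Prop.
Hypothesis Rcorr : xu_corr R.
Variables (a e : F).
Hypothesis RX : R (tor 1 0) (tor' a 0).
Hypothesis RY : R (tor 0 1) (tor' 0 e).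

(** The coordinates 3 and 4 are the coordinates 1 and 2 for the
    correspondence conjugated by the exchange on both sides, where the
    monomial [alpha] is replaced by [- swapv alpha - sigma]. *)
Lemma corr_coords : exists a1 a3, [/\
    forall alpha alpha' k, monR R alpha alpha' k -> alpha 0 p2 != 0 -> alpha 0 p4 != 0 ->
      alpha' = tri a1 a^-1 a3 e^-1 alpha,
    forall p, J p -> J' p, ~~ J' p1 -> J p2 -> a1 = 0 & ~~ J' p3 -> J p4 -> a3 = 0].
Proof.
have sigG : sigma F \in Gamma by case: GammaA.
have sigG' : sigma F \in Gamma' by case: GammaA'.
have a0 := diag_a0 GammaA Rcorr RX RY; have e0 := diag_e0 GammaA Rcorr RX RY.
have [a1 [co1 J1 J2 a1J]] := corr_first char0 GammaA GammaA' Rcorr RX RY.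
have [Ga [I sw]] := swapped_exists Gamma J.
have [Ga' [I' sw']] := swapped_exists Gamma' J'.
have GaA := conditionA_swap sw GammaA; have GaA' := conditionA_swap sw' GammaA'.
have sGa : sigma F \in Ga by case: GaA.
have sGa' : sigma F \in Ga' by case: GaA'.
have swi := swapped_sym sw; have swi' := swapped_sym sw'.
have R2c := corr_swap Rcorr sigG sigG' sw sw'; set R2 := fun b b' => _ in R2c.
have R2X : R2 (torelt Ga I 1 0) (torelt Ga' I' e 0) by rewrite /R2 !swap_iso_tor.
have R2Y : R2 (torelt Ga I 0 1) (torelt Ga' I' 0 a) by rewrite /R2 !swap_iso_tor.
have [a3 [co3 J3 J4 a3J]] := corr_first char0 GaA GaA' R2c R2X R2Y.
have IE p : I p = J (swap4 p) by rewrite (swap_J sw).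
have IE' p : I' p = J' (swap4 p) by rewrite (swap_J sw').
rewrite !IE !IE' /= in J3 J4 a3J.
exists a1, a3; split=> //; last by apply: ord4P.
move=> al al' k H al2 al4; have [E1 E2 E4] := co1 _ _ _ H al2.
have [aG aG' k0 Rk] := H.
have mon2 : monR R2 (- swapv al - sigma F) (- swapv al' - sigma F) k.
  split=> //; first by rewrite rpredB ?rpredN // (swap_in sw).
    by rewrite rpredB ?rpredN // (swap_in sw').
  rewrite /R2 swap_iso_xg ?rpredB ?rpredN ?(swap_in sw) //.
  have -> : @swap_iso F Ga' Gamma' I' J' (k *: xmon Ga' I' (- swapv al' - sigma F) 0) =
     k *: swap_iso Gamma' J' (xmon Ga' I' (- swapv al' - sigma F) 0).
    have := swap_iso_linear Gamma' J' k (xmon Ga' I' (- swapv al' - sigma F) 0) 0.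
    rewrite addr0 => ->; rewrite -[RHS]addr0; congr (_ + _).
    by rewrite /swap_iso /swap_map xu_map0 mulr0.
  rewrite swap_iso_xg ?rpredB ?rpredN ?(swap_in sw') //.
  have sK b : - sigma F - swapv (- swapv b - sigma F) = b.
    by rewrite swapvD !swapvN swapvK swapv_sigma opprD !opprK addrCA addNr addr0.
  by rewrite !sK.
have := co3 _ _ _ mon2; rewrite !rvD !rvN !swapvE !sigmaE !subr0 oppr_eq0 => /(_ al4)[E3 _ _].
apply: rV4P; rewrite vec4E //.
- by rewrite E2 mulKf.
- by apply: oppr_inj; apply: (addIr (-1)); rewrite E3; ring.
- by rewrite E4 mulKf.
Qed.
End Coordinates.

Section Diagonal.
Context (F : closedFieldType) (char0 : [pchar F] =i pred0).

Lemma axis_avoid (Gamma : zmodClosed 'rV[F]_4) (GammaA : conditionA Gamma) p (x : F) :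
  exists n, [/\ n != 0, single n p \in Gamma & x + n != 0].
Proof.
have [n n0 nG] := axis_exists GammaA p.
have [xn|xn] := eqVneq (x + n) 0; last by exists n.
have nn : n + n != 0 by rewrite -mulr2n -mulr_natr mulf_neq0 // (natf_eq0_char0 char0).
exists (n + n); split=> //; first by rewrite single_dbl rpredD.
by rewrite addrA xn add0r.
Qed.

(** An arbitrary [x] is the difference of [x + M] and [M], for a sum [M] of
    elements of the second and the fourth axis whose coordinates avoid [0]
    and those of [- x]. *)
Lemma generic_ind (Gamma : zmodClosed 'rV[F]_4) (GammaA : conditionA Gamma) (P : 'rV[F]_4 -> Prop) :
    (forall x, x \in Gamma -> x 0 p2 != 0 -> x 0 p4 != 0 -> P x) ->
    (forall x y, P x -> P y -> P (x - y)) ->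
  forall x, x \in Gamma -> P x.
Proof.
move=> Pgen PB x xG.
have [n [n0 nG xn]] := axis_avoid GammaA p2 (x 0 p2).
have [m [m0 mG xm]] := axis_avoid GammaA p4 (x 0 p4).
have MG : single n p2 + single m p4 \in Gamma by rewrite rpredD.
rewrite -[x](addrK (single n p2 + single m p4)); apply: (PB); apply: Pgen => //.
- by rewrite rpredD.
- by rewrite !rvD !singleE /= ?(addr0, add0r).
- by rewrite !rvD !singleE /= ?(addr0, add0r).
- by rewrite !rvD !singleE /= ?(addr0, add0r).
- by rewrite !rvD !singleE /= ?(addr0, add0r).
Qed.

Context (Gamma Gamma' : zmodClosed 'rV[F]_4) (J J' : jtype).
Local Notation A := (xu_A4 Gamma J).
Local Notation A' := (xu_A4 Gamma' J').
Local Notation tor' := (@torelt F Gamma' J').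
Local Notation tor := (@torelt F Gamma J).
Hypothesis GammaA : conditionA Gamma.
Hypothesis GammaA' : conditionA Gamma'.
Variable R : A -> A' -> Prop.
Hypothesis Rcorr : xu_corr R.
Variables (a e : F).
Hypothesis RX : R (tor 1 0) (tor' a 0).
Hypothesis RY : R (tor 0 1) (tor' 0 e).

(** The exponents outside the two coordinate hyperplanes are matched by
    monomials in both directions, and they generate the groups. *)
Lemma corr_diagonal : exists a1 a3,
  [/\ J = J', ~~ J p1 -> J p2 -> a1 = 0, ~~ J p3 -> J p4 -> a3 = 0
    & is_group_iso Gamma Gamma' (tri a1 a^-1 a3 e^-1)].
Proof.
have a0 := diag_a0 GammaA Rcorr RX RY; have e0 := diag_e0 GammaA Rcorr RX RY.
have Rs := xu_corr_sym Rcorr.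
have RX' : R (tor a^-1 0) (tor' 1 0).
  by have := corrZ Rcorr a^-1 RX; rewrite !torZ mulr1 mulVf // mulr0.
have RY' : R (tor 0 e^-1) (tor' 0 1).
  by have := corrZ Rcorr e^-1 RY; rewrite !torZ mulr1 mulVf // mulr0.
have [a1 [a3 [co JJ' a1J a3J]]] := corr_coords char0 GammaA GammaA' Rcorr RX RY.
have [_ [_ [_ J'J _ _]]] := corr_coords char0 GammaA' GammaA Rs RX' RY'.
have JE : J = J'.
  by apply/ffunP=> p; apply/idP/idP; [apply: JJ'|apply: J'J].
have w0 (x : 'rV[F]_4) : x 0 p2 != 0 -> (x 0 p2, x 0 p4) <> (0, 0).
  by move=> x2 [/eqP]; rewrite (negPf x2).
have phiB x y : tri a1 a^-1 a3 e^-1 (x - y) = tri a1 a^-1 a3 e^-1 x - tri a1 a^-1 a3 e^-1 y.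
  by apply/(addIr (tri a1 a^-1 a3 e^-1 y)); rewrite -triD !subrK.
have {}a1J : ~~ J p1 -> J p2 -> a1 = 0 by rewrite {1}JE.
have {}a3J : ~~ J p3 -> J p4 -> a3 = 0 by rewrite {1}JE.
exists a1, a3; split=> //; split.
- apply: (generic_ind GammaA) => [x xG x2 x4|x y xG yG]; last by rewrite phiB rpredB.
  have [x' [k H]] := monR_exists char0 GammaA GammaA' Rcorr RX RY xG (w0 _ x2).
  by rewrite -(co _ _ _ H x2 x4); case: H.
- by move=> x y _ _; apply: triD.
- move=> x y _ _ E; rewrite -[x](@tri_inv _ a1 a^-1 a3 e^-1) ?invr_eq0 // E.
  by rewrite tri_inv ?invr_eq0.
apply: (generic_ind GammaA') => [y yG y2 y4|_ _ [x xG <-] [y yG <-]]; last first.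
  by exists (x - y); rewrite ?rpredB.
have [x [k H]] := monR_exists char0 GammaA' GammaA Rs RX' RY' yG (w0 _ y2).
have [x2 x4] := monR_weight GammaA' GammaA Rs RX' RY' H (w0 _ y2).
have [_ xG k0 Rk] := H.
exists x => //; apply/esym; apply: (co _ _ k^-1).
- split=> //; first by rewrite invr_eq0.
  by have := corrZ Rcorr k^-1 Rk; rewrite scalerA mulVf // scale1r.
- by apply: contraNneq y2 => x20; rewrite x2 x20 mulr0.
- by apply: contraNneq y4 => x40; rewrite x4 x40 mulr0.
Qed.
End Diagonal.

Theorem theorem3p2 (F : closedFieldType) (char0 : [pchar F] =i pred0)
    (Gamma Gamma' : zmodClosed 'rV[F]_4)
    (GammaA : conditionA Gamma) (GammaA' : conditionA Gamma')
    (J J' : jtype) :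
  lie_isomorphic (xu_B Gamma J) (xu_B Gamma' J') <->
  exists a1 a2 a3 a4 : F,
    [/\ a2 != 0, a4 != 0,
        (~~ J p1 -> J p2 -> a1 = 0),
        (~~ J p3 -> J p4 -> a3 = 0)
      & (J = J' /\
         is_group_iso Gamma Gamma'
           (fun b => vec4 (b 0 p1 + a1 * b 0 p2) (a2 * b 0 p2)
                          (b 0 p3 + a3 * b 0 p4) (a4 * b 0 p4)))
        \/
        ([/\ J p1 = J' p3, J p2 = J' p4, J p3 = J' p1 & J p4 = J' p2] /\
         is_group_iso Gamma Gamma'
           (fun b => vec4 (b 0 p3 + a3 * b 0 p4) (a4 * b 0 p4)
                          (b 0 p1 + a1 * b 0 p2) (a2 * b 0 p2)))].
Proof.
have sG : sigma F \in Gamma by case: GammaA.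
have sG' : sigma F \in Gamma' by case: GammaA'.
have swtri a1 a2 a3 a4 b : swapv (tri a1 a2 a3 a4 b) =
    vec4 (b 0 p3 + a3 * b 0 p4) (a4 * b 0 p4) (b 0 p1 + a1 * b 0 p2) (a2 * b 0 p2).
  by rewrite /swapv !vec4E.
split; last first.
  move=> [a1 [a2 [a3 [a4 [a20 a40 a1J a3J [[JE iso]|[[J1 J2 J3 J4] iso]]]]]]].
    case: _ / JE in iso *.
    by have [f [g fg]] := xu_iso_tri char0 sG sG' a20 a40 a1J a3J iso; apply: (xu_B_iso fg).
(* Case (ii) is case (i) for the exchanged group, followed by the exchange. *)
  have [Ga [I sw]] := swapped_exists Gamma' J'.
  have swi := swapped_sym sw.
  have sGa : sigma F \in Ga by rewrite -swapv_sigma; apply: (swap_in sw).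
  have IE : J = I.
    by apply/ffunP; apply: ord4P; rewrite -(swap_J sw).
  case: _ / IE in sw swi *.
  have isoGa : is_group_iso Gamma Ga (tri a1 a2 a3 a4).
    case: iso => iG _ _ iS; split=> [x xG||x y _ _ E|y yG].
    - by rewrite -[tri _ _ _ _ _]swapvK swtri; apply: (swap_in sw); apply: iG.
    - by move=> x y _ _; apply: triD.
    - by rewrite -[x](@tri_inv _ a1 a2 a3 a4) // E tri_inv.
    have [x xG E] := iS _ (swap_in' sw yG); exists x => //.
    by apply: (can_inj (@swapvK F)); rewrite swtri.
  have [f [g fg]] := xu_iso_tri char0 sG sGa a20 a40 a1J a3J isoGa.
  exact: (xu_B_iso (xu_iso_comp fg (xu_iso_swap swi sGa))).
move=> /corr_of_iso[R Rc].
have [a [b RX]] := corr_tor char0 GammaA' Rc (lfin_tor10 sG) (tor_inD char0 _ GammaA 1 0).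
have [c [e RY]] := corr_tor char0 GammaA' Rc (lfin_tor01 sG) (tor_inD char0 _ GammaA 0 1).
case: (corr_lines char0 GammaA GammaA' Rc RX RY) => -[E1 E2]; rewrite E1 E2 in RX RY.
  have [a1 [a3 [JE a1J a3J iso]]] := corr_diagonal char0 GammaA GammaA' Rc RX RY.
  exists a1, a^-1, a3, e^-1; split=> //; last by left.
    by rewrite invr_eq0 (diag_a0 GammaA Rc RX RY).
  by rewrite invr_eq0 (diag_e0 GammaA Rc RX RY).
(* Composition with the exchange makes the correspondence diagonal. *)
have [Ga [I sw]] := swapped_exists Gamma' J'.
have swi := swapped_sym sw; have GaA := conditionA_swap sw GammaA'.
have sGa : sigma F \in Ga by case: GaA.
have Rc2 := corr_comp Rc (xu_iso_swap sw sG'); set R2 := fun x y => _ in Rc2.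
have R2X : R2 (torelt Gamma J 1 0) (torelt Ga I b 0) by rewrite /R2 swap_iso_tor.
have R2Y : R2 (torelt Gamma J 0 1) (torelt Ga I 0 c) by rewrite /R2 swap_iso_tor.
have [a1 [a3 [JE a1J a3J iso]]] := corr_diagonal char0 GammaA GaA Rc2 R2X R2Y.
exists a1, b^-1, a3, c^-1; split=> //.
- by rewrite invr_eq0 (diag_a0 GammaA Rc2 R2X R2Y).
- by rewrite invr_eq0 (diag_e0 GammaA Rc2 R2X R2Y).
right; split; first by rewrite JE -!(swap_J sw).
case: iso => iG _ iI iS; split=> [x xG|x y _ _|x y xG yG|y yG].
- by rewrite -swtri; apply: (swap_in' sw); apply: iG.
- by rewrite -!swtri triD swapvD.
- by rewrite -!swtri => /(can_inj (@swapvK F)); apply: iI.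
have [x xG E] := iS _ (swap_in sw yG); exists x => //.
by rewrite -swtri E swapvK.
Qed.
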